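(* There is a function $\delta(n)$ with $\delta(n)\to 0$ as $n\to\infty$ such that for every $n$ there exists a triangle-free graph $G$ on $n$ vertices with \[ i(G) \leq e^{(1+\delta(n))(1+\ln 2)\sqrt{n}\ln n}. \]
   Context: For a graph $G$, $i(G)$ denotes the number of independent sets in $G$ (sets of vertices no two of which are adjacent, including the empty set). All logarithms are natural logarithms.
   Formalization: The claim is proved for every n ≥ 2: at n = 1 the only graph has i(G) = 2 while the right-hand side is e^0 = 1 whatever δ(1) is, and at n = 0 the quantity ln n is undefined. *)

(* Defs.v *)
From mathcomp Require Import all_boot.

Set Implicit Arguments.
Unset Strict Implicit.
Unset Printing Implicit Defensive.

Record sgraph (T : finType) := SGraph {
  adj : rel T;
  adj_sym : symmetric adj;
  adj_irrefl : irreflexive adj }.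

Definition triangle_free (T : finType) (G : sgraph T) : Prop :=
  forall x y z : T, ~ [/\ adj G x y, adj G y z & adj G x z].

Definition independent (T : finType) (G : sgraph T) (S : {set T}) : bool :=
  [forall x in S, forall y in S, ~~ adj G x y].

Definition num_indep (T : finType) (G : sgraph T) : nat :=
  #|[set S : {set T} | independent G S]|.

(* Main.v *)
(** Let [h] be a triangle-free graph on [m = n / (ln n)^40] vertices, obtained from a random
    graph of density [p = ln n / (10 sqrt n)] by deleting the edges of a maximal family of
    edge-disjoint triangles. On the [m^2] pairs, join [(x, y)] to [(x', y')] in red if [x] is
    adjacent to [x'] and [y], [y'] have no common neighbour, and in blue if the same holds
    with the coordinates exchanged: two edges of one colour that meet in a point create a
    common neighbour, which forbids the third edge of the other colour, so the product is
    triangle-free.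

    Deleting vertices one by one at random finds [n] pairs which span at most [Z(n / m^2)]
    independent sets, where [Z(q)] is the hard-core partition function of the product at
    fugacity [q]. If every set [S] of more than [M] vertices has a vertex with [r |S|]
    neighbours in [S], the recursion [Z_S <= Z_(S-v) + q Z_(S-v-N(v))] gives
    [Z <= exp (q M + ln (r q m^2)^2 / (2 r))]. It is used with [r = 3p/2] for [|S|] at least
    [m sqrt n (ln n)^3], where both colours have almost full density, and with
    [r = p/10000] from there down to [|S|] about [6.93 p m^2] (the pairs whose first
    coordinate lies in one neighbourhood form an independent set of size [p m^2]). The
    resulting exponent is less than [1.57 sqrt n ln n], so that one can take [delta n = 0]
    for large [n]. *)

Require Import Defs.
From mathcomp Require Import all_boot all_order all_algebra.
From mathcomp Require Import ring lra.

Set Implicit Arguments.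
Unset Strict Implicit.
Unset Printing Implicit Defensive.

Import Order.TTheory GRing.Theory Num.Theory.
Local Open Scope ring_scope.

(** * The hard-core partition function *)

(** The obstacle is a set [S] carried by tall columns, where pairs of columns sharing a neighbour
    are lost. An edge costs about [n^(-1/2)], so three edges from a column into a small set of hubs
    beat the [n] choices of the column, while two do not. A typical column may thus see two hubs,
    and the lost weight is about [2 D m |S|], harmless once [|S|] is at least [3 D m]. Asking this
    of the part of [S] in tall columns or in tall rows costs a factor slightly above 2 and leads to
    [63/10 D m], about [6.93 p m^2]. With [p = c ln n / sqrt n] the exponent, in units of
    [sqrt n ln n], is then about [6.93 c + 1 / (12 c)], minimal near [c = 0.11]; hence the choice
    [c = 1/10]. The factor [(ln n)^40] between [n] and [m] makes [p^2 m] tiny, so common neighbours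
    are rare and few edges are lost to triangles. Yet the set sizes from [p m^2] to
    [m sqrt n (ln n)^3] differ only by a power of [ln n]: the logarithm in the growth bound is
    [O(ln ln n)] there, and the weak constant [p/10000] is affordable. *)

Definition hardcore (R : realFieldType) (T : finType) (G : sgraph T) (q : R)
    (S : {set T}) : R :=
  \sum_(I : {set T} | independent G I && (I \subset S)) q ^+ #|I|.

Lemma independentS (T : finType) (G : sgraph T) (I J : {set T}) :
  I \subset J -> independent G J -> independent G I.
Proof.
move=> sIJ /forall_inP hJ; apply/forall_inP => x xI; apply/forall_inP => y yI.
by move: (hJ x (subsetP sIJ x xI)) => /forall_inP; apply; apply: (subsetP sIJ).
Qed.

Lemma hardcore_rec (R : realFieldType) (T : finType) (G : sgraph T) (q : R)
    (S : {set T}) (v : T) :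
  0 <= q -> v \in S ->
  hardcore G q S <= hardcore G q (S :\ v) +
                    q * hardcore G q ((S :\ v) :\: [set w | adj G v w]).
Proof.
move=> q0 vS; rewrite {1}/hardcore (bigID (fun I : {set T} => v \in I)) /= addrC.
apply: lerD.
  rewrite le_eqVlt; apply/orP; left; apply/eqP; apply: eq_bigl => I.
  by rewrite subsetD1 -andbA.
rewrite /hardcore mulr_sumr.
rewrite [X in _ <= X](_ : _ = \sum_(J : {set T} | independent G J &&
   (J \subset (S :\ v) :\: [set w | adj G v w])) q ^+ #|v |: J|); last first.
  apply: eq_bigr => J /andP[_ /subsetP sJ].
  rewrite cardsU1 -exprS; case vJ: (v \in J) => //=.
  by move: (sJ v vJ); rewrite !inE eqxx /= andbF.
(* Sets containing [v] are [v |: J] with [J] free of [v] and of its neighbours; the extra vertex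
   supplies the factor [q]. *)
rewrite (reindex_onto (fun J : {set T} => v |: J) (fun I => I :\ v)) /=; last first.
  by move=> I /andP[_ vI]; rewrite setD1K.
rewrite [X in X <= _]big_mkcond [X in _ <= X]big_mkcond /=.
apply: ler_sum => J _; case: ifP => [|_]; last first.
  by case: ifP => // _; rewrite exprn_ge0.
move=> /andP[/andP[/andP[iJ sJ] _] /eqP eJ].
have vJ : v \notin J by rewrite -eJ !inE eqxx.
have -> : independent G J by apply: independentS iJ; apply: subsetUr.
rewrite /= ifT //; apply/subsetP => w wJ; rewrite !inE.
have -> : w != v by apply: contraNneq vJ => <-.
rewrite (subsetP sJ) ?inE ?wJ ?orbT //= ?andbT.
have vV : v \in v |: J by rewrite !inE eqxx.
have wV : w \in v |: J by rewrite !inE wJ orbT.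
by move: iJ => /forall_inP/(_ v vV)/forall_inP/(_ w wV).
Qed.

Lemma sum_ge_exists (R : realFieldType) (T : finType) (S : {set T}) (F : T -> R) (c : R) :
  S != set0 -> \sum_(v in S) F v <= #|S|%:R * c -> exists2 v, v \in S & F v <= c.
Proof.
move=> S0 hs; case: (pickP (fun v => (v \in S) && (F v <= c))) => [v /andP[vS Fv]|h].
  by exists v.
suff : \sum_(v in S) c < \sum_(v in S) F v.
  by rewrite sumr_const -[c *+ _]mulr_natl ltNge hs.
have [v0 v0S] := set0Pn _ S0.
apply: ltr_sum; first by apply/hasP; exists v0 => //; rewrite mem_index_enum.
by move=> v vS; move: (h v); rewrite vS /= ltNge => ->.
Qed.

Lemma bernoulli_inv (R : realFieldType) (s k : nat) :
  (1 < s)%N -> (1 - k%:R / s%:R <= (1 - s%:R^-1) ^+ k :> R).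
Proof.
move=> s1; have s0 : (0 : R) < s%:R by rewrite ltr0n; case: s s1.
have hs : s%:R^-1 <= 1 :> R by rewrite invf_le1 // ler1n; case: s s1 {s0}.
have hp : 0 < s%:R^-1 :> R by rewrite invr_gt0.
elim: k => [|k IH]; first by rewrite mul0r subr0 expr0.
rewrite exprS -natr1 mulrDl mul1r.
apply: (@le_trans _ _ ((1 - s%:R^-1) * (1 - k%:R / s%:R))).
  have : 0 <= k%:R / s%:R :> R by rewrite divr_ge0.
  have : 0 <= k%:R / s%:R * s%:R^-1 :> R by apply: mulr_ge0; [exact: divr_ge0 | rewrite invr_ge0].
  move: (k%:R / s%:R) hs hp => a; move: (s%:R^-1) => b; nra.
by apply: ler_wpM2l => //; lra.
Qed.

(* Averaging over [v] keeps each set [I] with probability [1 - |I|/|S| <= (1 - 1/|S|)^|I|]. *)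
Lemma hardcore_delete (R : realFieldType) (T : finType) (G : sgraph T) (q : R)
    (S : {set T}) :
  0 <= q -> (1 < #|S|)%N ->
  exists2 v, v \in S &
    hardcore G (q * #|S|%:R / (#|S|.-1)%:R) (S :\ v) <= hardcore G q S.
Proof.
move=> q0 S1; set s := #|S|; set q' := q * _ / _.
have s0 : (0 : R) < s%:R by rewrite ltr0n /s; case: #|S| S1.
have s10 : (0 : R) < s.-1%:R by rewrite ltr0n /s; case: #|S| S1 => [|[]].
have sE : s%:R = s.-1%:R + 1 :> R by rewrite natr1 prednK // /s; case: #|S| S1.
have q'0 : 0 <= q' by rewrite /q' !mulr_ge0 // ?invr_ge0 ltW.
apply: sum_ge_exists; first by rewrite -card_gt0; apply: ltn_trans S1.
rewrite -/s /hardcore; under eq_bigr do rewrite big_mkcond /=.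
rewrite exchange_big /= mulr_sumr [X in _ <= X]big_mkcond /=.
apply: ler_sum => I _; rewrite -big_mkcondr /= sumr_const.
case: (boolP (independent G I && (I \subset S))) => [/andP[iI sI]|nI]; last first.
  rewrite [X in _ *+ X](_ : _ = 0%N) ?mulr0n //; apply: eq_card0 => v; rewrite !inE; apply/negbTE.
  by apply: contra nI; move=> /andP[vS /andP[-> /subset_trans->]] //; apply: subsetDl.
rewrite [X in _ *+ X](_ : _ = (s - #|I|)%N); last first.
  rewrite /s -(cardsDS sI); apply: eq_card => v.
  by rewrite [RHS]inE unfold_in /= iI /= subsetD1 sI /= andbC.
have leI : (#|I| <= s)%N by apply: subset_leq_card.
rewrite -[_ *+ (s - _)]mulr_natr natrB //.
(* The new fugacity is fixed by [q' (1 - 1/s) = q], so Bernoulli's bound on the survival probability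
   of [I] is absorbed exactly. *)
have -> : q ^+ #|I| = q' ^+ #|I| * (1 - s%:R^-1) ^+ #|I|.
  rewrite -exprMn; congr (_ ^+ _); rewrite /q'.
  have -> : 1 - s%:R^-1 = s.-1%:R / s%:R :> R.
    by rewrite sE; field; rewrite -sE gt_eqF.
  by field; rewrite !gt_eqF.
rewrite mulrCA; apply: ler_wpM2l; first by rewrite exprn_ge0.
have -> : s%:R - #|I|%:R = s%:R * (1 - #|I|%:R / s%:R) :> R.
  by field; rewrite gt_eqF.
by apply: ler_wpM2l; [exact: ltW | apply: bernoulli_inv].
Qed.

(** The factors [s / (s - 1)] of the successive deletions telescope. Started at [q = n / (n + k)],
    the fugacity ends at exactly 1, where the partition function counts independent sets. *)
Lemma hardcore_sparsify (R : realFieldType) (T : finType) (G : sgraph T) (n k : nat)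
    (S : {set T}) (q : R) :
  (0 < n)%N -> #|S| = (n + k)%N -> 0 <= q ->
  exists V : {set T}, #|V| = n /\
    hardcore G (q * (n + k)%:R / n%:R) V <= hardcore G q S.
Proof.
move=> n0; have n0R : (n%:R : R) != 0 by rewrite pnatr_eq0 -lt0n.
elim: k S q => [|k IH] S q cS q0.
  by exists S; split; [rewrite cS addn0 | rewrite addn0 mulfK].
have S1 : (1 < #|S|)%N by rewrite cS addnS ltnS addn_gt0 n0.
have [v vS hv] := hardcore_delete G q0 S1.
have cSv : #|S :\ v| = (n + k)%N.
  by apply: succn_inj; rewrite -addnS -cS (cardsD1 v S) vS.
have q'0 : 0 <= q * #|S|%:R / #|S|.-1%:R by rewrite !mulr_ge0 ?invr_ge0.
have [V [cV hV]] := IH _ _ cSv q'0; exists V; split=> //.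
apply: le_trans hv; apply: le_trans hV; rewrite cS addnS /=.
have nk : ((n + k)%:R : R) != 0 by rewrite pnatr_eq0 -lt0n addn_gt0 n0.
by rewrite -[q * _ / (n + k)%:R * _]mulrA mulVf // mulr1.
Qed.

Definition pullback_graph (T U : finType) (G : sgraph T) (f : U -> T) : sgraph U :=
  @SGraph U (fun i j => adj G (f i) (f j))
    (fun i j => adj_sym G (f i) (f j)) (fun i => adj_irrefl G (f i)).

Lemma pullback_triangle_free (T U : finType) (G : sgraph T) (f : U -> T) :
  triangle_free G -> triangle_free (pullback_graph G f).
Proof. by move=> tf x y z /= h; apply: (tf (f x) (f y) (f z)). Qed.

Lemma num_indep_pullback (R : realFieldType) (T U : finType) (G : sgraph T) (f : U -> T)
    (V : {set T}) :
  injective f -> (forall i, f i \in V) ->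
  (num_indep (pullback_graph G f))%:R <= hardcore G (1 : R) V.
Proof.
move=> injf fV; rewrite /hardcore; under eq_bigr do rewrite expr1n.
rewrite sumr_const ler_nat /num_indep -(card_imset _ (imset_inj injf)).
apply/subset_leq_card/subsetP => J /imsetP[I]; rewrite inE => iI ->.
apply/andP; split; last first.
  by apply/subsetP => _ /imsetP[i _ ->].
apply/forall_inP => _ /imsetP[i iI' ->]; apply/forall_inP => _ /imsetP[j jI ->].
by move: iI => /forall_inP/(_ i iI')/forall_inP/(_ j jI).
Qed.

Lemma exists_sparse_pullback (R : realFieldType) (T : finType) (G : sgraph T) (n : nat) :
  (0 < n)%N -> (n <= #|T|)%N -> triangle_free G ->
  exists G' : sgraph 'I_n, triangle_free G' /\
    (num_indep G')%:R <= hardcore G (n%:R / #|T|%:R : R) [set: T].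
Proof.
move=> n0 nT tf.
have cT : #|[set: T]| = (n + (#|T| - n))%N by rewrite cardsT subnKC.
have q0 : 0 <= n%:R / #|T|%:R :> R by rewrite divr_ge0.
have [V [cV hV]] := hardcore_sparsify G n0 cT q0.
have vn (i : 'I_n) : (i < #|V|)%N by rewrite cV.
pose f (i : 'I_n) : T := enum_val (cast_ord (esym cV) i).
have injf : injective f by move=> i j /enum_val_inj /cast_ord_inj.
exists (pullback_graph G f); split; first exact: pullback_triangle_free.
apply: le_trans (num_indep_pullback _ _ injf _) _; last first.
  rewrite subnKC // in hV; apply: le_trans hV.
  rewrite divfK ?divff // ?pnatr_eq0 -lt0n ?(leq_trans n0) //.
by move=> i; apply: enum_valP.
Qed.

(** All edges are ignored here. With [1 + q <= exp q] this is the bound for sets below the size at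
    which degrees are controlled, and the source of the term [q M]. *)
Lemma hardcore_le_expn (R : realFieldType) (T : finType) (G : sgraph T) (q : R) S :
  0 <= q -> hardcore G q S <= (1 + q) ^+ #|S|.
Proof.
move=> q0; move: {2}#|S| (leqnn #|S|) => n; elim: n S => [|n IH] S cS.
  move: cS; rewrite leqn0 cards_eq0 => /eqP->.
  rewrite cards0 expr0 /hardcore (big_pred1 set0) ?cards0 ?expr0 // => I.
  rewrite /= subset0; case: eqP => [->|]; last by rewrite andbF.
  by rewrite andbT; apply/forall_inP => x; rewrite inE.
case: (set_0Vmem S) => [->|[v vS]].
  by apply: IH; rewrite cards0.
apply: le_trans (hardcore_rec G q0 vS) _.
have cv : #|S :\ v| = #|S|.-1 by rewrite (cardsD1 v S) vS.
have S0 : (0 < #|S|)%N by apply/card_gt0P; exists v.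
have le1 : (#|S :\ v| <= n)%N by rewrite cv -ltnS prednK.
have le2 : (#|(S :\ v) :\: [set w | adj G v w]| <= #|S :\ v|)%N.
  by apply/subset_leq_card/subsetDl.
rewrite -(prednK S0) exprS mulrDl mul1r -cv lerD ?IH //.
apply: ler_wpM2l => //; apply: le_trans (IH _ (leq_trans le2 le1)) _.
by apply: ler_weXn2l => //; rewrite lerDl.
Qed.

(** * Random edge sets *)

Section RandomSet.
Variables (R : realFieldType) (E : finType) (p : R).
Hypothesis p0 : 0 <= p.
Hypothesis p1 : p <= 1.

(** The product measure that keeps each element independently with probability [p]. Probability is
    reduced to finite weighted sums, so that existence statements follow from first moments. *)
Definition set_weight (S : {set E}) : R := \prod_e (if e \in S then p else 1 - p).
Definition expect (f : {set E} -> R) : R := \sum_(S : {set E}) set_weight S * f S.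

Lemma set_weight_ge0 S : 0 <= set_weight S.
Proof. by apply: prodr_ge0 => e _; case: ifP => _ //; rewrite subr_ge0. Qed.

Lemma expect_prod (a b : E -> R) :
  expect (fun S => \prod_e (if e \in S then a e else b e)) =
  \prod_e (p * a e + (1 - p) * b e).
Proof.
rewrite bigA_distr; apply: eq_bigr => S _; rewrite -big_split /=.
by apply: eq_bigr => e _; case: ifP.
Qed.

Lemma expect_sum (I : finType) (P : pred I) (f : I -> {set E} -> R) :
  expect (fun S => \sum_(i | P i) f i S) = \sum_(i | P i) expect (f i).
Proof. by rewrite [RHS]exchange_big /=; apply: eq_bigr => S _; rewrite mulr_sumr. Qed.

Lemma expectZ (c : R) (f : {set E} -> R) : expect (fun S => f S * c) = expect f * c.
Proof. by rewrite mulr_suml; apply: eq_bigr => S _; rewrite mulrA. Qed.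

Lemma expectD (f g : {set E} -> R) : expect (fun S => f S + g S) = expect f + expect g.
Proof. by rewrite -big_split; apply: eq_bigr => S _; rewrite mulrDr. Qed.

Lemma expect_lt1 (f : {set E} -> R) : expect f < 1 -> exists S, f S < 1.
Proof.
move=> h; case: (pickP (fun S => f S < 1)) => [S fS|n]; first by exists S.
suff : 1 <= expect f by rewrite leNgt h.
have <- : expect (fun=> 1) = 1.
  transitivity (expect (fun S => \prod_e (if e \in S then 1 else 1))).
    by apply: eq_bigr => S _; rewrite big1 // => e _; case: ifP.
  by rewrite expect_prod big1 // => e _; lra.
apply: ler_sum => S _; apply: ler_wpM2l; first exact: set_weight_ge0.
by rewrite leNgt n.
Qed.

Lemma prod_pow (T : finType) (F : {set T}) (x : R) :
  \prod_(e : T) (if e \in F then x else 1) = x ^+ #|F|.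
Proof. by rewrite -big_mkcond /= prodr_const. Qed.

(** The binomial moment generating function: [t < 1] gives lower tail tests, [t > 1] upper tail
    tests. *)
Lemma expect_exp (F : {set E}) (t : R) :
  expect (fun S => t ^+ #|S :&: F|) = (p * t + (1 - p)) ^+ #|F|.
Proof.
rewrite -prod_pow [RHS](_ : _ = \prod_e (p * (if e \in F then t else 1) + (1 - p) * 1)).
  rewrite -expect_prod; apply: eq_bigr => S _; congr (_ * _); rewrite -prod_pow.
  by apply: eq_bigr => e _; rewrite inE; case: (e \in S).
by apply: eq_bigr => e _; case: ifP => _; rewrite ?mulr1 //; ring.
Qed.

Lemma expect_sub (F : {set E}) : expect (fun S => (F \subset S)%:R) = p ^+ #|F|.
Proof.
rewrite -prod_pow [RHS](_ : _ = \prod_e (p * 1 + (1 - p) * (e \notin F)%:R)).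
  rewrite -expect_prod; apply: eq_bigr => S _; congr (_ * _).
  case: (boolP (F \subset S)) => [sF|/subsetPn[e eF eS]].
    rewrite big1 // => e _; case: ifP => // /negbT eS.
    by rewrite (contra (subsetP sF e)).
  by rewrite (bigD1 e) //= (negbTE eS) eF mul0r.
by apply: eq_bigr => e _; case: ifP => _ /=; ring.
Qed.

(* A packing of [k] disjoint members of [Q] inside [S] contributes all its [2^k] subfamilies,
   so this polynomial controls upper tails of packing numbers without any independence. *)
Definition pack_poly (s : R) (Q : {set {set E}}) (S : {set E}) : R :=
  \sum_(F : {set {set E}} | [&& F \subset Q, trivIset F & cover F \subset S]) s ^+ #|F|.

Lemma pack_poly_ge0 s Q S : 0 <= s -> 0 <= pack_poly s Q S.
Proof. by move=> s0; apply: sumr_ge0 => F _; apply: exprn_ge0. Qed.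

Lemma sum_subsets (T : finType) (Q : {set T}) (x : R) :
  \sum_(F : {set T} | F \subset Q) x ^+ #|F| = (1 + x) ^+ #|Q|.
Proof.
rewrite -prod_pow [RHS](_ : _ = \prod_i ((if i \in Q then x else 0) + 1)); last first.
  by apply: eq_bigr => i _; case: ifP; rewrite ?add0r // addrC.
rewrite bigA_distr big_mkcond /=; apply: eq_bigr => F _.
case: (boolP (F \subset Q)) => [sF|/subsetPn[e eF eQ]].
  rewrite -prod_pow; apply: eq_bigr => e _; case: ifP => // eF.
  by rewrite (subsetP sF _ eF).
by rewrite (bigD1 e) //= eF (negbTE eQ) mul0r.
Qed.

Lemma pack_poly_ge (s : R) (Q F0 : {set {set E}}) (S : {set E}) :
  0 <= s -> F0 \subset Q -> trivIset F0 -> cover F0 \subset S ->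
  (1 + s) ^+ #|F0| <= pack_poly s Q S.
Proof.
move=> s0 FQ tF cF; rewrite -sum_subsets /pack_poly [X in X <= _]big_mkcond.
rewrite [X in _ <= X]big_mkcond /=; apply: ler_sum => F _.
case: ifP => [sF|_]; last by case: ifP => // _; apply: exprn_ge0.
rewrite (subset_trans sF FQ) (trivIsetS sF tF) /= ifT //.
by apply: subset_trans cF; apply/bigcupsP => B BF; apply: bigcup_sup; apply: (subsetP sF).
Qed.

(** A disjoint family [F] covers at least [d #|F|] elements, so it lies in the random set with
    probability at most [(p ^+ d) ^+ #|F|]. Disjointness is dropped only afterwards, and the sum
    over all subfamilies of [Q] factors. *)
Lemma expect_pack (s : R) (d : nat) (Q : {set {set E}}) :
  0 <= s -> (forall B, B \in Q -> (d <= #|B|)%N) ->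
  expect (pack_poly s Q) <= (1 + s * p ^+ d) ^+ #|Q|.
Proof.
move=> s0 hd; rewrite -sum_subsets.
have -> : expect (pack_poly s Q) =
    \sum_(F : {set {set E}} | (F \subset Q) && trivIset F) p ^+ #|cover F| * s ^+ #|F|.
  rewrite -(eq_bigr _ (fun F _ => congr1 (fun x => x * _) (expect_sub _))).
  rewrite -(eq_bigr _ (fun F _ => expectZ _ _)) -expect_sum; apply: eq_bigr => S _.
  congr (_ * _); rewrite /pack_poly big_mkcond [RHS]big_mkcond /=; apply: eq_bigr => F _.
  by case: (F \subset Q); case: (trivIset F); case: (cover F \subset S);
    rewrite /= ?mul1r ?mul0r.
rewrite [X in X <= _]big_mkcond [X in _ <= X]big_mkcond /=; apply: ler_sum => F _.
case: (boolP (F \subset Q)) => sF //=; case: (boolP (trivIset F)) => tF; last first.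
  by rewrite exprn_ge0 // mulr_ge0 // exprn_ge0.
rewrite exprMn mulrC ler_wpM2l ?exprn_ge0 // -exprM.
apply: ler_wiXn2l => //; rewrite -(eqP tF) mulnC -sum_nat_const.
by apply: leq_sum => B BF; apply: hd; apply: (subsetP sF).
Qed.

End RandomSet.

(** The budget of a union bound over all vertex sets: a set [X] receives weight [N^(-|X|)]. The sum
    is [(1 + 1/N)^|T|], controlled through [(1 + a)^k (1 - k a) <= 1]. *)
Lemma sum_inv_pow_le2 (R : realFieldType) (T : finType) (N : R) :
  2 * #|T|%:R <= N -> 0 < N -> \sum_(X : {set T}) N^-1 ^+ #|X| <= 2.
Proof.
move=> hN N0.
have -> : \sum_(X : {set T}) N^-1 ^+ #|X| = (1 + N^-1) ^+ #|T|.
  by rewrite -cardsT -sum_subsets; apply: eq_bigl => X; rewrite subsetT.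
have i0 : 0 < N^-1 by rewrite invr_gt0.
have step k : (1 + N^-1) ^+ k * (1 - k%:R * N^-1) <= 1.
  elim: k => [|k IH]; first by rewrite expr0 mul0r subr0 mulr1.
  apply: le_trans IH; rewrite exprSr -mulrA; apply: ler_wpM2l.
    by rewrite exprn_ge0 // addr_ge0 // ltW.
  rewrite -natr1.
  have : 0 <= k%:R * N^-1 * N^-1 by rewrite !mulr_ge0 // ltW.
  have : 0 <= N^-1 * N^-1 by rewrite !mulr_ge0 // ltW.
  move: (N^-1) (k%:R) => a t; lra.
have := step #|T|.
have h2 : #|T|%:R * N^-1 <= 1 / 2.
  by rewrite ler_pdivrMr //; lra.
have P0 : 0 <= (1 + N^-1) ^+ #|T| by rewrite exprn_ge0 // addr_ge0 // ltW.
have : (1 + N^-1) ^+ #|T| * (1 / 2) <= (1 + N^-1) ^+ #|T| * (1 - #|T|%:R * N^-1).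
  by apply: ler_wpM2l => //; lra.
lra.
Qed.

(** * Random graphs as random sets of pairs, and removal of triangles *)

Section RandomGraph.
Variable m : nat.
Local Notation A := 'I_m.
Implicit Types (x y z : A) (S : {set A * A}) (X Y Z U : {set A}).

(** Code of an unordered pair, so that one random subset of [A * A] yields a symmetric relation;
    pairs that are not increasing are sampled but never read. *)
Definition nedge x y : A * A := if (x < y)%N then (x, y) else (y, x).

Lemma nedgeC x y : nedge x y = nedge y x.
Proof. by rewrite /nedge; case: ltngtP => // /ord_inj ->. Qed.

Lemma nedge_inj x y a b :
  nedge x y = nedge a b -> (x = a /\ y = b) \/ (x = b /\ y = a).
Proof.
by rewrite /nedge; case: ifP => _; case: ifP => _ [-> ->]; [left|right|right|left].
Qed.

Definition sample_adj S x y : bool := (x != y) && (nedge x y \in S).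

Lemma sample_adj_sym S : symmetric (sample_adj S).
Proof. by move=> x y; rewrite /sample_adj eq_sym nedgeC. Qed.

(** For overlapping [X] and [Y] an edge may be counted twice among ordered pairs. Splitting by the
    smaller end leaves two halves, in each of which every potential edge occurs at most once, so
    each count is binomial. *)
Definition forward X Y : {set A * A} :=
  [set e : A * A | [&& (e.1 < e.2)%N, e.1 \in X & e.2 \in Y]].

Lemma sum_forward S X Y :
  (\sum_(x in X) \sum_(y in Y) ((x < y)%N && ((x, y) \in S)))%N = #|S :&: forward X Y|.
Proof.
rewrite pair_big /= -sum1_card big_mkcond /= [RHS]big_mkcond /=.
apply: eq_bigr => -[x y] _; rewrite !inE /=.
by case: (x \in X); case: (y \in Y); case: (x < y)%N; case: (_ \in S).
Qed.

Lemma sum_sample S X Y :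
  (\sum_(x in X) \sum_(y in Y) sample_adj S x y)%N =
  (#|S :&: forward X Y| + #|S :&: forward Y X|)%N.
Proof.
rewrite -!sum_forward [X in (_ + X)%N]exchange_big /= -big_split /=.
apply: eq_bigr => x _; rewrite -big_split /=; apply: eq_bigr => y _.
rewrite /sample_adj /nedge -(inj_eq val_inj) /=.
by case: ltngtP => //=; rewrite ?addn0.
Qed.

Lemma card_forward X Y :
  (#|forward X Y| + #|forward Y X| + #|X :&: Y| = #|X| * #|Y|)%N.
Proof.
have := sum_sample setT X Y; rewrite !setTI => <-.
rewrite -[#|X :&: Y|]sum1_card -[(#|X| * _)%N]sum_nat_const.
rewrite [X in (_ + X)%N](_ : _ = \sum_(x in X) \sum_(y in Y) (x == y))%N; last first.
  rewrite big_mkcond [RHS]big_mkcond /=; apply: eq_bigr => x _; rewrite inE.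
  case: (x \in X) => //=; case: (boolP (x \in Y)) => [xY|xY].
    rewrite (bigD1 x) //= eqxx big1 ?addn0 // => y /andP[_ /negbTE].
    by rewrite eq_sym => ->.
  by rewrite big1 // => y yY; case: eqP => // e; rewrite e yY in xY.
rewrite -big_split /=; apply: eq_bigr => x _; rewrite -big_split /= -sum1_card.
by apply: eq_bigr => y _; rewrite /sample_adj inE andbT; case: (x == y).
Qed.

(** One test for all edges between [X] and [Y]. Two [forward] halves would pay the entropy of the
    pair [X], [Y] twice, which the three-edge estimate behind [base_fan] cannot afford. *)
Definition joins X Y : {set A * A} := [set nedge x y | x in X, y in Y].

Lemma card_joins X Y : (#|joins X Y| <= #|X| * #|Y|)%N.
Proof.
rewrite -cardsX /joins; rewrite curry_imset2X; exact: leq_imset_card.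
Qed.

Lemma sum_joins_le S X Y : {in X & Y, forall x y x' y', x' \in X -> y' \in Y ->
    sample_adj S x y -> nedge x y = nedge x' y' -> x = x' /\ y = y'} ->
  (\sum_(x in X) \sum_(y in Y) sample_adj S x y <= #|S :&: joins X Y|)%N.
Proof.
move=> inj.
rewrite pair_big /= (bigID (fun u => sample_adj S u.1 u.2)) /= [X in (_ + X)%N]big1; last first.
  by move=> u /andP[_ /negbTE->].
rewrite addn0 (eq_bigr (fun=> 1%N)); last by move=> u /andP[_ ->].
rewrite sum1dep_card -(card_in_imset (f := fun u => nedge u.1 u.2)).
  apply/subset_leq_card/subsetP => e /imsetP[[x y]]; rewrite !inE /= => /andP[/andP[xX yY] hxy] ->.
  by move: (hxy) => /andP[_ ->] /=; apply/imset2P; exists x y.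
move=> [x y] [x' y']; rewrite !inE /= => /andP[/andP[xX yY] hxy] /andP[/andP[xX' yY'] _] e.
by have [-> ->] := inj x y xX yY x' y' xX' yY' hxy e.
Qed.

Definition cherries U : {set {set A * A}} :=
  [set [set nedge u.1 u.2.1; nedge u.1 u.2.2] | u in
    [set u : A * (A * A) | [&& u.1 \notin U, u.2.1 \in U, u.2.2 \in U & u.2.1 != u.2.2]]].

Lemma card_cherries U : (#|cherries U| <= m * #|U| ^ 2)%N.
Proof.
apply: leq_trans (leq_imset_card _ _) _.
apply: leq_trans (_ : (#|setX [set: A] (setX U U)| <= _)%N); last first.
  by rewrite !cardsX cardsT card_ord expnS expn1.
by apply/subset_leq_card/subsetP => -[z [y y']]; rewrite !inE /= => /and4P[_ -> ->].
Qed.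

Lemma cherries_ge2 U B : B \in cherries U -> (2 <= #|B|)%N.
Proof.
move=> /imsetP[[z [y y']]]; rewrite inE /= => /and4P[zU yU yU' ny] ->.
rewrite cards2; case: eqP => // /nedge_inj [[_ e]|[e _]].
  by rewrite e eqxx in ny.
by rewrite e yU' in zU.
Qed.

(** One cherry is chosen per centre. Each of its edges has exactly one end outside [U], namely the
    centre, so cherries at different centres share no edge and form a packing. *)
Lemma cherry_count (R : realFieldType) S U :
  2 ^+ #|[set z | (z \notin U) && (2 <= \sum_(y in U) sample_adj S z y)%N]| <=
  pack_poly (1 : R) (cherries U) S.
Proof.
set Z := [set z | _].
have ex z : z \in Z -> exists u : A * A, [&& u.1 \in U, u.2 \in U, u.1 != u.2,
    sample_adj S z u.1 & sample_adj S z u.2].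
  rewrite inE => /andP[zU c2].
  have : (1 < #|[set y in U | sample_adj S z y]|)%N.
    rewrite -sum1_card (eq_bigl (fun y => (y \in U) && sample_adj S z y)); last by move=> y; rewrite inE.
    by rewrite big_mkcondr /=; apply: leq_trans c2 _; apply: leq_sum => y _; case: (sample_adj _ _ _).
  move=> /card_gt1P[y [y' [/setIdP[yU hy] /setIdP[yU' hy'] ny]]].
  by exists (y, y'); rewrite /= yU yU' hy hy' ny.
pose f z : A * A := odflt (z, z) [pick u : A * A | [&& u.1 \in U, u.2 \in U, u.1 != u.2,
    sample_adj S z u.1 & sample_adj S z u.2]].
have fP z : z \in Z -> [&& (f z).1 \in U, (f z).2 \in U, (f z).1 != (f z).2,
    sample_adj S z (f z).1 & sample_adj S z (f z).2].
  move=> zZ; rewrite /f; case: pickP => //= n.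
  by have [u hu] := ex z zZ; rewrite n in hu.
pose g z : {set A * A} := [set nedge z (f z).1; nedge z (f z).2].
have gdisj z w e : z \in Z -> w \in Z -> e \in g z -> e \in g w -> z = w.
  move=> zZ wZ; have /and5P[a1 a2 _ _ _] := fP _ zZ; have /and5P[b1 b2 _ _ _] := fP _ wZ.
  have zU : z \notin U by move: zZ; rewrite inE => /andP[].
  rewrite !inE => /orP[/eqP->|/eqP->] /orP[] /eqP/nedge_inj[[]//|[e1 _]];
    by rewrite e1 ?b1 ?b2 in zU.
have gi : {in Z &, injective g}.
  move=> z w zZ wZ e; apply: (gdisj z w (nedge z (f z).1)) => //; rewrite -?e !inE eqxx //.
rewrite -(card_in_imset gi) (_ : 2 = 1 + 1) //; apply: pack_poly_ge => //.
- apply/subsetP => B /imsetP[z zZ ->]; apply/imsetP.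
  have /and5P[a1 a2 a3 _ _] := fP _ zZ; exists (z, f z) => //.
  by rewrite inE /= a1 a2 a3; move: zZ; rewrite inE => /andP[->].
- apply/trivIsetP => B C /imsetP[z zZ ->] /imsetP[w wZ ->] ne.
  rewrite -setI_eq0; apply: contraNT ne => /set0Pn[e]; rewrite inE => /andP[h1 h2].
  by rewrite (gdisj _ _ _ zZ wZ h1 h2).
apply/bigcupsP => B /imsetP[z zZ ->]; have /and5P[_ _ _ /andP[_ a1] /andP[_ a2]] := fP _ zZ.
by apply/subsetP => e; rewrite !inE => /orP[] /eqP->.
Qed.

Definition tri x y z : {set A * A} := [set nedge x y; nedge y z; nedge x z].

Lemma triC x y z : tri x y z = tri y x z.
Proof. by apply/setP => e; rewrite !inE (nedgeC x y) -!orbA [(_ == nedge y z) || _]orbC. Qed.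

Lemma tri_rot x y z : tri x y z = tri y z x.
Proof.
apply/setP => e; rewrite !inE (nedgeC z x) (nedgeC y x).
by case: (e == nedge x y); case: (e == nedge y z); case: (e == nedge x z).
Qed.

Definition triangles X Y : {set {set A * A}} :=
  [set tri u.1.1 u.1.2 u.2 | u in [set u : A * A * A |
    [&& u.1.1 \in X, u.1.2 \in Y, u.1.1 != u.1.2, u.1.2 != u.2 & u.1.1 != u.2]]].

Lemma card_triangles X Y : (#|triangles X Y| <= #|X| * #|Y| * m)%N.
Proof.
apply: leq_trans (leq_imset_card _ _) _.
apply: leq_trans (_ : (#|setX (setX X Y) [set: A]| <= _)%N); last first.
  by rewrite !cardsX cardsT card_ord.
by apply/subset_leq_card/subsetP => -[[x y] z]; rewrite !inE /= => /and5P[-> -> _ _ _].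
Qed.

Lemma card_tri x y z : x != y -> y != z -> x != z -> #|tri x y z| = 3.
Proof.
move=> xy yz xz; rewrite /tri -setUA cardsU1 cards2 !inE.
case: eqP => [/nedge_inj [[e _]|[e _]]|_]; first by rewrite e eqxx in xy.
  by rewrite e eqxx in xz.
case: eqP => [/nedge_inj [[_ e]|[e1 e2]]|_].
- by rewrite e eqxx in yz.
- by rewrite e1 eqxx in xz.
case: eqP => [/nedge_inj [[e _]|[e _]]|_] //; first by rewrite e eqxx in xy.
by rewrite e eqxx in yz.
Qed.

Lemma triangles_ge3 X Y B : B \in triangles X Y -> (3 <= #|B|)%N.
Proof.
by move=> /imsetP[[[x y] z]]; rewrite inE /= => /and5P[_ _ h1 h2 h3] ->; rewrite card_tri.
Qed.

Lemma triangles_through X Y B x y : B \in triangles setT setT ->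
  x \in X -> y \in Y -> x != y -> nedge x y \in B -> B \in triangles X Y.
Proof.
move=> /imsetP[[[a b] c]]; rewrite inE /= => /and5P[_ _ ab bc ac] -> xX yY xy.
have mk u v w : nedge x y = nedge u v -> u != v -> v != w -> u != w ->
    tri u v w \in triangles X Y.
  move=> /nedge_inj[[<- <-]|[<- <-]] h1 h2 h3; apply/imsetP.
    by exists (x, y, w) => //; rewrite inE /= xX yY h1 h2 h3.
  by exists (x, y, w); rewrite ?[tri y x w]triC // inE /= xX yY xy h3 h2.
rewrite !inE => /orP[/orP[]|] /eqP e.
- exact: mk.
- by rewrite tri_rot; apply: mk => //; rewrite eq_sym.
by rewrite triC tri_rot; apply: mk => //; rewrite eq_sym.
Qed.

Definition triangle_packing S (F : {set {set A * A}}) : bool :=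
  [&& F \subset triangles setT setT, trivIset F & cover F \subset S].
Definition max_packing S : {set {set A * A}} :=
  [arg max_(F > set0 | triangle_packing S F) #|F|]%N.

Lemma max_packingP S : triangle_packing S (max_packing S) /\
  forall F, triangle_packing S F -> (#|F| <= #|max_packing S|)%N.
Proof.
rewrite /max_packing; case: arg_maxnP => [|F h1 h2]; last by split.
rewrite /triangle_packing sub0set /cover big_set0 sub0set /=.
by rewrite andbT; apply/trivIsetP => B; rewrite inE.
Qed.

(* Maximality of the packing makes the remaining graph triangle-free. *)
Definition base_adj S x y : bool := sample_adj (S :\: cover (max_packing S)) x y.

Lemma base_adj_triangle_free S x y z :
  ~ [/\ base_adj S x y, base_adj S y z & base_adj S x z].
Proof.
case=> /andP[xy] /setDP[exy nxy] /andP[yz] /setDP[eyz nyz] /andP[xz] /setDP[exz nxz].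
have [/and3P[pT pI pS] pmax] := max_packingP S.
have dis B : B \in max_packing S -> [disjoint tri x y z & B].
  move=> BP; rewrite -setI_eq0; apply/eqP/setP => e; rewrite in_set0; apply/negbTE.
  apply/negP; rewrite !inE => /andP[he eB].
  have eC : e \in cover (max_packing S) by apply/bigcupP; exists B.
  by move: he nxy nyz nxz => /orP[/orP[]|] /eqP<-; rewrite eC.
have tn : tri x y z \notin max_packing S.
  apply/negP => /dis; rewrite -setI_eq0 setIid => /eqP e0.
  by have := card_tri xy yz xz; rewrite e0 cards0.
suff /pmax : triangle_packing S (tri x y z |: max_packing S).
  by rewrite cardsU1 tn ltnn.
apply/and3P; split.
- rewrite subUset pT andbT sub1set; apply/imsetP; exists (x, y, z) => //.
  by rewrite !inE /= xy yz xz.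
- apply/trivIsetP => B C; rewrite !inE => /orP[/eqP->|hB] /orP[/eqP->|hC].
  + by rewrite eqxx.
  + by move=> _; apply: dis.
  + by move=> _; rewrite disjoint_sym; apply: dis.
  by move: (trivIsetP pI B C hB hC).
rewrite /cover; apply/bigcupsP => B; rewrite !inE => /orP[/eqP->|hB].
  by apply/subsetP => e; rewrite !inE => /orP[/orP[]|] /eqP->.
by apply: subset_trans pS; apply: bigcup_sup.
Qed.

Lemma card_nedge_fiber (e : A * A) : (\sum_(u : A * A) (nedge u.1 u.2 == e) <= 2)%N.
Proof.
have -> : (\sum_(u : A * A) (nedge u.1 u.2 == e) = #|[set u : A * A | nedge u.1 u.2 == e]|)%N.
  rewrite -sum1_card [RHS]big_mkcond /=; apply: eq_bigr => u _; rewrite inE.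
  by case: ifP.
apply: leq_trans (_ : #|[set e; (e.2, e.1)]| <= 2)%N; last by rewrite cards2; case: (_ != _).
apply/subset_leq_card/subsetP => -[x y]; rewrite !inE /= => /eqP <-.
by rewrite /nedge; case: ifP => _ /=; rewrite eqxx ?orbT.
Qed.

(** An edge from [X] to [Y] that is lost lies in a packed triangle of [triangles X Y]. A triangle
    has three edges, each met by at most two ordered pairs, whence the factor 6. *)
Lemma removed_edges S X Y :
  (\sum_(x in X) \sum_(y in Y) sample_adj S x y <=
   \sum_(x in X) \sum_(y in Y) base_adj S x y +
   6 * #|max_packing S :&: triangles X Y|)%N.
Proof.
have [/and3P[pT _ _] _] := max_packingP S.
set P := max_packing S :&: _.
have h6 : (\sum_(x in X) \sum_(y in Y) \sum_(B in P) \sum_(e in B) (nedge x y == e) <= 6 * #|P|)%N.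
  rewrite pair_big /= exchange_big /= mulnC -sum_nat_const; apply: leq_sum => B.
  rewrite inE => /andP[BP BXY].
  rewrite exchange_big /=.
  have c3 : #|B| = 3.
    have /imsetP[[[x y] z]] := subsetP pT B BP.
    by rewrite inE /= => /and5P[_ _ h1 h2 h3] ->; rewrite card_tri.
  rewrite (_ : 6%N = (#|B| * 2)%N); last by rewrite c3.
  rewrite -sum_nat_const; apply: leq_sum => e _.
  apply: leq_trans (card_nedge_fiber e).
  by rewrite big_mkcond /=; apply: leq_sum => u _; case: ifP.
apply: leq_trans (leq_add (leqnn _) h6); rewrite -big_split /=; apply: leq_sum => x xX.
rewrite -big_split /=; apply: leq_sum => y yY.
rewrite /base_adj /sample_adj inE.
case: (boolP (x != y)) => //= xy; case: (boolP (nedge x y \in S)) => //= eS.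
case: (boolP (nedge x y \in cover _)) => //= /bigcupP[B BP eB].
have BXY : B \in P.
  by rewrite inE BP; apply: triangles_through (subsetP pT B BP) xX yY xy eB.
by rewrite (bigD1 B) //= (bigD1 (nedge x y)) //= eqxx.
Qed.

Lemma packed_triangles (R : realFieldType) S X Y :
  2 ^+ #|max_packing S :&: triangles X Y| <= pack_poly (1 : R) (triangles X Y) S.
Proof.
have [/and3P[_ pI pS] _] := max_packingP S.
rewrite (_ : 2 = 1 + 1) //; apply: pack_poly_ge => //.
- exact: subsetIr.
- by apply: trivIsetS pI; apply: subsetIl.
apply: subset_trans pS; apply/bigcupsP => B; rewrite inE => /andP[BP _].
exact: bigcup_sup.
Qed.

End RandomGraph.

(** * Union bound by weighted first moments *)

Section UnionBound.
Variables (R : realFieldType) (E J : finType) (p : R).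
Variables (f : J -> {set E} -> R) (c w : J -> R).
Hypothesis f0 : forall j S, 0 <= f j S.
Hypothesis c0 : forall j, 0 < c j.
Hypothesis w0 : forall j, 0 <= w j.
Hypothesis fc : forall j, expect p (f j) <= c j.

(** Markov's inequality for all tests at once: each test is normalised by its mean bound [c j], so
    the total has expectation at most the sum of the [w j], and a sample with total below 1 passes
    every test with slack [1 / w j]. *)
Definition weighted_tests (S : {set E}) : R := \sum_j f j S * (w j / c j).

Lemma weighted_test_ge0 j S : 0 <= f j S * (w j / c j).
Proof. by rewrite mulr_ge0 // divr_ge0 // ltW. Qed.

Lemma weighted_tests_ge0 S : 0 <= weighted_tests S.
Proof. by apply: sumr_ge0 => j _; apply: weighted_test_ge0. Qed.

Lemma expect_weighted_tests : expect p weighted_tests <= \sum_j w j.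
Proof.
rewrite expect_sum; apply: ler_sum => j _; rewrite expectZ mulrA ler_pdivrMr // mulrC.
by apply: ler_wpM2l.
Qed.

Lemma weighted_tests_lt1 S j : weighted_tests S < 1 -> f j S * w j < c j.
Proof.
move=> h; rewrite -[X in _ < X]mul1r -ltr_pdivrMr // -mulrA; apply: le_lt_trans h.
rewrite /weighted_tests (bigD1 j) //= lerDl; apply: sumr_ge0 => i _.
exact: weighted_test_ge0.
Qed.

End UnionBound.

(** Six families of tests share one sample: lower and upper edge counts, degrees, edges between two
    sets, cherries and triangles. Their weights add up to at most [(4 + 4 + 1 + 4 + 2 + 4) / 100].
    The tilt [t] is left free because edges into small sets need a very large one. *)
Lemma random_sample (R : realFieldType) (m : nat) (p s t N : R) :
  0 <= p -> p <= 1 -> 0 < s -> s < 1 -> 0 < t -> 0 < N -> 2 * m%:R <= N ->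
  exists S : {set 'I_m * 'I_m},
  [/\ forall X Y : {set 'I_m}, (1 - s) ^+ #|S :&: forward X Y| <
        100 * (N ^+ #|X| * N ^+ #|Y|) * (1 - s * p) ^+ #|forward X Y|,
      forall X Y : {set 'I_m}, 2 ^+ #|S :&: forward X Y| <
        100 * (N ^+ #|X| * N ^+ #|Y|) * (1 + p) ^+ #|forward X Y|,
      forall x : 'I_m, (1 + s) ^+ #|S :&: joins [set x] setT| <
        100 * N * (1 + s * p) ^+ #|joins [set x] setT| &
      [/\ forall X Y : {set 'I_m}, (1 + t) ^+ #|S :&: joins X Y| <
        100 * (N ^+ #|X| * N ^+ #|Y|) * (1 + t * p) ^+ #|joins X Y|,
      forall U : {set 'I_m}, pack_poly 1 (cherries U) S <
        100 * N ^+ #|U| * (1 + p ^+ 2) ^+ #|cherries U| &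
      forall X Y : {set 'I_m}, pack_poly 1 (triangles X Y) S <
        100 * (N ^+ #|X| * N ^+ #|Y|) * (1 + p ^+ 3) ^+ #|triangles X Y|]].
Proof.
move=> p0 p1 s0 s1 t0 N0 mN.
have i0 : 0 < N^-1 by rewrite invr_gt0.
have sp1 : 0 < 1 - s * p by nra.
pose P := ({set 'I_m} * {set 'I_m})%type.
pose w (u : P) : R := N^-1 ^+ #|u.1| * N^-1 ^+ #|u.2| / 100.
pose w1 (x : 'I_m) : R := N^-1 / 100.
pose w2 (U : {set 'I_m}) : R := N^-1 ^+ #|U| / 100.
have w0 u : 0 <= w u by rewrite /w !mulr_ge0 ?exprn_ge0 ?invr_ge0 ?ltW.
have w10 x : 0 <= w1 x by rewrite /w1 !mulr_ge0 ?invr_ge0 ?ltW.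
have w20 U : 0 <= w2 U by rewrite /w2 !mulr_ge0 ?exprn_ge0 ?invr_ge0 ?ltW.
have two : \sum_(X : {set 'I_m}) N^-1 ^+ #|X| <= 2.
  by apply: sum_inv_pow_le2; rewrite ?card_ord.
have sw : \sum_u w u <= 4 / 100.
  rewrite /w -mulr_suml ler_pM2r ?invr_gt0 // -(pair_big xpredT xpredT (fun X Y : {set 'I_m} =>
    N^-1 ^+ #|X| * N^-1 ^+ #|Y|)) /= -big_distrlr /=.
  have -> : 4 = 2 * 2 :> R by ring.
  by apply: ler_pM => //; apply: sumr_ge0 => X _; rewrite exprn_ge0 // ltW.
have sw1 : \sum_x w1 x <= 1 / 100.
  rewrite sumr_const card_ord /w1 -mulrnAl ler_pM2r ?invr_gt0 // -mulr_natl.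
  by rewrite ler_pdivrMr // mul1r; have : 0 <= m%:R :> R by []; lra.
have sw2 : \sum_U w2 U <= 2 / 100 by rewrite /w2 -mulr_suml ler_pM2r ?invr_gt0.
pose f1 (u : P) (S : {set 'I_m * 'I_m}) := (1 - s) ^+ #|S :&: forward u.1 u.2|.
pose c1 (u : P) := (1 - s * p) ^+ #|forward u.1 u.2|.
pose f2 (u : P) (S : {set 'I_m * 'I_m}) := (2 : R) ^+ #|S :&: forward u.1 u.2|.
pose c2 (u : P) := (1 + p) ^+ #|forward u.1 u.2|.
pose f3 (x : 'I_m) (S : {set 'I_m * 'I_m}) := (1 + s) ^+ #|S :&: joins [set x] setT|.
pose c3 (x : 'I_m) := (1 + s * p) ^+ #|joins [set x] setT|.
pose f4 (u : P) (S : {set 'I_m * 'I_m}) := (1 + t) ^+ #|S :&: joins u.1 u.2|.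
pose c4 (u : P) := (1 + t * p) ^+ #|joins u.1 u.2|.
pose f5 (U : {set 'I_m}) := pack_poly (1 : R) (cherries U).
pose c5 (U : {set 'I_m}) := (1 + p ^+ 2) ^+ #|cherries U|.
pose f6 (u : P) := pack_poly (1 : R) (triangles u.1 u.2).
pose c6 (u : P) := (1 + p ^+ 3) ^+ #|triangles u.1 u.2|.
have f10 u S : 0 <= f1 u S by rewrite exprn_ge0 // subr_ge0 ltW.
have f20 u S : 0 <= f2 u S by rewrite exprn_ge0.
have f30 u S : 0 <= f3 u S by rewrite exprn_ge0 // addr_ge0 // ltW.
have f40 u S : 0 <= f4 u S by rewrite exprn_ge0 // addr_ge0 // ltW.
have f50 u S : 0 <= f5 u S by apply: pack_poly_ge0.
have f60 u S : 0 <= f6 u S by apply: pack_poly_ge0.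
have c10 u : 0 < c1 u by rewrite exprn_gt0.
have c20 u : 0 < c2 u by rewrite exprn_gt0 // ltr_wpDr.
have c30 u : 0 < c3 u by rewrite exprn_gt0 // ltr_wpDr // mulr_ge0 // ltW.
have c40 u : 0 < c4 u by rewrite exprn_gt0 // ltr_wpDr // mulr_ge0 // ltW.
have c50 u : 0 < c5 u by rewrite exprn_gt0 // ltr_wpDr // exprn_ge0.
have c60 u : 0 < c6 u by rewrite exprn_gt0 // ltr_wpDr // exprn_ge0.
have e1 u : expect p (f1 u) <= c1 u.
  by rewrite /f1 expect_exp /c1 (_ : p * (1 - s) + (1 - p) = 1 - s * p) //; ring.
have e2 u : expect p (f2 u) <= c2 u.
  by rewrite /f2 expect_exp /c2 (_ : p * 2 + (1 - p) = 1 + p) //; ring.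
have e3 u : expect p (f3 u) <= c3 u.
  by rewrite /f3 expect_exp /c3 (_ : p * (1 + s) + (1 - p) = 1 + s * p) //; ring.
have e4 u : expect p (f4 u) <= c4 u.
  by rewrite /f4 expect_exp /c4 (_ : p * (1 + t) + (1 - p) = 1 + t * p) //; ring.
have e5 U : expect p (f5 U) <= c5 U.
  by have := expect_pack p0 p1 ler01 (@cherries_ge2 m U); rewrite mul1r.
have e6 u : expect p (f6 u) <= c6 u.
  by have := expect_pack p0 p1 ler01 (@triangles_ge3 m u.1 u.2); rewrite mul1r.
pose F1 := weighted_tests f1 c1 w; pose F2 := weighted_tests f2 c2 w.
pose F3 := weighted_tests f3 c3 w1; pose F4 := weighted_tests f4 c4 w.
pose F5 := weighted_tests f5 c5 w2; pose F6 := weighted_tests f6 c6 w.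
have [S] : exists S, F1 S + F2 S + F3 S + F4 S + F5 S + F6 S < 1.
  apply: (expect_lt1 p0 p1); rewrite !expectD.
  have := expect_weighted_tests c10 w0 e1; have := expect_weighted_tests c20 w0 e2.
  have := expect_weighted_tests c30 w10 e3; have := expect_weighted_tests c40 w0 e4.
  have := expect_weighted_tests c50 w20 e5; have := expect_weighted_tests c60 w0 e6.
  rewrite -/F1 -/F2 -/F3 -/F4 -/F5 -/F6; lra.
have F10 : 0 <= F1 S by apply: weighted_tests_ge0.
have F20 : 0 <= F2 S by apply: weighted_tests_ge0.
have F30 : 0 <= F3 S by apply: weighted_tests_ge0.
have F40 : 0 <= F4 S by apply: weighted_tests_ge0.
have F50 : 0 <= F5 S by apply: weighted_tests_ge0.
have F60 : 0 <= F6 S by apply: weighted_tests_ge0.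
move=> hF.
have hF1 : F1 S < 1 by lra.
have hF2 : F2 S < 1 by lra.
have hF3 : F3 S < 1 by lra.
have hF4 : F4 S < 1 by lra.
have hF5 : F5 S < 1 by lra.
have hF6 : F6 S < 1 by lra.
have un (a c k : R) : 0 < k -> a * (k^-1 / 100) < c -> a < 100 * k * c.
  move=> k0; rewrite mulrA ltr_pdivrMr // ltr_pdivrMr //.
  by rewrite [100 * k * c](_ : _ = c * 100 * k) //; ring.
have NN (X Y : {set 'I_m}) : 0 < N ^+ #|X| * N ^+ #|Y| by rewrite mulr_gt0 // exprn_gt0.
have wE u : w u = (N ^+ #|u.1| * N ^+ #|u.2|)^-1 / 100 by rewrite /w invfM !exprVn.
exists S; split.
- move=> X Y; apply: un => //; rewrite -(wE (X, Y)).
  by apply: (weighted_tests_lt1 f10 c10 w0 (X, Y) hF1).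
- move=> X Y; apply: un => //; rewrite -(wE (X, Y)).
  by apply: (weighted_tests_lt1 f20 c20 w0 (X, Y) hF2).
- by move=> x; apply: un => //; apply: (weighted_tests_lt1 f30 c30 w10 x hF3).
split.
- move=> X Y; apply: un => //; rewrite -(wE (X, Y)).
  by apply: (weighted_tests_lt1 f40 c40 w0 (X, Y) hF4).
- move=> U; apply: un; first by rewrite exprn_gt0.
  by rewrite -exprVn; apply: (weighted_tests_lt1 f50 c50 w20 U hF5).
move=> X Y; apply: un => //; rewrite -(wE (X, Y)).
by apply: (weighted_tests_lt1 f60 c60 w0 (X, Y) hF6).
Qed.

(** * Bilinear counts and level sets *)

Definition ecount (R : realFieldType) (A : finType) (h : rel A) (X Y : {set A}) : R :=
  \sum_(x in X) \sum_(y in Y) (h x y)%:R.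

Lemma natr_levels (R : realFieldType) (k n : nat) (F : nat -> R) :
  (k <= n)%N -> \sum_(i < k) F i = \sum_(i < n) (i < k)%N%:R * F i.
Proof.
move=> kn; rewrite (big_ord_widen n F kn) big_mkcond /=.
by apply: eq_bigr => i _; case: ifP; rewrite ?mul1r ?mul0r.
Qed.

Lemma sum_levels (R : realFieldType) (A : finType) (w : A -> nat) n (F : nat -> R) :
  (forall x, (w x <= n)%N) ->
  \sum_x \sum_(i < w x) F i = \sum_(i < n) #|[set x | (i < w x)%N]|%:R * F i.
Proof.
move=> wn; under eq_bigr => x _ do rewrite (natr_levels F (wn x)).
rewrite exchange_big /=; apply: eq_bigr => i _.
rewrite -mulr_suml; congr (_ * _).
by rewrite -natr_sum -big_mkcond /= sum1dep_card cardsE.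
Qed.

(** Layer-cake argument: an integer weight is the sum of the indicators of its level sets, so the
    bound for indicators is summed over [wm * vm] pairs of levels. *)
Lemma weighted_kernel (R : realFieldType) (A : finType) (c : A -> A -> R) (K : R)
    (w v : A -> nat) (wm vm : nat) :
  (forall X Y : {set A}, \sum_(x in X) \sum_(y in Y) c x y <= K * (#|X|%:R + #|Y|%:R)) ->
  (forall x, (w x <= wm)%N) -> (forall x, (v x <= vm)%N) ->
  \sum_x \sum_y c x y * (w x)%:R * (v y)%:R <=
  K * (vm%:R * (\sum_x (w x)%:R) + wm%:R * (\sum_x (v x)%:R)).
Proof.
move=> hc hw hv.
have lev (u : A -> nat) um : (forall x, (u x <= um)%N) -> forall x,
    (u x)%:R = \sum_(i < um) (i < u x)%N%:R :> R.
  move=> hu x; have := natr_levels (fun=> (1 : R)) (hu x).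
  rewrite sumr_const card_ord => ->; by under [in RHS]eq_bigr do rewrite -[_%:R]mulr1.
have tot (u : A -> nat) um : (forall x, (u x <= um)%N) ->
    \sum_x (u x)%:R = \sum_(i < um) #|[set x | (i < u x)%N]|%:R :> R.
  move=> hu; under eq_bigr => x _ do rewrite (lev _ _ hu x).
  rewrite exchange_big /=; apply: eq_bigr => i _.
  by rewrite -natr_sum -big_mkcond /= sum1dep_card cardsE.
apply: (@le_trans _ _ (\sum_(i < wm) \sum_(j < vm) K *
    (#|[set x | (i < w x)%N]|%:R + #|[set y | (j < v y)%N]|%:R))).
  rewrite [X in X <= _](_ : _ = \sum_(i < wm) \sum_(j < vm)
    \sum_(x in [set x | (i < w x)%N]) \sum_(y in [set y | (j < v y)%N]) c x y).
    by apply: ler_sum => i _; apply: ler_sum => j _; apply: hc.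
  under eq_bigr => x _.
    under eq_bigr => y _.
      rewrite (lev _ _ hw x) (lev _ _ hv y) -mulrA big_distrl mulr_sumr /=.
      under eq_bigr do rewrite mulr_sumr mulr_sumr.
      over.
    over.
  under eq_bigr do rewrite exchange_big /=.
  rewrite exchange_big /=; apply: eq_bigr => i _.
  under eq_bigr do rewrite exchange_big /=.
  rewrite exchange_big /=; apply: eq_bigr => j _.
  rewrite [RHS]big_mkcond /=; apply: eq_bigr => x _; rewrite inE.
  case: (i < w x)%N; last by rewrite big1 // => y _; rewrite mul0r mulr0.
  rewrite [RHS]big_mkcond /=; apply: eq_bigr => y _; rewrite inE mul1r.
  by case: (j < v y)%N; rewrite ?mulr1 ?mulr0.
under eq_bigr do rewrite -mulr_sumr big_split /= sumr_const card_ord.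
rewrite -mulr_sumr big_split /= sumr_const card_ord -(tot _ _ hv) sumrMnl -(tot _ _ hw).
by rewrite -[_ *+ vm]mulr_natl -[_ *+ wm]mulr_natl.
Qed.

(** Since [d m <= V / 3], the last term is at most [2/3 V^2], the first and third together at most
    [V^2 / 24], the second at most [V^2 / 36]. The total [53/72] is just below [3/4], which is why 3
    appears in the hypothesis on [V]. *)
Lemma tall_arith (R : realFieldType) (m V d z : R) :
  0 <= m -> 0 <= V -> 0 <= d -> 3 * (d * m) <= V -> 1 + 6 * z <= d / 8 ->
  m * V + m ^+ 2 * (d ^+ 2 / 4) + 6 * z * m * V + 2 * d * m * V <= 3 / 4 * V ^+ 2.
Proof.
move=> m0 V0 d0 V3 h1.
have a1 := ler_wpM2r (mulr_ge0 m0 V0) h1.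
have a2 := ler_wpM2r V0 V3.
have a3 : 3 * (d * m) * (3 * (d * m)) <= V * V by apply: ler_pM => //; rewrite !mulr_ge0.
have a4 : 0 <= V * V by rewrite mulr_ge0.
rewrite !expr2; lra.
Qed.

(** * Red pairs over a base graph with bounded discrepancy *)

Section BaseGraph.
Variables (R : realFieldType) (A : finType) (h : rel A) (p K : R) (D : nat).
Hypothesis p0 : 0 <= p.
Hypothesis K0 : 0 <= K.
Hypothesis hsym : symmetric h.
Hypothesis upperC : forall X Y : {set A},
  ecount R h X Y <= 2 * p * #|X|%:R * #|Y|%:R + K * (#|X|%:R + #|Y|%:R).
Hypothesis degD : forall x, (\sum_y h x y <= D)%N.

Definition common_nbr (y y' : A) : bool := [exists z, h z y && h z y'].

Lemma kernel_upper (X Y : {set A}) :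
  \sum_(x in X) \sum_(y in Y) ((h x y)%:R - 2 * p) <= K * (#|X|%:R + #|Y|%:R).
Proof.
under eq_bigr do rewrite sumrB sumr_const.
rewrite sumrB sumr_const -mulrnA -[_ *+ (_ * _)]mulr_natr natrM.
have := upperC X Y; rewrite /ecount [#|Y|%:R * _]mulrC mulrA; lra.
Qed.

(* Write [W] for the degree into the weight [v]. The double count [sum W^2] is a
   bilinear form in [W] and [v], with [W <= D vm], so that the upper edge bound applies. *)
Lemma sum_wdeg_sq (v : A -> nat) (vm : nat) :
  (forall y, (v y <= vm)%N) ->
  \sum_z (\sum_y (h z y * v y)%N%:R) ^+ 2 <=
  2 * p * D%:R * (\sum_y (v y)%:R) ^+ 2 + 2 * K * D%:R * vm%:R * \sum_y (v y)%:R :> R.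
Proof.
move=> hv; set V : R := \sum_y (v y)%:R.
pose W z := (\sum_y h z y * v y)%N.
have WE z : (W z)%:R = \sum_y (h z y * v y)%N%:R :> R by rewrite /W natr_sum.
have Wm z : (W z <= D * vm)%N.
  apply: leq_trans (_ : ((\sum_y h z y) * vm <= _)%N); last by rewrite leq_mul2r degD orbT.
  by rewrite /W big_distrl /=; apply: leq_sum => y _; rewrite leq_mul2l hv orbT.
have V0 : 0 <= V by apply: sumr_ge0.
have sW : \sum_z (W z)%:R <= D%:R * V.
  rewrite (eq_bigr _ (fun z _ => WE z)) exchange_big /= mulr_sumr; apply: ler_sum => y _.
  under eq_bigr do rewrite natrM.
  rewrite -mulr_suml ler_wpM2r // -natr_sum ler_nat (eq_bigr (fun z => h y z : nat)) //.
  by move=> z _; rewrite hsym.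
have := weighted_kernel kernel_upper Wm hv.
rewrite [X in X <= _](_ : _ = \sum_z (W z)%:R ^+ 2 - 2 * p * (\sum_z (W z)%:R) * V); last first.
  rewrite [2 * p * \sum_z _]mulr_sumr [X in _ - X]mulr_suml -sumrB; apply: eq_bigr => z _.
  under eq_bigr do rewrite mulrBl mulrBl.
  rewrite sumrB; congr (_ - _); last by rewrite -mulr_sumr.
  transitivity ((W z)%:R * \sum_y (h z y * v y)%N%:R : R); last by rewrite -WE expr2.
  by rewrite mulr_sumr; apply: eq_bigr => y _; rewrite natrM mulrAC mulrC.
rewrite -/V => hk; rewrite (eq_bigr (fun z => (W z)%:R ^+ 2)); last by move=> z _; rewrite WE.
have sW0 : 0 <= \sum_z (W z)%:R :> R by apply: sumr_ge0.
set sw := \sum_z (W z)%:R in hk sW sW0.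
have i1 : 2 * p * sw * V <= 2 * p * D%:R * V ^+ 2.
  rewrite expr2 mulrA; apply: ler_wpM2r => //.
  by rewrite -!mulrA; apply: ler_wpM2l => //; apply: ler_wpM2l.
have i2 : K * (vm%:R * sw + (D * vm)%:R * V) <= 2 * K * D%:R * vm%:R * V.
  rewrite natrM [2 * K]mulrC -!mulrA; apply: ler_wpM2l => //.
  have := ler_wpM2l (ler0n R vm) sW; lra.
lra.
Qed.

(** The square at [z] expands over pairs of neighbours of [z], so each pair with a common neighbour
    is counted at least once on the right. *)
Lemma common_nbr_weight (v : A -> nat) :
  \sum_y \sum_y' (common_nbr y y')%:R * (v y)%:R * (v y')%:R <=
  \sum_z (\sum_y (h z y * v y)%N%:R) ^+ 2 :> R.
Proof.
under [X in _ <= X]eq_bigr do rewrite expr2 big_distrlr /=.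
rewrite [X in _ <= X]exchange_big /=; apply: ler_sum => y _.
rewrite [X in _ <= X]exchange_big /=; apply: ler_sum => y' _.
under eq_bigr do rewrite -natrM mulnACA natrM.
rewrite -mulr_suml -[(_ * _ * _)]mulrA -natrM ler_wpM2r // -natr_sum ler_nat.
rewrite /common_nbr; case: existsP => [[z /andP[h1 h2]]|] //=.
by rewrite (bigD1 z) //= h1 h2.
Qed.

(* If the smaller weight of a pair is at most [a] times the larger one the pair is paid
   for by degrees; otherwise the product is at most [min(w, w')^2 / a], a sum over levels. *)
Lemma weighted_edges_le (w : A -> nat) (a : R) : 0 < a ->
  \sum_x \sum_x' (h x x')%:R * (w x)%:R * (w x')%:R <=
  2 * a * D%:R * \sum_x (w x)%:R ^+ 2 +
  a^-1 * (4 * p * (\sum_x (w x)%:R) ^+ 2 + 2 * K * \sum_x (w x)%:R ^+ 2).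
Proof.
move=> a0; pose n := (\max_x w x)%N.
have wn x : (w x <= n)%N by apply: leq_bigmax.
have ai0 : 0 < a^-1 by rewrite invr_gt0.
pose X (i : nat) := [set x | (i < w x)%N].
have sq k : (k%:R ^+ 2 : R) = \sum_(i < k) (2 * i + 1)%:R.
  elim: k => [|k IH]; first by rewrite big_ord0 expr2 mulr0.
  by rewrite big_ord_recr /= -IH -natr1 natrD natrM; ring.
have pair x x' : (w x)%:R * (w x')%:R <= a * ((w x)%:R ^+ 2 + (w x')%:R ^+ 2) +
    a^-1 * (minn (w x) (w x'))%:R ^+ 2 :> R.
  have aux (s t : R) : 0 <= s -> s <= t -> s * t <= a * (s ^+ 2 + t ^+ 2) + a^-1 * s ^+ 2.
    move=> s0 st; have t0 := le_trans s0 st.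
    have [le|lt] := leP s (a * t).
      have : s * t <= a * t * t by apply: ler_wpM2r.
      have : 0 <= a * s ^+ 2 by rewrite mulr_ge0 // ?exprn_ge0 // ltW.
      have : 0 <= a^-1 * s ^+ 2 by rewrite mulr_ge0 // ?exprn_ge0 // ltW.
      rewrite expr2; lra.
    have : t <= a^-1 * s by rewrite mulrC ler_pdivlMr // mulrC ltW.
    move/(ler_wpM2l s0); rewrite mulrCA -expr2.
    have : 0 <= a * (s ^+ 2 + t ^+ 2) by rewrite mulr_ge0 ?addr_ge0 ?exprn_ge0 // ltW.
    lra.
  case: (leqP (w x) (w x')) => hx.
    by apply: aux => //; rewrite ler_nat.
  by rewrite mulrC [_ + (w x')%:R ^+ 2]addrC; apply: aux => //; rewrite ler_nat ltnW.
pose S2 : R := \sum_x (w x)%:R ^+ 2.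
pose W : R := \sum_x (w x)%:R.
have degx (F : A -> R) : (forall x, 0 <= F x) ->
    \sum_x \sum_x' (h x x')%:R * F x <= D%:R * \sum_x F x.
  move=> F0; rewrite mulr_sumr; apply: ler_sum => x _.
  by rewrite -mulr_suml ler_wpM2r // -natr_sum ler_nat.
have degx' (F : A -> R) : (forall x, 0 <= F x) ->
    \sum_x \sum_x' (h x x')%:R * F x' <= D%:R * \sum_x F x.
  move=> F0; rewrite exchange_big /=; apply: le_trans (degx F F0).
  by apply: ler_sum => x _; apply: ler_sum => x' _; rewrite hsym.
have w2 x : 0 <= (w x)%:R ^+ 2 :> R by rewrite exprn_ge0.
have lvl : \sum_x \sum_x' (h x x')%:R * (minn (w x) (w x'))%:R ^+ 2 =
    \sum_(i < n) (2 * i + 1)%:R * ecount R h (X i) (X i).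
  under eq_bigr => x _.
    under eq_bigr => x' _.
      rewrite sq (natr_levels (fun i => (2 * i + 1)%:R) (n := n)) ?geq_min ?wn // mulr_sumr.
      over.
    rewrite exchange_big /=.
    over.
  rewrite exchange_big /=; apply: eq_bigr => i _; rewrite /ecount mulr_sumr.
  rewrite [RHS]big_mkcond /=; apply: eq_bigr => x _; rewrite inE mulr_sumr.
  case: (boolP (i < w x)%N) => hx; last first.
    by rewrite big1 // => x' _; rewrite leq_min (negbTE hx) mul0r mulr0.
  rewrite [RHS]big_mkcond /=; apply: eq_bigr => x' _; rewrite inE leq_min hx /=.
  by case: (i < w x')%N; rewrite ?mul1r ?mul0r ?mulr0 // mulrC.
have S2E : \sum_(i < n) #|X i|%:R * (2 * i + 1)%:R = S2.
  by rewrite /S2 -(sum_levels (fun i => (2 * i + 1)%:R) wn); apply: eq_bigr => x _; rewrite sq.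
have WE : \sum_(i < n) #|X i|%:R = W.
  have := sum_levels (fun i => (1 : R)) wn.
  under [X in _ = X -> _]eq_bigr do rewrite mulr1.
  by move <-; apply: eq_bigr => x _; rewrite sumr_const card_ord.
(* Markov's inequality for level sets. It trades one factor [#|X i|] in the quadratic term of
   [upperC] for the total weight, leaving a sum over levels that is linear. *)
have XW (i : nat) : (2 * i + 1)%:R * #|X i|%:R <= 2 * W.
  apply: (@le_trans _ _ (2 * (#|X i|%:R * (i.+1)%:R))).
    have : 0 <= #|X i|%:R :> R by [].
    have -> : (2 * i + 1)%:R = 2 * i%:R + 1 :> R by rewrite natrD natrM.
    have -> : i.+1%:R = i%:R + 1 :> R by rewrite natr1.
    by move: (#|X i|%:R) (i%:R) => y t; lra.
  rewrite ler_wpM2l // /W (bigID (mem (X i))) /= -sum1_card natr_sum mulr_suml.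
  apply: (@le_trans _ _ (\sum_(x in X i) (w x)%:R)); last by rewrite lerDl sumr_ge0.
  by apply: ler_sum => x; rewrite inE mul1r ler_nat.
have W0 : 0 <= W by apply: sumr_ge0.
have main : \sum_(i < n) (2 * i + 1)%:R * ecount R h (X i) (X i) <=
    4 * p * W ^+ 2 + 2 * K * S2.
  apply: (@le_trans _ _ (\sum_(i < n) (4 * p * W * #|X i|%:R +
      2 * K * (#|X i|%:R * (2 * i + 1)%:R)))).
    apply: ler_sum => i _.
    have := ler_wpM2l (ler0n R (2 * i + 1)) (upperC (X i) (X i)).
    have : p * #|X i|%:R * ((2 * i + 1)%:R * #|X i|%:R) <= p * #|X i|%:R * (2 * W).
      by apply: ler_wpM2l; [rewrite mulr_ge0 | apply: XW].
    move: (#|X i|%:R) ((2 * i + 1)%:R) (ecount _ _ _ _) => y t e; lra.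
  by rewrite big_split /= -!mulr_sumr S2E WE; lra.
apply: (@le_trans _ _ (\sum_x \sum_x' (a * ((h x x')%:R * (w x)%:R ^+ 2) +
   a * ((h x x')%:R * (w x')%:R ^+ 2) +
   a^-1 * ((h x x')%:R * (minn (w x) (w x'))%:R ^+ 2)))).
  apply: ler_sum => x _; apply: ler_sum => x' _; case: (h x x') => /=.
    by rewrite !mul1r; have := pair x x'; lra.
  by rewrite !mul0r !mulr0 !addr0.
under eq_bigr do rewrite !big_split /= -!mulr_sumr.
rewrite !big_split /= -!mulr_sumr lvl.
have := degx _ w2; have := degx' _ w2; rewrite -/S2 => d1 d2.
have := ler_wpM2l (ltW a0) d1; have := ler_wpM2l (ltW a0) d2.
have := ler_wpM2l (ltW ai0) main; rewrite -/W; lra.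
Qed.

Variable b : R.
Hypothesis lowerB : forall X Y : {set A},
  b * #|X|%:R * #|Y|%:R - K * (#|X|%:R + #|Y|%:R) <= ecount R h X Y.

Definition col (S : {set A * A}) (y : A) : {set A} := [set x | (x, y) \in S].
Definition red (u v : A * A) : bool := h u.1 v.1 && ~~ common_nbr u.2 v.2.
Definition red_pairs (S : {set A * A}) : R := \sum_(u in S) \sum_(v in S) (red u v)%:R.

Lemma sum_cols (S : {set A * A}) (F : A -> A -> R) :
  \sum_(u in S) F u.1 u.2 = \sum_y \sum_(x in col S y) F x y.
Proof.
rewrite (exchange_big_dep xpredT) //= pair_big_dep /=.
by apply: eq_bigl => -[x y] /=; rewrite inE.
Qed.

Lemma sum_card_col (S : {set A * A}) : \sum_y #|col S y|%:R = #|S|%:R :> R.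
Proof.
rewrite -[in RHS]sum1_card natr_sum (sum_cols S (fun _ _ => 1%:R)).
by apply: eq_bigr => y _; rewrite -natr_sum sum1_card.
Qed.

Lemma red_pairsE (S : {set A * A}) :
  red_pairs S = \sum_y \sum_y' (~~ common_nbr y y')%:R * ecount R h (col S y) (col S y').
Proof.
rewrite /red_pairs (sum_cols S (fun x y => \sum_(v in S) (red (x, y) v)%:R)).
apply: eq_bigr => y _.
under eq_bigr => x _ do rewrite (sum_cols S (fun x' y' => (red (x, y) (x', y'))%:R)).
rewrite exchange_big /=; apply: eq_bigr => y' _; rewrite /ecount mulr_sumr.
apply: eq_bigr => x _; rewrite mulr_sumr; apply: eq_bigr => x' _.
by rewrite /red /= -natrM mulnb andbC.
Qed.

Lemma red_pairs_mono (S S' : {set A * A}) : S \subset S' -> red_pairs S <= red_pairs S'.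
Proof.
move=> sS; have mono (F : A * A -> R) : (forall u, 0 <= F u) ->
    \sum_(u in S) F u <= \sum_(u in S') F u.
  move=> F0; rewrite [X in X <= _]big_mkcond [X in _ <= X]big_mkcond /=.
  apply: ler_sum => u _; case: ifP => [/(subsetP sS)->//|_]; by case: ifP.
apply: le_trans (_ : \sum_(u in S) \sum_(v in S') (red u v)%:R <= _).
  by apply: ler_sum => u _; apply: mono.
by apply: mono => u; apply: sumr_ge0.
Qed.

(** For columns of sizes [s], [t] at least [k0], the error [K (s + t)] is at most [2 K / k0 * s t].
    Hence any two nonempty columns without a common neighbour have density at least [c] between
    them. *)
Lemma red_pairs_ge (S : {set A * A}) (k0 c : R) :
  0 < k0 -> (forall y, col S y != set0 -> k0 <= #|col S y|%:R) ->
  0 <= c -> c <= b - 2 * K / k0 ->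
  c * (#|S|%:R ^+ 2 - \sum_y \sum_y' (common_nbr y y')%:R * #|col S y|%:R * #|col S y'|%:R) <=
  red_pairs S.
Proof.
move=> k00 hk c0 hc; rewrite red_pairsE -sum_card_col expr2 big_distrlr /= -sumrB mulr_sumr.
apply: ler_sum => y _; rewrite -sumrB mulr_sumr; apply: ler_sum => y' _.
case: (common_nbr y y') => /=; first by rewrite !mul1r mul0r subrr mulr0.
rewrite !mul0r subr0 mul1r.
have e0 : 0 <= ecount R h (col S y) (col S y').
  by apply: sumr_ge0 => x _; apply: sumr_ge0.
have [z|n1] := eqVneq (col S y) set0; first by rewrite [in X in X <= _]z cards0 mul0r mulr0.
have [z|n2] := eqVneq (col S y') set0; first by rewrite [in X in X <= _]z cards0 mulr0 mulr0.
have := lowerB (col S y) (col S y').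
have := hk _ n1; have := hk _ n2.
move: (#|col S y|%:R) (#|col S y'|%:R) (ecount _ _ _ _) => s t e ht hs.
have kK : 0 <= K / k0 by rewrite divr_ge0 // ltW.
have t0 : 0 <= t by apply: le_trans ht; apply: ltW.
have s0 : 0 <= s by apply: le_trans hs; apply: ltW.
have KE : K = K / k0 * k0 by rewrite divfK // gt_eqF.
have i1 : K * s <= K / k0 * s * t.
  have -> : K * s = K / k0 * s * k0 by rewrite mulrAC -KE.
  by apply: ler_wpM2l => //; apply: mulr_ge0.
have i2 : K * t <= K / k0 * s * t.
  rewrite {1}KE; apply: ler_wpM2r => //; apply: ler_wpM2l => //.
have i3 : c * (s * t) <= (b - 2 * K / k0) * (s * t) by apply: ler_wpM2r => //; rewrite mulr_ge0.
by move: i1 i2 i3; rewrite -[2 * K / k0]mulrA; move: (K / k0) => kk; lra.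
Qed.

Lemma red_pairs_col (S : {set A * A}) (k0 c : R) (vm : nat) :
  0 < k0 -> (forall y, col S y != set0 -> k0 <= #|col S y|%:R) ->
  (forall y, (#|col S y| <= vm)%N) ->
  0 <= c -> c <= b - 2 * K / k0 ->
  c * (#|S|%:R ^+ 2 - (2 * p * D%:R * #|S|%:R ^+ 2 + 2 * K * D%:R * vm%:R * #|S|%:R)) <=
  red_pairs S.
Proof.
move=> k00 hk hv c0 hc; apply: le_trans (red_pairs_ge k00 hk c0 hc).
apply: ler_wpM2l => //; rewrite lerD2l lerN2.
apply: le_trans (common_nbr_weight (fun y => #|col S y|)) _.
by rewrite -sum_card_col; apply: sum_wdeg_sq.
Qed.

(** For such a small [U] the upper bound reads [2 K |Z| + K |U|]. As every [z] sends more than [4 K]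
    edges, [2 |Z| <= |U|] follows and is put back into the bound. *)
Lemma heavy_edges (U : {set A}) : 2 * p * #|U|%:R <= K ->
  ecount R h [set z | 4 * K < (\sum_(y in U) h z y)%:R] U <= 2 * K * #|U|%:R.
Proof.
move=> pU; set Z := [set z | _].
have : 4 * K * #|Z|%:R <= ecount R h Z U.
  rewrite mulr_natr -sumr_const; apply: ler_sum => z; rewrite inE natr_sum; exact: ltW.
have := upperC Z U.
have : 2 * p * #|U|%:R * #|Z|%:R <= K * #|Z|%:R by apply: ler_wpM2r.
move: (#|Z|%:R) (#|U|%:R) (ecount _ _ _ _) => s t e; lra.
Qed.

(* Few columns: outside a small exceptional set, a column meets at most two of the few
   vertices [z] with many neighbours among the columns, hence shares such a [z] with
   columns of total weight at most [2 D |A|]; all other [z] create few bad pairs. *)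
Lemma common_nbr_tall (S : {set A * A}) (U : {set A}) (u0 N2 z0 T : R) :
  (forall y, (col S y != set0) -> y \in U) -> #|U|%:R <= u0 ->
  2 * p * u0 <= K -> 4 * K <= T -> 0 < T -> 2 * K * u0 <= z0 * T ->
  #|[set z | (2 <= \sum_(y in U) h z y)%N]|%:R <= N2 ->
  (forall Z Y : {set A}, #|Z|%:R <= z0 -> [disjoint Z & Y] ->
     (forall y, y \in Y -> (3 <= \sum_(z in Z) h z y)%N) -> #|Y|%:R <= 5 * z0) ->
  (3 * D%:R * #|A|%:R <= #|S|%:R :> R) ->
  1 + 6 * z0 <= D%:R / 8 -> 16 * K ^+ 2 * N2 + 2 * K * T * u0 <= D%:R ^+ 2 / 4 ->
  \sum_y \sum_y' (common_nbr y y')%:R * #|col S y|%:R * #|col S y'|%:R <=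
  3 / 4 * #|S|%:R ^+ 2 :> R.
Proof.
move=> hU Uu pU KT T0 hz N2P fan V3 h1 h2.
pose c z := (\sum_(y in U) h z y)%N.
pose v y : R := #|col S y|%:R.
pose V : R := #|S|%:R.
pose m : R := #|A|%:R.
have v0 y : 0 <= v y by [].
have vm y : v y <= m by rewrite /v /m ler_nat max_card.
have vU y : y \notin U -> v y = 0.
  by move=> yU; apply/eqP; rewrite pnatr_eq0 cards_eq0; apply: contraNT yU; apply: hU.
have VE : \sum_y v y = V by apply: sum_card_col.
have m0 : 0 <= m by [].
have V0 : 0 <= V by [].
have UU : 2 * K * #|U|%:R <= 2 * K * u0 by apply: ler_wpM2l => //; rewrite mulr_ge0.
pose Zb := [set z | 4 * K < (c z)%:R].
have eZb : ecount R h Zb U <= 2 * K * u0.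
  apply: le_trans UU; apply: heavy_edges; apply: le_trans pU.
  by apply: ler_wpM2l => //; rewrite mulr_ge0.
have cE z : \sum_(y in U) (h z y)%:R = (c z)%:R :> R by rewrite /c natr_sum.
have eZbE : ecount R h Zb U = \sum_(z in Zb) (c z)%:R.
  by apply: eq_bigr => z _; rewrite cE.
pose Zh := [set z | T < (c z)%:R].
have Zhb : Zh \subset Zb by apply/subsetP => z; rewrite !inE; apply: le_lt_trans.
have cZh : #|Zh|%:R <= z0.
  rewrite -(ler_pM2r T0); apply: le_trans hz; apply: le_trans eZb; rewrite eZbE.
  rewrite -mulr_natl mulr1 mulr_natl -sumr_const.
  apply: (@le_trans _ _ (\sum_(z in Zh) (c z)%:R)).
    by apply: ler_sum => z; rewrite inE => /ltW.
  rewrite [X in X <= _]big_mkcond [X in _ <= X]big_mkcond /=; apply: ler_sum => z _.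
  by case: ifP => [/(subsetP Zhb)->//|_]; case: ifP.
have z00 : 0 <= z0 by apply: le_trans cZh.
pose Y3 := [set y | (y \notin Zh) && (3 <= \sum_(z in Zh) h z y)%N].
have cY3 : #|Y3|%:R <= 5 * z0.
  apply: (fan Zh) => //.
    by rewrite -setI_eq0; apply/eqP/setP => y; rewrite !inE; case: (_ < _).
  by move=> y; rewrite inE => /andP[].
pose bad := Zh :|: Y3.
have cbad : #|bad|%:R <= 6 * z0.
  apply: le_trans (_ : (#|Zh| + #|Y3|)%:R <= _); last by rewrite natrD; lra.
  by rewrite ler_nat cardsU leq_subr.
pose lo := [set z | (z \notin Zh) && (2 <= c z)%N].
(* A pair is charged to the diagonal, to a common neighbour outside [Zh], to an exceptional [y], or,
   for the other [y], to a common neighbour inside [Zh]. A common neighbour of two distinct columns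
   has at least two neighbours in [U], as [lo] requires. *)
have split4 y y' : (common_nbr y y')%:R * v y * v y' <=
    (y == y')%:R * v y * v y' + \sum_(z in lo) (h z y)%:R * v y * ((h z y')%:R * v y') +
    (y \in bad)%:R * v y * v y' +
    (y \notin bad)%:R * v y * (\sum_(z in Zh) (h z y)%:R * ((h z y')%:R * v y')).
  have t1 : 0 <= (y == y')%:R * v y * v y' by rewrite !mulr_ge0.
  have t2 : 0 <= \sum_(z in lo) (h z y)%:R * v y * ((h z y')%:R * v y').
    by apply: sumr_ge0 => z _; rewrite !mulr_ge0.
  have t3 : 0 <= (y \in bad)%:R * v y * v y' by rewrite !mulr_ge0.
  have t4 : 0 <= (y \notin bad)%:R * v y * (\sum_(z in Zh) (h z y)%:R * ((h z y')%:R * v y')).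
    by rewrite !mulr_ge0 //; apply: sumr_ge0 => z _; rewrite !mulr_ge0.
  case: (boolP (common_nbr y y')) => [/existsP[z /andP[hy hy']]|_]; last by rewrite !mul0r; lra.
  rewrite mul1r.
  have t0 := addr_ge0 (addr_ge0 (addr_ge0 t1 t2) t3) t4.
  have [yU|yU] := boolP (y \in U); last first.
    by have -> : v y * v y' = 0 by rewrite vU ?mul0r.
  have [yU'|yU'] := boolP (y' \in U); last first.
    by have -> : v y * v y' = 0 by rewrite (vU y') ?mulr0.
  have [zh|zl] := boolP (z \in Zh).
    have [yb|yb] := boolP (y \in bad); first by rewrite yb in t3 t4 *; rewrite mul1r in t3 *; lra.
    suff hs : v y * v y' <= v y * (\sum_(z in Zh) (h z y)%:R * ((h z y')%:R * v y')).
      by rewrite /= !mul0r mul1r; lra.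
    apply: ler_wpM2l => //.
    rewrite (bigD1 z) //= hy hy' !mul1r lerDl; apply: sumr_ge0 => ? _; by rewrite !mulr_ge0.
  have [yy|ny] := eqVneq y y'; first by rewrite mul1r; lra.
  suff hs : v y * v y' <= \sum_(z in lo) (h z y)%:R * v y * ((h z y')%:R * v y').
    by rewrite !mul0r; lra.
  have zlo : z \in lo.
    rewrite inE zl /= /c (bigD1 y) //= (bigD1 y') /=; last by rewrite yU' eq_sym.
    by rewrite hy hy'.
  rewrite (bigD1 z) //= hy hy' !mul1r lerDl; apply: sumr_ge0 => ? _; by rewrite !mulr_ge0.
have s1 : \sum_y \sum_y' (y == y')%:R * v y * v y' <= m * V.
  rewrite -VE mulr_sumr; apply: ler_sum => y _.
  rewrite (bigD1 y) //= eqxx mul1r big1 ?addr0 ?ler_wpM2r //.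
  by move=> y' /negbTE; rewrite eq_sym => ->; rewrite !mul0r.
have s2 : \sum_y \sum_y' \sum_(z in lo) (h z y)%:R * v y * ((h z y')%:R * v y') <=
    m ^+ 2 * (D%:R ^+ 2 / 4).
  under eq_bigr do rewrite exchange_big /=.
  rewrite exchange_big /=.
  have step z : \sum_y \sum_y' (h z y)%:R * v y * ((h z y')%:R * v y') <=
      m ^+ 2 * (c z)%:R ^+ 2.
    rewrite -[X in X <= _]big_distrlr /= -expr2 -exprMn ler_pXn2r ?nnegrE ?mulr_ge0 //; last first.
      by apply: sumr_ge0 => y _; rewrite mulr_ge0.
    rewrite -cE mulr_sumr [X in _ <= X]big_mkcond /=; apply: ler_sum => y _.
    case: ifP => [_|/negbT/vU->]; last by rewrite mulr0.
    by rewrite mulrC ler_wpM2r.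
  apply: (@le_trans _ _ (\sum_(z in lo) m ^+ 2 * (c z)%:R ^+ 2)).
    by apply: ler_sum => z _; apply: step.
  rewrite -mulr_sumr ler_wpM2l ?exprn_ge0 //; apply: le_trans h2.
  (* Outside [Zb] there are at most [N2] vertices, each with [c z <= 4 K]. Inside [Zb] but outside
     [Zh], [c z <= T] reduces the squares to the edge count [eZb]. *)
  rewrite (bigID (mem Zb)) /= addrC; apply: lerD.
    apply: (@le_trans _ _ (\sum_(z in [set z | (2 <= c z)%N]) 16 * K ^+ 2)).
      rewrite [X in X <= _]big_mkcond [X in _ <= X]big_mkcond /=; apply: ler_sum => z _.
      rewrite !inE -!leNgt; case: ifP => [/andP[/andP[_ ->] cz]|_].
        rewrite (_ : 16 * K ^+ 2 = (4 * K) ^+ 2); last by ring.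
        by rewrite ler_pXn2r ?nnegrE ?mulr_ge0.
      by case: ifP => // _; rewrite mulr_ge0 ?exprn_ge0.
    rewrite sumr_const -[_ *+ #|_|]mulr_natr ler_wpM2l ?mulr_ge0 ?exprn_ge0 //.
  apply: (@le_trans _ _ (\sum_(z in Zb) T * (c z)%:R)).
    rewrite [X in X <= _]big_mkcond [X in _ <= X]big_mkcond /=; apply: ler_sum => z _.
    rewrite inE; case: (boolP (z \in Zb)) => zb; rewrite ?andbF // andbT.
    case: ifP => [/andP[zl _]|_]; last by rewrite mulr_ge0 // ltW.
    by rewrite expr2 ler_wpM2r //; move: zl; rewrite inE -leNgt.
  rewrite -mulr_sumr -eZbE.
  have := ler_wpM2l (ltW T0) eZb; lra.
have s3 : \sum_y \sum_y' (y \in bad)%:R * v y * v y' <= 6 * z0 * m * V.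
  under eq_bigr do rewrite -mulr_sumr VE.
  rewrite -mulr_suml ler_wpM2r //.
  apply: (@le_trans _ _ (#|bad|%:R * m)); last by rewrite ler_wpM2r.
  rewrite mulr_natl -sumr_const [X in _ <= X]big_mkcond /=; apply: ler_sum => y _.
  by case: ifP; rewrite ?mul1r ?mul0r.
have s4 : \sum_y \sum_y' (y \notin bad)%:R * v y *
      (\sum_(z in Zh) (h z y)%:R * ((h z y')%:R * v y')) <= 2 * D%:R * m * V.
  rewrite -[X in _ <= _ * X]VE mulr_sumr; apply: ler_sum => y _.
  rewrite -mulr_sumr mulrAC [X in _ <= X]mulrC -mulrA.
  rewrite [X in X <= _](_ : _ = v y * ((y \notin bad)%:R *
    \sum_y' \sum_(z in Zh) (h z y)%:R * ((h z y')%:R * v y'))); last by ring.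
  apply: ler_wpM2l => //.
  case: (boolP (y \in bad)) => yb; first by rewrite mul0r !mulr_ge0.
  rewrite mul1r exchange_big /=.
  apply: (@le_trans _ _ (\sum_(z in Zh) (h z y)%:R * (D%:R * m))).
    apply: ler_sum => z _; rewrite -mulr_sumr ler_wpM2l //.
    apply: (@le_trans _ _ (\sum_y' (h z y')%:R * m)).
      by apply: ler_sum => y' _; rewrite ler_wpM2l.
    by rewrite -mulr_suml ler_wpM2r // -natr_sum ler_nat.
  rewrite -mulr_suml -mulrA ler_wpM2r ?mulr_ge0 // -natr_sum ler_nat.
  (* The decisive factor 2: a [y] outside [Zh] and [Y3] has fewer than three neighbours in [Zh]. *)
  move: yb; rewrite !inE negb_or => /andP[yZ]; rewrite yZ /= -ltnNge ltnS; exact.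
apply: (@le_trans _ _ (m * V + m ^+ 2 * (D%:R ^+ 2 / 4) + 6 * z0 * m * V + 2 * D%:R * m * V)).
  apply: le_trans (_ : _ <= \sum_y \sum_y' _) _.
    by apply: ler_sum => y _; apply: ler_sum => y' _; apply: split4.
  under eq_bigr do rewrite !big_split /=.
  rewrite !big_split /=; by apply: lerD s4; apply: lerD s3; apply: lerD s1 s2.
by apply: tall_arith => //; rewrite mulrA.
Qed.

Lemma red_pairs_tall (S : {set A * A}) (U : {set A}) (k0 c u0 N2 z0 T : R) :
  0 < k0 -> (forall y, col S y != set0 -> k0 <= #|col S y|%:R) ->
  0 <= c -> c <= b - 2 * K / k0 ->
  (forall y, (col S y != set0) -> y \in U) -> #|U|%:R <= u0 ->
  2 * p * u0 <= K -> 4 * K <= T -> 0 < T -> 2 * K * u0 <= z0 * T ->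
  #|[set z | (2 <= \sum_(y in U) h z y)%N]|%:R <= N2 ->
  (forall Z Y : {set A}, #|Z|%:R <= z0 -> [disjoint Z & Y] ->
     (forall y, y \in Y -> (3 <= \sum_(z in Z) h z y)%N) -> #|Y|%:R <= 5 * z0) ->
  (3 * D%:R * #|A|%:R <= #|S|%:R :> R) ->
  1 + 6 * z0 <= D%:R / 8 -> 16 * K ^+ 2 * N2 + 2 * K * T * u0 <= D%:R ^+ 2 / 4 ->
  c / 4 * #|S|%:R ^+ 2 <= red_pairs S.
Proof.
move=> k00 hk c0 hc hU Uu pU KT T0 hz N2P fan V3 h1 h2.
apply: le_trans (red_pairs_ge k00 hk c0 hc).
have := common_nbr_tall hU Uu pU KT T0 hz N2P fan V3 h1 h2.
move/(ler_wpM2l c0); move: (#|S|%:R ^+ 2) => V2; lra.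
Qed.

Definition row (S : {set A * A}) (x : A) : {set A} := [set y | (x, y) \in S].

Lemma sum_rows (S : {set A * A}) (F : A -> A -> R) :
  \sum_(u in S) F u.1 u.2 = \sum_x \sum_(y in row S x) F x y.
Proof. by rewrite pair_big_dep /=; apply: eq_bigl => -[x y] /=; rewrite inE. Qed.

(** When rows and columns are short, all pairs with adjacent first coordinates are counted and the
    spoiled ones subtracted. The latter are grouped by the common neighbour [z]: with [w z x] the
    number of neighbours of [z] in row [x], they form a weighted edge count, bounded by
    [weighted_edges_le]. *)
Lemma red_pairs_small (S : {set A * A}) (a : R) (k : nat) :
  0 < a -> (forall y, (#|col S y| <= k)%N) -> (forall x, (#|row S x| <= k)%N) ->
  b * #|S|%:R ^+ 2 - 2 * K * k%:R * #|S|%:R -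
  ((2 * a * D%:R + 2 * K / a) * (2 * p * k%:R + 2 * K) * D%:R * #|S|%:R +
   4 * p / a * (2 * p * D%:R * #|S|%:R ^+ 2 + 2 * K * D%:R * k%:R * #|S|%:R)) <=
  red_pairs S.
Proof.
move=> a0 hc hr; set V : R := #|S|%:R; have ai0 : 0 < a^-1 by rewrite invr_gt0.
pose r x := #|row S x|.
have VE : \sum_x (r x)%:R = V.
  rewrite /V -[in RHS]sum1_card natr_sum (sum_rows S (fun _ _ => 1%:R)).
  by apply: eq_bigr => x _; rewrite -natr_sum sum1_card.
pose tot : R := \sum_(u in S) \sum_(v in S) (h u.1 v.1)%:R.
pose bad : R := \sum_(u in S) \sum_(v in S) (h u.1 v.1 && common_nbr u.2 v.2)%:R.
have redE : red_pairs S = tot - bad.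
  rewrite /tot /bad -sumrB; apply: eq_bigr => u _; rewrite -sumrB; apply: eq_bigr => v _.
  by rewrite /red; case: (h _ _); case: (common_nbr _ _); rewrite /= ?subrr ?subr0.
have totE : tot = \sum_x \sum_x' (h x x')%:R * (r x)%:R * (r x')%:R.
  rewrite /tot (sum_rows S (fun x _ => \sum_(v in S) (h x v.1)%:R)).
  apply: eq_bigr => x _; rewrite sumr_const -/(r x).
  rewrite (sum_rows S (fun x' _ => (h x x')%:R)) -sumrMnl; apply: eq_bigr => x' _.
  by rewrite sumr_const -/(r x') -mulrnA -mulrA -natrM mulr_natr mulnC.
have tot_ge : b * V ^+ 2 - 2 * K * k%:R * V <= tot.
  have kl (X Y : {set A}) :
      \sum_(x in X) \sum_(y in Y) (b - (h x y)%:R) <= K * (#|X|%:R + #|Y|%:R).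
    under eq_bigr do rewrite sumrB sumr_const.
    rewrite sumrB sumr_const -mulrnA -[_ *+ (_ * _)]mulr_natr natrM.
    have := lowerB X Y; rewrite /ecount [#|Y|%:R * _]mulrC mulrA; lra.
  have := weighted_kernel kl hr hr; rewrite VE.
  rewrite [X in X <= _](_ : _ = b * V ^+ 2 - tot); first by lra.
  rewrite totE -VE expr2 big_distrlr /= mulr_sumr -sumrB; apply: eq_bigr => x _.
  rewrite mulr_sumr -sumrB; apply: eq_bigr => y _; rewrite /r; ring.
pose w z x := (\sum_(y in row S x) h z y)%N.
have bad_le : bad <= \sum_z \sum_x \sum_x' (h x x')%:R * (w z x)%:R * (w z x')%:R.
  rewrite /bad (sum_rows S (fun x y => \sum_(v in S) (h x v.1 && common_nbr y v.2)%:R)).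
  rewrite [X in _ <= X]exchange_big /=; apply: ler_sum => x _.
  under eq_bigr => y _ do
    rewrite (sum_rows S (fun x' y' => (h x x' && common_nbr y y')%:R)).
  rewrite exchange_big /= [X in _ <= X]exchange_big /=; apply: ler_sum => x' _.
  under [X in _ <= X]eq_bigr do rewrite -mulrA /w !natr_sum big_distrlr /=.
  rewrite -mulr_sumr [X in _ <= _ * X]exchange_big /= mulr_sumr; apply: ler_sum => y _.
  rewrite [X in _ <= _ * X]exchange_big /= mulr_sumr; apply: ler_sum => y' _.
  under [X in _ <= _ * X]eq_bigr do rewrite -natrM.
  rewrite -natr_sum -natrM ler_nat; case: (h x x') => //=; rewrite mul1n.
  rewrite /common_nbr; case: existsP => [[z /andP[h1 h2]]|] //=.
  by rewrite (bigD1 z) //= h1 h2.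
pose W z : R := \sum_x (w z x)%:R.
pose Q z : R := \sum_x (w z x)%:R ^+ 2.
have WE z : W z = \sum_y (h z y * #|col S y|)%N%:R.
  rewrite /W; under eq_bigr do rewrite /w natr_sum.
  rewrite -(sum_rows S (fun x y => (h z y)%:R)) (sum_cols S (fun x y => (h z y)%:R)).
  by apply: eq_bigr => y _; rewrite sumr_const natrM mulr_natr.
have sW : \sum_z W z ^+ 2 <= 2 * p * D%:R * V ^+ 2 + 2 * K * D%:R * k%:R * V.
  under eq_bigr do rewrite WE.
  by rewrite /V -sum_card_col; apply: sum_wdeg_sq.
have sQ : \sum_z Q z <= (2 * p * k%:R + 2 * K) * D%:R * V.
  rewrite /Q exchange_big /= -VE mulr_sumr; apply: ler_sum => x _.
  (* The same second moment bound, now with the indicator of one row as weight. *)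
  have := @sum_wdeg_sq (fun y => (y \in row S x) : nat) 1%N (fun y => leq_b1 _).
  rewrite (eq_bigr (fun z => (w z x)%:R ^+ 2)); last first.
    move=> z _; congr (_ ^+ 2); rewrite /w natr_sum [RHS]big_mkcond /=; apply: eq_bigr => y _.
    by case: ifP => _; rewrite ?muln1 ?muln0.
  rewrite -natr_sum (_ : (\sum_y (y \in row S x) = r x)%N); last first.
    by rewrite /r -sum1_card [RHS]big_mkcond /=; apply: eq_bigr => y _; case: ifP.
  move=> hh; apply: le_trans hh _.
  have rk : (r x)%:R <= k%:R :> R by rewrite ler_nat hr.
  have r0 : 0 <= (r x)%:R :> R by [].
  have pD : 0 <= 2 * p * D%:R by rewrite !mulr_ge0.
  have := ler_wpM2l pD (ler_wpM2r r0 rk).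
  rewrite expr2; move: ((r x)%:R) (k%:R) (D%:R) => s t d; lra.
have bound z : \sum_x \sum_x' (h x x')%:R * (w z x)%:R * (w z x')%:R <=
    (2 * a * D%:R + 2 * K / a) * Q z + 4 * p / a * W z ^+ 2.
  apply: le_trans (@weighted_edges_le (w z) a a0) _; rewrite -/(Q z) -/(W z).
  by rewrite le_eqVlt; apply/orP; left; apply/eqP; ring.
have fin : bad <= (2 * a * D%:R + 2 * K / a) * \sum_z Q z + 4 * p / a * \sum_z W z ^+ 2.
  apply: le_trans bad_le _; rewrite !mulr_sumr -big_split /=.
  by apply: ler_sum => z _; apply: bound.
have c1 : 0 <= 2 * a * D%:R + 2 * K / a.
  by rewrite addr_ge0 // !mulr_ge0 // ltW.
have c2 : 0 <= 4 * p / a by rewrite !mulr_ge0 // ltW.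
have := ler_wpM2l c1 sQ; have := ler_wpM2l c2 sW; rewrite redE !mulrA; lra.
Qed.

End BaseGraph.

(** * The two-coordinate product graph *)

(** The upper density only enters error terms, so the crude [2 p] suffices; the lower density and
    [D] enter the exponent and must be close to [p] and [p m]. *)
Record base_graph (R : realFieldType) (A : finType) (h : rel A) (p K : R) (D : nat)
    (u0 N2 z0 : R) : Prop := BaseGraph {
  base_sym : symmetric h;
  base_irr : irreflexive h;
  base_triangle_free : forall x y z, ~ [/\ h x y, h y z & h x z];
  base_upper : forall X Y : {set A},
    ecount R h X Y <= 2 * p * #|X|%:R * #|Y|%:R + K * (#|X|%:R + #|Y|%:R);
  base_lower : forall X Y : {set A},
    19 / 20 * p * #|X|%:R * #|Y|%:R - K * (#|X|%:R + #|Y|%:R) <= ecount R h X Y;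
  base_deg : forall x, (\sum_y h x y <= D)%N;
  base_cherry : forall U : {set A}, #|U|%:R <= u0 ->
    #|[set z | (2 <= \sum_(y in U) h z y)%N]|%:R <= N2;
  base_fan : forall Z Y : {set A}, #|Z|%:R <= z0 -> [disjoint Z & Y] ->
     (forall y, y \in Y -> (3 <= \sum_(z in Z) h z y)%N) -> #|Y|%:R <= 5 * z0 }.

Definition swap (A : finType) (u : A * A) : A * A := (u.2, u.1).

Definition product_adj (A : finType) (h : rel A) (u v : A * A) : bool :=
  red h u v || red h (swap u) (swap v).

Lemma common_nbr_sym (A : finType) (h : rel A) : symmetric (common_nbr h).
Proof. by move=> y y'; apply/existsP/existsP => -[z /andP[h1 h2]]; exists z; rewrite h1 h2. Qed.

Lemma red_sym (A : finType) (h : rel A) : symmetric h -> symmetric (red h).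
Proof. by move=> hs u v; rewrite /red hs common_nbr_sym. Qed.

Lemma product_adj_sym (A : finType) (h : rel A) : symmetric h -> symmetric (product_adj h).
Proof.
by move=> hs u v; rewrite /product_adj (red_sym hs) [red h (swap u) _](red_sym hs).
Qed.

Lemma product_adj_irr (A : finType) (h : rel A) : irreflexive h -> irreflexive (product_adj h).
Proof. by move=> hi u; rewrite /product_adj /red /swap /= !hi. Qed.

Definition product_graph (A : finType) (h : rel A) (hs : symmetric h) (hi : irreflexive h) :
  sgraph (A * A)%type := SGraph (product_adj_sym hs) (product_adj_irr hi).

(** Of the eight colourings, the six mixed ones contradict a missing common neighbour; the two with
    one colour project to a triangle of [h] in one coordinate. *)
Lemma product_triangle_free (A : finType) (h : rel A) (hs : symmetric h)
    (hi : irreflexive h) :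
  (forall x y z, ~ [/\ h x y, h y z & h x z]) -> triangle_free (product_graph hs hi).
Proof.
move=> tf u v w [/=]; rewrite /product_adj /red /swap /=.
have cn x y z : h x y -> h y z -> common_nbr h x z = true.
  by move=> h1 h2; apply/existsP; exists y; rewrite hs h1 h2.
have cn' x y z : h x y -> h x z -> common_nbr h y z = true.
  by move=> h1 h2; apply/existsP; exists x; rewrite h1 h2.
have cn'' x y z : h y z -> h x z -> common_nbr h x y = true.
  by move=> h1 h2; apply: cn h2 _; rewrite hs.
case/orP => /andP[a1 a2]; case/orP => /andP[b1 b2]; case/orP => /andP[c1 c2].
- by apply: (tf u.1 v.1 w.1).
- by rewrite (cn _ _ _ a1 b1) in c2.
- by rewrite (cn' _ _ _ a1 c1) in b2.
- by rewrite (cn'' _ _ _ b1 c1) in a2.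
- by rewrite (cn'' _ _ _ b1 c1) in a2.
- by rewrite (cn' _ _ _ a1 c1) in b2.
- by rewrite (cn _ _ _ a1 b1) in c2.
by apply: (tf u.2 v.2 w.2).
Qed.

Definition edge_pairs (R : realFieldType) (A : finType) (h : rel A) (S : {set A * A}) : R :=
  \sum_(u in S) \sum_(v in S) (product_adj h u v)%:R.

Definition transpose (A : finType) (S : {set A * A}) : {set A * A} := [set u | swap u \in S].

Lemma sum_transpose (R : realFieldType) (A : finType) (S : {set A * A}) (F : A * A -> R) :
  \sum_(u in transpose S) F u = \sum_(u in S) F (swap u).
Proof.
rewrite (reindex (@swap A)) /=; last first.
  by exists (@swap A) => -[x y] _.
by apply: eq_bigl => -[x y]; rewrite inE.
Qed.

Lemma card_transpose (A : finType) (S : {set A * A}) : #|transpose S| = #|S|.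
Proof.
rewrite -!sum1_card (reindex (@swap A)) /=; last by exists (@swap A) => -[x y] _.
by apply: eq_bigl => -[x y]; rewrite inE.
Qed.

Lemma col_transpose (A : finType) (S : {set A * A}) x : col (transpose S) x = row S x.
Proof. by apply/setP => y; rewrite !inE. Qed.

Lemma red_le_edge_pairs (R : realFieldType) (A : finType) (h : rel A) (S : {set A * A}) :
  red_pairs R h S <= edge_pairs R h S.
Proof.
apply: ler_sum => u _; apply: ler_sum => v _; rewrite ler_nat /product_adj.
by case: (red h u v).
Qed.

Lemma blue_le_edge_pairs (R : realFieldType) (A : finType) (h : rel A) (S : {set A * A}) :
  red_pairs R h (transpose S) <= edge_pairs R h S.
Proof.
rewrite /red_pairs sum_transpose; apply: ler_sum => u _; rewrite sum_transpose.
apply: ler_sum => v _; rewrite ler_nat /product_adj orbC.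
by case: (red h (swap u) (swap v)).
Qed.

(** Pairs that are both red and blue are adjacent in both coordinates, so each vertex has at most
    [D^2] of them. *)
Lemma edge_pairs_ge (R : realFieldType) (A : finType) (h : rel A) (D : nat) (S : {set A * A}) :
  (forall x, (\sum_y h x y <= D)%N) ->
  red_pairs R h S + red_pairs R h (transpose S) <= edge_pairs R h S + D%:R ^+ 2 * #|S|%:R.
Proof.
move=> degD; rewrite /red_pairs sum_transpose -big_split /= -[#|S|]sum1_card natr_sum mulr_sumr.
rewrite /edge_pairs -big_split /=; apply: ler_sum => u _.
rewrite sum_transpose -big_split /= mulr1.
apply: (@le_trans _ _ (\sum_(v in S) ((product_adj h u v)%:R + (h u.1 v.1)%:R * (h u.2 v.2)%:R))).
  apply: ler_sum => v _; rewrite -!natrM -!natrD ler_nat /product_adj /red /swap /=.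
  by case: (h u.1 v.1); case: (h u.2 v.2); case: (common_nbr _ _ _); case: (common_nbr _ _ _).
rewrite big_split /= lerD2l expr2.
apply: (@le_trans _ _ (\sum_(v : A * A) (h u.1 v.1)%:R * (h u.2 v.2)%:R)).
  by rewrite [X in X <= _]big_mkcond /=; apply: ler_sum => v _; case: ifP => // _; rewrite mulr_ge0.
rewrite -(pair_big xpredT xpredT (fun x y => (h u.1 x)%:R * (h u.2 y)%:R)) /=.
by rewrite -big_distrlr /= -!natr_sum; apply: ler_pM; rewrite // ler_nat.
Qed.

Definition cols_where (A : finType) (P : pred nat) (S : {set A * A}) : {set A * A} :=
  [set u in S | P #|col S u.2|].

Lemma col_cols_where (A : finType) (P : pred nat) (S : {set A * A}) y :
  col (cols_where P S) y = if P #|col S y| then col S y else set0.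
Proof.
by apply/setP => x; rewrite !inE /=; case: ifP => hP; rewrite ?andbT ?andbF ?inE.
Qed.

Lemma cols_where_sub (A : finType) (P : pred nat) (S : {set A * A}) : cols_where P S \subset S.
Proof. by apply/subsetP => u; rewrite inE => /andP[]. Qed.

Lemma card_cols_split (A : finType) (P : pred nat) (S : {set A * A}) :
  (#|S| = #|cols_where P S| + #|cols_where (predC P) S|)%N.
Proof.
rewrite -(cardsID (cols_where P S) S); congr (_ + _)%N; apply: eq_card => u; rewrite !inE.
  by rewrite andbA andbb.
by case: (u \in S); rewrite /= ?andbT ?andbF.
Qed.

(** * Edge density of large and medium vertex sets of the product *)

Section Phases.
Variables (R : realFieldType) (A : finType) (h : rel A) (p K : R) (D : nat) (u0 N2 z0 : R).
Hypothesis p0 : 0 < p.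
Hypothesis K0 : 0 < K.
Hypothesis bg : base_graph h p K D u0 N2 z0.
Let m : R := #|A|%:R.

Lemma threshold_le (k0 : R) : 0 < k0 -> 40 * K <= p * k0 ->
  9 / 10 * p <= 19 / 20 * p - 2 * K / k0.
Proof.
move=> k00 hk; have : 2 * K / k0 <= p / 20 by rewrite ler_pdivrMr //; move: hk; lra.
lra.
Qed.

(** Columns of size at least [k] give density [9/10 p]. Each of the two terms bounding pairs with a
    common neighbour is at most [|S|^2 / 100], and [9/10 * 98/100 > 88/100]. *)
Lemma red_pairs_columns (S : {set A * A}) (k vm : nat) :
  (0 < k)%N -> 40 * K <= p * k%:R -> 200 * p * D%:R <= 1 ->
  (forall y, col S y != set0 -> (k <= #|col S y|)%N) ->
  (forall y, (#|col S y| <= vm)%N) -> 200 * K * D%:R * vm%:R <= #|S|%:R ->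
  88 / 100 * p * #|S|%:R ^+ 2 <= red_pairs R h S.
Proof.
move=> k0 hk pD hc hv hV.
have k0R : 0 < k%:R :> R by rewrite ltr0n.
have hcR y : col S y != set0 -> k%:R <= #|col S y|%:R :> R by move=> /hc; rewrite ler_nat.
have c0 : 0 <= 9 / 10 * p by have := p0; lra.
apply: le_trans (red_pairs_col (ltW p0) (ltW K0) (base_sym bg) (base_upper bg)
  (base_deg bg) (base_lower bg) k0R hcR hv c0 (threshold_le k0R hk)).
have V0 : 0 <= #|S|%:R :> R by [].
have h1 := ler_wpM2r V0 hV.
have h2 := ler_wpM2r (mulr_ge0 V0 V0) pD.
have q0 : 0 <= #|S|%:R ^+ 2 - (2 * p * D%:R * #|S|%:R ^+ 2 + 2 * K * D%:R * vm%:R * #|S|%:R) -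
   98 / 100 * #|S|%:R ^+ 2 :> R.
  by move: h1 h2; rewrite expr2; move: (#|S|%:R) (D%:R) (vm%:R) => V d w; lra.
have := mulr_ge0 (ltW p0) q0; have : 0 <= p * #|S|%:R ^+ 2 by rewrite mulr_ge0 ?exprn_ge0 // ltW.
lra.
Qed.

(** Columns shorter than [k] hold at most [k m], that is one percent of [S]. For so large a set the
    trivial cap [m] on the column sizes is good enough. *)
Lemma red_pairs_large (S : {set A * A}) (k : nat) :
  (0 < k)%N -> 40 * K <= p * k%:R -> 200 * p * D%:R <= 1 ->
  100 * k%:R * m <= #|S|%:R -> 300 * K * D%:R * m <= #|S|%:R ->
  86 / 100 * p * #|S|%:R ^+ 2 <= red_pairs R h S.
Proof.
move=> k0 hk pD hS hV; set S' := cols_where (fun c => k <= c)%N S.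
apply: le_trans (@red_pairs_mono R A h _ _ (cols_where_sub (fun c => k <= c)%N S)).
have small : #|cols_where (predC (fun c => k <= c)%N) S|%:R <= k%:R * m.
  have -> : k%:R * m = \sum_(y : A) k%:R by rewrite sumr_const mulr_natr.
  rewrite -sum_card_col; apply: ler_sum => y _.
  rewrite col_cols_where /=; case: ifP; rewrite ?cards0 //.
  by rewrite -ltnNge ler_nat => /ltnW.
have VE : #|S|%:R = #|S'|%:R + #|cols_where (predC (fun c => k <= c)%N) S|%:R :> R.
  by rewrite -natrD -card_cols_split.
have V'ge : 99 / 100 * #|S|%:R <= #|S'|%:R :> R by lra.
apply: (@le_trans _ _ (88 / 100 * p * #|S'|%:R ^+ 2)).
  have V0 : 0 <= #|S|%:R :> R by [].
  have : (99 / 100 * #|S|%:R) ^+ 2 <= #|S'|%:R ^+ 2 :> R.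
    by rewrite ler_pXn2r ?nnegrE //; move: V0; lra.
  move/(ler_wpM2l (ltW p0)).
  have : 0 <= p * #|S|%:R ^+ 2 by rewrite mulr_ge0 ?exprn_ge0 // ltW.
  rewrite exprMn; move: (#|S|%:R ^+ 2) (#|S'|%:R ^+ 2) => V2 W2; lra.
apply: (red_pairs_columns (vm := #|A|) k0 hk pD) => [y|y|].
- by rewrite col_cols_where; case: ifP; rewrite ?eqxx.
- exact: max_card.
have V0 : 0 <= #|S|%:R :> R by [].
by move: V'ge hV; rewrite -/m; lra.
Qed.

(** Each colour contributes [86/100], and the overlap is at most [1/100]; what remains exceeds
    [3/2]. *)
Lemma edge_pairs_large (S : {set A * A}) (k : nat) :
  (0 < k)%N -> 40 * K <= p * k%:R -> 200 * p * D%:R <= 1 ->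
  100 * k%:R * m <= #|S|%:R -> 300 * K * D%:R * m <= #|S|%:R ->
  100 * D%:R ^+ 2 <= p * #|S|%:R ->
  3 / 2 * p * #|S|%:R ^+ 2 <= edge_pairs R h S.
Proof.
move=> k0 hk pD h1 h2 h3.
have r1 := red_pairs_large k0 hk pD h1 h2.
have r2 : 86 / 100 * p * #|S|%:R ^+ 2 <= red_pairs R h (transpose S).
  by rewrite -card_transpose; apply: (red_pairs_large k0 hk pD); rewrite card_transpose.
have := edge_pairs_ge R S (base_deg bg).
have V0 : 0 <= #|S|%:R :> R by [].
have := ler_wpM2r V0 h3.
have : 0 <= p * #|S|%:R ^+ 2 by rewrite mulr_ge0 ?exprn_ge0 // ltW.
move: r1 r2; rewrite !expr2 -!mulrA; move: (p * _) => q; lra.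
Qed.

(** Few tall columns are handled by the hub argument of [red_pairs_tall]. Many of them force [S'] to
    have at least [u0 vm] elements, enough for [red_pairs_columns] with cap [m]. For middle columns
    the cap [vm] itself makes the error small. *)
Lemma red_pairs_tall_or_mid (S : {set A * A}) (k vm : nat) (T : R) :
  (0 < k)%N -> (k <= vm)%N -> 40 * K <= p * k%:R -> 200 * p * D%:R <= 1 ->
  2 * p * u0 <= K -> 4 * K <= T -> 2 * K * u0 <= z0 * T ->
  1 + 6 * z0 <= D%:R / 8 -> 16 * K ^+ 2 * N2 + 2 * K * T * u0 <= D%:R ^+ 2 / 4 ->
  200 * K * D%:R * m <= u0 * vm%:R -> 2000 * K * vm%:R <= m ->
  63 / 10 * D%:R * m <= #|S|%:R ->
  (10 / 21 * #|S|%:R <= #|cols_where (fun c => vm < c)%N S|%:R :> R) \/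
  (#|S|%:R / 63 <= #|cols_where (fun c => (k < c) && (c <= vm))%N S|%:R :> R) ->
  1 / 10000 * p * #|S|%:R ^+ 2 <= red_pairs R h S.
Proof.
move=> k0 kvm hk pD pu KT hz h1 h2 hu hvm hS.
have V0 : 0 <= #|S|%:R :> R by [].
have pV : 0 <= p * #|S|%:R ^+ 2 by rewrite mulr_ge0 ?exprn_ge0 // ltW.
have T0 : 0 < T by apply: lt_le_trans KT; rewrite mulr_gt0.
have hkv : 40 * K <= p * vm%:R.
  by apply: le_trans hk _; apply: ler_wpM2l; [exact: ltW | rewrite ler_nat].
have vm0 : (0 < vm)%N by apply: leq_trans kvm.
case=> hV.
- set S' := cols_where (fun c => vm < c)%N S in hV.
  apply: le_trans (@red_pairs_mono R A h _ _ (cols_where_sub (fun c => vm < c)%N S)).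
  rewrite -/S'.
  have sq : (10 / 21 * #|S|%:R) ^+ 2 <= #|S'|%:R ^+ 2 :> R.
    by rewrite ler_pXn2r ?nnegrE //; move: V0; lra.
  pose U := [set y | (vm < #|col S y|)%N].
  have colS' y : col S' y != set0 -> (vm < #|col S' y|)%N /\ y \in U.
    by rewrite /S' col_cols_where inE; case: ifP; rewrite ?eqxx.
  have psq := ler_wpM2l (ltW p0) sq.
  have [hU|hU] := leP #|U|%:R u0.
    apply: (@le_trans _ _ (9 / 10 * p / 4 * #|S'|%:R ^+ 2)).
      by move: psq; rewrite exprMn; move: (#|S|%:R ^+ 2) (#|S'|%:R ^+ 2) pV => V2 W2; lra.
    apply: (red_pairs_tall (k0 := vm%:R) (ltW p0) (ltW K0) (base_upper bg) (base_deg bg)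
      (base_lower bg) _ _ _ _ (U := U) _ hU pu KT T0 hz (base_cherry bg hU)
      (base_fan bg) _ h1 h2).
    - by rewrite ltr0n.
    - by move=> y /colS'[hy _]; rewrite ler_nat ltnW.
    - by have := p0; lra.
    - by apply: threshold_le; rewrite ?ltr0n.
    - by move=> y /colS'[].
    by move: hV hS; rewrite -/m; move: (#|S|%:R) (D%:R) (#|S'|%:R) => V d W; lra.
  apply: (@le_trans _ _ (88 / 100 * p * #|S'|%:R ^+ 2)).
    by move: psq; rewrite exprMn; move: (#|S|%:R ^+ 2) (#|S'|%:R ^+ 2) pV => V2 W2; lra.
  apply: (red_pairs_columns (vm := #|A|) vm0 hkv pD) => [y /colS'[/ltnW]//|y|].
    exact: max_card.
  rewrite -/m; apply: le_trans hu _.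
  apply: (@le_trans _ _ (#|U|%:R * vm%:R)); first by rewrite ler_wpM2r // ltW.
  rewrite -[X in _ <= X]sum_card_col mulr_natl -sumr_const big_mkcond /=.
  apply: ler_sum => y _; case: ifP => // yU; rewrite /S' col_cols_where.
  by move: (yU); rewrite inE => hy; rewrite hy ler_nat ltnW.
set S' := cols_where (fun c => (k < c) && (c <= vm))%N S in hV.
apply: le_trans (@red_pairs_mono R A h _ _ (cols_where_sub (fun c => (k < c) && (c <= vm))%N S)).
rewrite -/S'.
have sq : (#|S|%:R / 63) ^+ 2 <= #|S'|%:R ^+ 2 :> R.
  by rewrite ler_pXn2r ?nnegrE // divr_ge0.
have psq := ler_wpM2l (ltW p0) sq.
apply: (@le_trans _ _ (88 / 100 * p * #|S'|%:R ^+ 2)).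
  by move: psq; rewrite exprMn; move: (#|S|%:R ^+ 2) (#|S'|%:R ^+ 2) pV => V2 W2; lra.
apply: (red_pairs_columns (vm := vm) k0 hk pD) => [y|y|].
- by rewrite /S' col_cols_where; case: ifP; rewrite ?eqxx // => /andP[/ltnW].
- by rewrite /S' col_cols_where; case: ifP; rewrite ?cards0 // => /andP[].
have D0 : 0 <= D%:R :> R by [].
have := ler_wpM2l D0 hvm; rewrite -/m; move: hV hS.
move: (#|S|%:R) (D%:R) (#|S'|%:R) (vm%:R) => V d W v; lra.
Qed.

(** The four error terms take at most [1/20 + 3/10] of [p |S|^2] away from [19/20]. *)
Lemma red_pairs_thin (S : {set A * A}) (k : nat) (a : R) :
  0 < a -> D%:R * m / 10 <= #|S|%:R -> (0 < D)%N -> 0 < m ->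
  (forall y, (#|col S y| <= k)%N) -> (forall x, (#|row S x| <= k)%N) ->
  400 * K * k%:R <= p * D%:R * m ->
  (2 * a * D%:R + 2 * K / a) * (2 * p * k%:R + 2 * K) * 100 <= p * m ->
  80 * p * D%:R <= a -> 800 * K * k%:R <= a * m ->
  1 / 2 * p * #|S|%:R ^+ 2 <= red_pairs R h S.
Proof.
move=> a0 hS D0 m0 hc hr h1 h2 h3 h4.
apply: le_trans (red_pairs_small (ltW p0) (ltW K0) (base_sym bg) (base_upper bg)
  (base_deg bg) (base_lower bg) a0 hc hr).
have V0 : 0 <= #|S|%:R :> R by [].
have D0R : 0 < D%:R :> R by rewrite ltr0n.
move: (#|S|%:R : R) (k%:R : R) (D%:R : R) V0 D0R hS h1 h2 h3 h4 => V kk d V0 d0 hS h1 h2 h3 h4.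
have pV : p * (d * m / 10) <= p * V by apply: ler_wpM2l => //; apply: ltW.
have t1 : 2 * K * kk * V <= p * V * V / 20.
  have : 40 * K * kk <= p * V by move: pV h1; lra.
  by move/(ler_wpM2r V0); lra.
have t2 : (2 * a * d + 2 * K / a) * (2 * p * kk + 2 * K) * d * V <= p * V * V / 10.
  have := ler_wpM2r (ltW d0) h2; move: ((2 * a * d + 2 * K / a) * (2 * p * kk + 2 * K)) => q hq.
  have : 10 * (q * d) <= p * V by move: pV hq; lra.
  by move/(ler_wpM2r V0); lra.
have ai0 : 0 <= a^-1 by rewrite invr_ge0 ltW.
have aK : a * a^-1 = 1 by rewrite divff // gt_eqF.
have t3 : 4 * p / a * (2 * p * d * V ^+ 2) <= p * V * V / 10.
  have hv : 0 <= p * V * V by rewrite !mulr_ge0 // ltW.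
  have := ler_wpM2r (mulr_ge0 ai0 hv) h3.
  rewrite [a * (_ * _)]mulrA aK mul1r expr2; lra.
have t4 : 4 * p / a * (2 * K * d * kk * V) <= p * V * V / 10.
  have hv : 0 <= p * V * d by rewrite !mulr_ge0 // ltW.
  have := ler_wpM2r (mulr_ge0 ai0 hv) h4.
  rewrite [a * m * _](_ : _ = a * a^-1 * (m * (p * V * d))); last by ring.
  rewrite aK mul1r.
  have := ler_wpM2r V0 pV; lra.
have : 0 <= p * V * V by rewrite !mulr_ge0 // ltW.
rewrite mulrDr !expr2 in t3 *; lra.
Qed.

(** Tall columns and tall rows get the threshold share [10/21] each, middle ones [1/63] each, which
    leaves [1/63] for the thin part. Applied to [63/10 D m], the shares are [3 D m] and [D m / 10],
    as [red_pairs_tall] and [red_pairs_thin] demand. *)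
Lemma edge_pairs_medium (S : {set A * A}) (k vm : nat) (T a : R) :
  (0 < k)%N -> (k <= vm)%N -> 40 * K <= p * k%:R -> 200 * p * D%:R <= 1 ->
  2 * p * u0 <= K -> 4 * K <= T -> 2 * K * u0 <= z0 * T ->
  1 + 6 * z0 <= D%:R / 8 -> 16 * K ^+ 2 * N2 + 2 * K * T * u0 <= D%:R ^+ 2 / 4 ->
  200 * K * D%:R * m <= u0 * vm%:R -> 2000 * K * vm%:R <= m ->
  0 < a -> (0 < D)%N -> 0 < m ->
  400 * K * k%:R <= p * D%:R * m ->
  (2 * a * D%:R + 2 * K / a) * (2 * p * k%:R + 2 * K) * 100 <= p * m ->
  80 * p * D%:R <= a -> 800 * K * k%:R <= a * m ->
  63 / 10 * D%:R * m <= #|S|%:R ->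
  1 / 10000 * p * #|S|%:R ^+ 2 <= edge_pairs R h S.
Proof.
move=> k0 kvm hk pD pu KT hz h1 h2 hu hvm a0 D0 m0 e1 e2 e3 e4 hS.
have V0 : 0 <= #|S|%:R :> R by [].
set tall := (fun c => vm < c)%N; set mid := (fun c => (k < c) && (c <= vm))%N.
have main (S' : {set A * A}) : #|S'| = #|S| ->
    (10 / 21 * #|S'|%:R <= #|cols_where tall S'|%:R :> R) \/
    (#|S'|%:R / 63 <= #|cols_where mid S'|%:R :> R) ->
    1 / 10000 * p * #|S|%:R ^+ 2 <= red_pairs R h S'.
  move=> cS hh; rewrite -cS.
  by apply: (red_pairs_tall_or_mid k0 kvm hk pD pu KT hz h1 h2 hu hvm _ hh); rewrite cS.
have [c1|c1] := leP (10 / 21 * #|S|%:R) (#|cols_where tall S|%:R : R).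
  by apply: le_trans (red_le_edge_pairs _ _ _); apply: main => //; left.
have [c2|c2] := leP (#|S|%:R / 63) (#|cols_where mid S|%:R : R).
  by apply: le_trans (red_le_edge_pairs _ _ _); apply: main => //; right.
have [c3|c3] := leP (10 / 21 * #|S|%:R) (#|cols_where tall (transpose S)|%:R : R).
  apply: le_trans (blue_le_edge_pairs _ _ _); apply: main; first exact: card_transpose.
  by rewrite card_transpose; left.
have [c4|c4] := leP (#|S|%:R / 63) (#|cols_where mid (transpose S)|%:R : R).
  apply: le_trans (blue_le_edge_pairs _ _ _); apply: main; first exact: card_transpose.
  by rewrite card_transpose; right.
pose S' := [set u in S | (#|col S u.2| <= k)%N && (#|row S u.1| <= k)%N].
have sS : S' \subset S by apply/subsetP => u; rewrite inE => /andP[].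
have cover5 : (#|S| <= #|cols_where tall S| + #|cols_where mid S| +
    #|cols_where tall (transpose S)| + #|cols_where mid (transpose S)| + #|S'|)%N.
  rewrite -(card_transpose (cols_where tall (transpose S))).
  rewrite -(card_transpose (cols_where mid (transpose S))).
  apply: leq_trans (subset_leq_card (_ : S \subset cols_where tall S :|: cols_where mid S :|:
    transpose (cols_where tall (transpose S)) :|:
    transpose (cols_where mid (transpose S)) :|: S')) _.
    apply/subsetP => -[x y] uS; rewrite !inE /= uS /= !col_transpose /tall /mid.
    by case: (leqP _ vm); case: (leqP _ vm); case: (leqP _ k); case: (leqP _ k).
  by do ![apply: leq_trans (leq_card_setU _ _) _; rewrite leq_add2r].
have V'ge : #|S|%:R / 63 <= #|S'|%:R :> R.
  have : #|S|%:R <= #|cols_where tall S|%:R + #|cols_where mid S|%:R +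
    #|cols_where tall (transpose S)|%:R + #|cols_where mid (transpose S)|%:R + #|S'|%:R :> R.
    by rewrite -!natrD ler_nat.
  move: c1 c2 c3 c4; lra.
apply: le_trans (red_le_edge_pairs _ _ _); apply: le_trans (@red_pairs_mono R A h _ _ sS).
apply: (@le_trans _ _ (1 / 2 * p * #|S'|%:R ^+ 2)).
  have sq : (#|S|%:R / 63) ^+ 2 <= #|S'|%:R ^+ 2 :> R.
    by rewrite ler_pXn2r ?nnegrE // divr_ge0.
  have := ler_wpM2l (ltW p0) sq.
  have : 0 <= p * #|S|%:R ^+ 2 by rewrite mulr_ge0 ?exprn_ge0 // ltW.
  by rewrite exprMn; move: (#|S|%:R ^+ 2) (#|S'|%:R ^+ 2) => V2 W2; lra.
apply: (red_pairs_thin a0 _ D0 m0) e1 e2 e3 e4.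
- by move: V'ge hS; move: (#|S|%:R) (#|S'|%:R) (D%:R) => V W d; lra.
- move=> y; have [->|/set0Pn[x]] := eqVneq (col S' y) set0; first by rewrite cards0.
  rewrite !inE /= => /and3P[_ hk' _]; apply: leq_trans hk'.
  by apply/subset_leq_card/subsetP => x'; rewrite !inE => /andP[].
move=> x; have [->|/set0Pn[y]] := eqVneq (row S' x) set0; first by rewrite cards0.
rewrite !inE /= => /and3P[_ _ hk']; apply: leq_trans hk'.
by apply/subset_leq_card/subsetP => x'; rewrite !inE => /andP[].
Qed.

End Phases.

(** * Choice of the constants *)

Lemma pow_le (R : realFieldType) (l : R) i j : 10000 <= l -> (i <= j)%N -> l ^+ i <= l ^+ j.
Proof. by move=> L ij; apply: ler_weXn2l => //; lra. Qed.

Lemma pow_step (R : realFieldType) (l : R) i : 10000 <= l -> 10000 * l ^+ i <= l ^+ i.+1.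
Proof. by move=> L; rewrite exprS ler_pM2r // exprn_gt0 //; lra. Qed.

(* [l], [x], [p] stand for [ln n], [sqrt n] and the edge density; [m], [D], [k], [v] for
   the number of base vertices, their maximal degree, and the sizes below and above which
   a column counts as small and as tall. *)
Record constants (R : realFieldType) (l x p m D k v : R) : Prop := Constants {
  const_l : 10000 <= l;
  const_x : l ^+ 100 <= x;
  const_m_up : m * l ^+ 40 <= x ^+ 2;
  const_m_lo : x ^+ 2 <= 2 * m * l ^+ 40;
  const_px : 10 * p * x = l;
  const_p0 : 0 < p;
  const_m0 : 0 < m;
  const_D_up : D <= 11 / 10 * (p * m);
  const_D_lo : 11 / 10 * (p * m) - 1 <= D;
  const_k_up : k <= l ^+ 2 * x;
  const_k_lo : l ^+ 2 * x - 1 <= k;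
  const_v_up : v * l ^+ 3 <= m;
  const_v_lo : m <= (v + 1) * l ^+ 3 }.

Section Constants.
Variables (R : realFieldType) (l x p m D k v : R).
Hypothesis C : constants l x p m D k v.

Let L : 10000 <= l. Proof. exact: const_l C. Qed.
Let X : l ^+ 100 <= x. Proof. exact: const_x C. Qed.
Let m_up : m * l ^+ 40 <= x ^+ 2. Proof. exact: const_m_up C. Qed.
Let m_lo : x ^+ 2 <= 2 * m * l ^+ 40. Proof. exact: const_m_lo C. Qed.
Let px : 10 * p * x = l. Proof. exact: const_px C. Qed.
Let p0 : 0 < p. Proof. exact: const_p0 C. Qed.
Let m0 : 0 < m. Proof. exact: const_m0 C. Qed.
Let D_up : D <= 11 / 10 * (p * m). Proof. exact: const_D_up C. Qed.
Let D_lo : 11 / 10 * (p * m) - 1 <= D. Proof. exact: const_D_lo C. Qed.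
Let k_up : k <= l ^+ 2 * x. Proof. exact: const_k_up C. Qed.
Let k_lo : l ^+ 2 * x - 1 <= k. Proof. exact: const_k_lo C. Qed.
Let v_up : v * l ^+ 3 <= m. Proof. exact: const_v_up C. Qed.
Let v_lo : m <= (v + 1) * l ^+ 3. Proof. exact: const_v_lo C. Qed.

Let l0 : 0 < l. Proof. by have := L; lra. Qed.
Let l1 : 1 <= l. Proof. by have := L; lra. Qed.
Let lp j : 0 < l ^+ j. Proof. exact: exprn_gt0. Qed.

Let x0 : 0 < x. Proof. exact: lt_le_trans (lp 100) X. Qed.
Let P0 : 0 < p * m. Proof. exact: mulr_gt0. Qed.

(** The bounds on [m] are multiplied by [p], and [10 p x = l]: the typical degree [p m] has order
    [x / l^39]. *)
Lemma P_up : 10 * (p * m) * l ^+ 39 <= x.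
Proof.
rewrite -(ler_pM2r l0); have := ler_wpM2l (ltW p0) m_up.
have := congr1 (fun y => y * x) px; rewrite /=; lra.
Qed.

Lemma P_lo : x <= 20 * (p * m) * l ^+ 39.
Proof.
rewrite -(ler_pM2r l0); have := ler_wpM2l (ltW p0) m_lo.
have := congr1 (fun y => y * x) px; rewrite /=; lra.
Qed.

Lemma P_ge : l ^+ 60 <= p * m.
Proof.
rewrite -(ler_pM2r (lp 39)); have := pow_step 99 L; have := P_lo; have := X.
have := lp 99; rewrite -exprD; lra.
Qed.

(** The expected number [p^2 m] of common neighbours is below [l^(-38)]; conditions with [p D] or
    [p^2 m] draw on these spare powers. *)
Lemma pP_le : 100 * p * (p * m) * l ^+ 38 <= 1.
Proof.
rewrite -(ler_pM2r l0); have := ler_wpM2l (ltW p0) P_up; have := px; lra.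
Qed.

Lemma D_ge_P : 41 / 40 * p * m + 82 * l <= D.
Proof.
have := P_ge; have := pow_le L (isT : (2 <= 60)%N); have := pow_step 1 L; have := D_lo; have := L.
rewrite expr1; lra.
Qed.

Lemma D_ge : l ^+ 60 <= D.
Proof. have := D_ge_P; have := P_ge; have := P0; have := l0; lra. Qed.

Let D0 : 0 < D. Proof. exact: lt_le_trans (lp 60) D_ge. Qed.

Lemma pD_le : 50 * p * D * l ^+ 38 <= 1.
Proof.
have p38 : 0 <= p * l ^+ 38 by rewrite ltW // mulr_gt0.
have := ler_wpM2l p38 D_up; have := pP_le; lra.
Qed.

Lemma pD_small (c : R) i : (i < 38)%N -> 0 <= c -> c <= 50 * 10000 -> c * l ^+ i * p * D <= 1.
Proof.
move=> hi c0 c1.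
have pD0 : 0 <= p * D by rewrite ltW // mulr_gt0.
have h1 : l ^+ i <= l ^+ 37 by apply: pow_le L _.
have := pow_step 37 L; have := pD_le => h2 h3.
have h4 : c * l ^+ i <= 50 * l ^+ 38.
  have := ler_pM c0 (ltW (lp i)) c1 h1; lra.
have := ler_wpM2r pD0 h4; lra.
Qed.

Lemma const_m_small : 2 * m <= x ^+ 2.
Proof.
have h := pow_le L (isT : (1 <= 40)%N); rewrite expr1 in h.
have h2 : 2 <= l ^+ 40 by have := L; lra.
have := ler_wpM2l (ltW m0) h2; have := m_up; lra.
Qed.

Lemma const_pm : 960 * p ^+ 2 * m <= 1.
Proof.
have h : 10 <= l ^+ 38 by have := pow_le L (isT : (1 <= 38)%N); rewrite expr1; have := L; lra.
have q0 : 0 <= 96 * p * (p * m) by rewrite ltW // !mulr_gt0.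
have := ler_wpM2l q0 h; have := pP_le; have : 0 <= p * (p * m) * l ^+ 38 by rewrite ltW // !mulr_gt0.
rewrite expr2; lra.
Qed.

Lemma const_k : 40 * (200 * l) <= p * k.
Proof.
have h1 : 1 <= x.
  by apply: le_trans X; have := pow_le L (isT : (0 <= 100)%N); rewrite expr0.
have h2 : (8 * 10000) * x <= k.
  have := pow_step 1 L; rewrite expr1 => h; have h3 : (8 * 10000 + 1) <= l ^+ 2 by have := L; lra.
  have := ler_wpM2r (ltW x0) h3; have := k_lo; lra.
have := ler_wpM2l (ltW p0) h2; have := px; lra.
Qed.

Lemma const_k0 : 0 < k.
Proof.
have h : 1 * 1 <= l * x.
  apply: ler_pM => //; apply: le_trans X.
  by have := pow_le L (isT : (0 <= 100)%N); rewrite expr0.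
have := pow_step 1 L; rewrite expr1 => h1; have := ler_wpM2r (ltW x0) h1.
have := k_lo; lra.
Qed.

Lemma const_pD : 200 * p * D <= 1.
Proof. by have := @pD_small 200 0 isT ltac:(lra) ltac:(lra); rewrite expr0; lra. Qed.

Lemma const_pu : 2 * p * (l ^+ 6 * D) <= 200 * l.
Proof. have := @pD_small 2 6 isT ltac:(lra) ltac:(lra); have := L; lra. Qed.

Lemma const_T : 4 * (200 * l) <= D / l ^+ 9.
Proof.
rewrite ler_pdivlMr //; have := D_ge; have := pow_le L (isT : (11 <= 60)%N); have := pow_step 10 L.
have := lp 10; lra.
Qed.

Lemma const_z : 2 * (200 * l) * (l ^+ 6 * D) <= l ^+ 17 * (D / l ^+ 9).
Proof.
have -> : l ^+ 17 * (D / l ^+ 9) = l ^+ 8 * D by field; rewrite gt_eqF.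
have := ler_wpM2r (ltW D0) (pow_step 7 L); have := mulr_gt0 (lp 7) D0; lra.
Qed.

Lemma const_z_D : 1 + 6 * l ^+ 17 <= D / 8.
Proof.
have := D_ge; have := pow_le L (isT : (18 <= 60)%N); have := pow_step 17 L.
have := pow_le L (isT : (0 <= 17)%N); rewrite expr0; lra.
Qed.

(** The summands are at most [1/64], [1/32], [1/16] and [1/16] of [D^2]. The one with [p^2 m] needs
    [l^14] to be beaten by [pP_le]. *)
Lemma const_cherry :
  16 * (200 * l) ^+ 2 *
    (l ^+ 6 * D + 2 * (l + l * (l ^+ 6 * D) + p ^+ 2 * m * (l ^+ 6 * D) ^+ 2)) +
  2 * (200 * l) * (D / l ^+ 9) * (l ^+ 6 * D) <= D ^+ 2 / 4.
Proof.
have D1 : 1 <= D.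
  by apply: le_trans D_ge; have := pow_le L (isT : (0 <= 60)%N); rewrite expr0.
have -> : 2 * (200 * l) * (D / l ^+ 9) * (l ^+ 6 * D) = 400 * D ^+ 2 / l ^+ 2.
  by field; rewrite gt_eqF.
have t1 : 400 * D ^+ 2 / l ^+ 2 <= D ^+ 2 / 16.
  rewrite ler_pdivrMr //; have h : 6400 <= l ^+ 2 by have := pow_step 1 L; rewrite expr1; have := L; lra.
  have := ler_wpM2l (sqr_ge0 D) h; lra.
have t2 : 16 * (200 * l) ^+ 2 * (l ^+ 6 * D) <= D ^+ 2 / 64.
  have h : 64 * 16 * (4 * 10000) * l ^+ 8 <= D.
    by have := D_ge; have := pow_le L (isT : (10 <= 60)%N); have := pow_step 9 L; have := pow_step 8 L; lra.
  have := ler_wpM2r (ltW D0) h; lra.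
have t3 : 16 * (200 * l) ^+ 2 * (2 * (l + l * (l ^+ 6 * D))) <= D ^+ 2 / 32.
  have h : 128 * 16 * (4 * 10000) * l ^+ 9 <= D.
    have := D_ge; have := pow_le L (isT : (12 <= 60)%N); have := pow_step 11 L; have := pow_step 10 L.
    by have := pow_step 9 L; have := lp 9; lra.
  have h' : l ^+ 3 <= l ^+ 9 * D.
    by apply: le_trans (pow_le L (isT : (3 <= 9)%N)) _; rewrite ler_peMr // ltW.
  have := ler_wpM2r (ltW D0) h; lra.
have t4 : 16 * (200 * l) ^+ 2 * (2 * (p ^+ 2 * m * (l ^+ 6 * D) ^+ 2)) <= D ^+ 2 / 16.
  have h : 16 * 32 * (4 * 10000) * l ^+ 14 <= 100 * l ^+ 38.
    have := pow_le L (isT : (16 <= 38)%N); have := pow_step 15 L; have := pow_step 14 L.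
    by have := lp 14; lra.
  have q0 : 0 <= p * (p * m) * D ^+ 2 by rewrite ltW // !mulr_gt0 // exprn_gt0.
  have := ler_wpM2r q0 h; have := ler_wpM2r (sqr_ge0 D) pP_le; lra.
have := sqr_ge0 D; move: t1 t2 t3 t4; lra.
Qed.

Let m_big : l ^+ 55 * x <= m.
Proof.
rewrite -(ler_pM2r (lp 40)) -(ler_pM2r x0).
have h : 2 * l ^+ 95 <= x.
  by apply: le_trans X; have := pow_le L (isT : (96 <= 100)%N); have := pow_step 95 L; have := lp 95; lra.
have xx : 0 <= x * x by rewrite mulr_ge0 // ltW.
have := ler_wpM2r xx h; have := ler_wpM2r (ltW x0) m_lo; rewrite expr2; lra.
Qed.

Let v_half : m <= 2 * v * l ^+ 3.
Proof.
have h : 2 * l ^+ 3 <= m.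
  apply: le_trans m_big; apply: (@le_trans _ _ (l ^+ 55 * 1)).
    by have := pow_le L (isT : (4 <= 55)%N); have := pow_step 3 L; have := lp 3; lra.
  rewrite ler_pM2l //; apply: le_trans X.
  by have := pow_le L (isT : (0 <= 100)%N); rewrite expr0.
have := v_lo; lra.
Qed.

Let v0 : 0 < v.
Proof.
have : 0 < v * l ^+ 3 by have := v_half; have := m0; lra.
by rewrite pmulr_lgt0.
Qed.

Lemma const_kv : k <= v.
Proof.
rewrite -(ler_pM2r (lp 3)).
have h : 2 * l ^+ 5 * x <= m.
  apply: le_trans m_big; apply: ler_wpM2r; first exact: ltW.
  by have := pow_le L (isT : (6 <= 55)%N); have := pow_step 5 L; have := lp 5; lra.
have := ler_wpM2r (ltW (lp 3)) k_up; have := v_half; lra.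
Qed.

Lemma const_u : 200 * (200 * l) * D * m <= l ^+ 6 * D * v.
Proof.
have h : (8 * 10000) * l ^+ 4 <= l ^+ 6 by have := pow_step 5 L; have := pow_step 4 L; have := lp 4; lra.
have Dv : 0 <= D * v by rewrite ltW // mulr_gt0.
have lD : 0 <= l * D by rewrite ltW // mulr_gt0.
have := ler_wpM2r Dv h; have := ler_wpM2r lD v_half; lra.
Qed.

Lemma const_v : 2000 * (200 * l) * v <= m.
Proof.
have h : 2000 * 200 * l <= l ^+ 3.
  by have := pow_step 2 L; have := pow_step 1 L; rewrite expr1; have := l0; lra.
have := ler_wpM2r (ltW v0) h; have := v_up; lra.
Qed.

Lemma const_kD : 400 * (200 * l) * k <= p * D * m.
Proof.
have h : 400 * 200 * 20 * l ^+ 42 <= D.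
  have := D_ge; have := pow_le L (isT : (44 <= 60)%N); have := pow_step 43 L; have := pow_step 42 L.
  by have := lp 42; lra.
have := ler_wpM2r (ltW P0) h; have := ler_wpM2r (ltW (lp 3)) P_lo.
have := ler_wpM2r (ltW l0) k_up; lra.
Qed.

Lemma const_thin : (2 * l ^- 4 * D + 2 * (200 * l) / l ^- 4) * (2 * p * k + 2 * (200 * l)) * 100
  <= p * m.
Proof.
(* As this factor is at most [l^3], the choice [a = l^(-4)] saves one power of [l] against [D]. *)
have l3 : 2 * p * k + 2 * (200 * l) <= l ^+ 3.
  have := ler_wpM2l (ltW p0) k_up; have := congr1 (fun y => y * l ^+ 2) px.
  have := pow_step 2 L; have := pow_step 1 L; rewrite expr1 /=; have := lp 3; lra.
have e1 : 2 * (200 * l) / l ^- 4 = 400 * l ^+ 5 by field; rewrite gt_eqF.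
have y0 : 0 <= 2 * l ^- 4 * D + 2 * (200 * l) / l ^- 4.
  by rewrite e1 addr_ge0 ?mulr_ge0 ?invr_ge0 // ltW.
have := ler_wpM2l y0 l3; move=> h; apply: (@le_trans _ _ ((2 * l ^- 4 * D +
  2 * (200 * l) / l ^- 4) * l ^+ 3 * 100)); first by rewrite ler_pM2r.
rewrite e1.
have -> : (2 * l ^- 4 * D + 400 * l ^+ 5) * l ^+ 3 * 100 = 200 * D / l + (4 * 10000) * l ^+ 8.
  by field; rewrite gt_eqF.
have t1 : 200 * D / l <= p * m / 2.
  by rewrite ler_pdivrMr //; have := ler_wpM2l (ltW P0) L; have := D_up; have := P0; lra.
have t2 : (4 * 10000) * l ^+ 8 <= p * m / 2.
  have := P_ge; have := pow_le L (isT : (10 <= 60)%N); have := pow_step 9 L; have := pow_step 8 L.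
  by have := lp 8; lra.
lra.
Qed.

Lemma const_a : 80 * p * D <= l ^- 4.
Proof.
rewrite -(ler_pM2r (lp 4)) mulVf ?gt_eqF //.
by have := @pD_small 80 4 isT ltac:(lra) ltac:(lra); lra.
Qed.

Lemma const_ka : 800 * (200 * l) * k <= l ^- 4 * m.
Proof.
rewrite [_ * m]mulrC ler_pdivlMr //.
have h : 800 * 200 * l ^+ 7 * x <= l ^+ 55 * x.
  rewrite ler_pM2r //; have := pow_le L (isT : (9 <= 55)%N); have := pow_step 8 L; have := pow_step 7 L.
  by have := lp 7; lra.
have := m_big; have := ler_wpM2r (ltW (lp 5)) k_up; lra.
Qed.

Lemma const_large_k : 100 * k * m <= m * x * l ^+ 3.
Proof.
have mx : 0 <= m * x by rewrite ltW // mulr_gt0.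
have := ler_wpM2r mx (pow_step 2 L); have := ler_wpM2r (ltW m0) k_up.
have : 0 <= l ^+ 2 * (m * x) by rewrite mulr_ge0 // ltW.
lra.
Qed.

Lemma const_large_D : 300 * (200 * l) * D * m <= m * x * l ^+ 3.
Proof.
have h : 300 * 200 * D <= x.
  have := P_up; have := D_up; have h1 : 10000 <= l ^+ 39.
    by apply: le_trans L _; have := pow_le L (isT : (1 <= 39)%N); rewrite expr1.
  have := ler_wpM2l (ltW P0) h1; have := P0; lra.
have lm : 0 <= l * m by rewrite ltW // mulr_gt0.
have := ler_wpM2r lm h.
have h2 : l <= l ^+ 3 by have := pow_le L (isT : (1 <= 3)%N); rewrite expr1.
have mx : 0 <= m * x by rewrite ltW // mulr_gt0.
have := ler_wpM2l mx h2; lra.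
Qed.

Lemma const_large_DD : 100 * D ^+ 2 <= p * (m * x * l ^+ 3).
Proof.
have h : 200 * D <= x * l ^+ 3.
  have := P_up; have := D_up; have h1 : 10000 <= l ^+ 39.
    by apply: le_trans L _; have := pow_le L (isT : (1 <= 39)%N); rewrite expr1.
  have := ler_wpM2l (ltW P0) h1; have := P0.
  have h2 : 1 <= l ^+ 3 by have := pow_le L (isT : (0 <= 3)%N); rewrite expr0.
  have := ler_wpM2l (ltW x0) h2; lra.
have := ler_wpM2r (ltW P0) h; have := ler_wpM2l (ltW D0) D_up; rewrite expr2; have := P0.
have := mulr_gt0 D0 P0; lra.
Qed.

Lemma const_M_ge : 8 <= 63 / 10 * D * m.
Proof.
have D8 : 8 <= D.
  by apply: le_trans D_ge; apply: le_trans (_ : l <= _);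
    [have := L; lra | have := pow_le L (isT : (1 <= 60)%N); rewrite expr1].
have m1 : 1 <= m.
  apply: le_trans m_big; apply: (@le_trans _ _ (1 * 1)); first by rewrite mulr1.
  apply: ler_pM => //; first by have := pow_le L (isT : (0 <= 55)%N); rewrite expr0.
  by apply: le_trans X; have := pow_le L (isT : (0 <= 100)%N); rewrite expr0.
have := ler_wpM2l (ltW D0) m1; have := mulr_gt0 D0 m0; lra.
Qed.

Lemma const_MM1 : 63 / 10 * D * m <= m * x * l ^+ 3.
Proof.
have := const_large_D; have := ler_wpM2r (ltW (mulr_gt0 D0 m0)) L; have := mulr_gt0 D0 m0; lra.
Qed.

Lemma const_M1 : m * x * l ^+ 3 < m ^+ 2.
Proof.
rewrite expr2 -mulrA ltr_pM2l //; apply: lt_le_trans m_big; rewrite mulrC ltr_pM2r //.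
by have := pow_le L (isT : (4 <= 55)%N); have := pow_step 3 L; have := lp 3; lra.
Qed.

(** Here [693/1000] is [63/10 * 11/10 * 1/10], from [D <= 11/10 p m] and [p = l / (10 x)]. *)
Lemma const_qM : x ^+ 2 / m ^+ 2 * (63 / 10 * D * m) <= 693 / 1000 * l * x.
Proof.
have -> : x ^+ 2 / m ^+ 2 * (63 / 10 * D * m) = 63 / 10 * x ^+ 2 * D / m.
  by field; rewrite gt_eqF.
rewrite ler_pdivrMr //; have xx : 0 <= 63 / 10 * x ^+ 2 by rewrite mulr_ge0 ?sqr_ge0 //; lra.
have := ler_wpM2l xx D_up; have := congr1 (fun y => y * x * m) px; rewrite /= expr2; lra.
Qed.

Lemma const_ln2M : 64 <= 1 / 10000 * p * (x ^+ 2 / m ^+ 2) * (63 / 10 * D * m).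
Proof.
have -> : 1 / 10000 * p * (x ^+ 2 / m ^+ 2) * (63 / 10 * D * m) =
    63 / (10 * 10000) * (p * x ^+ 2) * D / m by field; rewrite gt_eqF.
rewrite ler_pdivlMr //.
have c0 : 0 <= p * x ^+ 2 by rewrite mulr_ge0 ?sqr_ge0 // ltW.
have c1 : 0 <= 63 / (10 * 10000) * (p * x ^+ 2) by lra.
have h : p * m <= D by have := D_ge_P; have := P0; have := l0; lra.
have := ler_wpM2l c1 h.
have -> : 63 / (10 * 10000) * (p * x ^+ 2) * (p * m) = 63 / (1000 * 10000) * (10 * p * x) ^+ 2 * m by field.
rewrite px; have l2 : 10000 * 10000 <= l ^+ 2 by have := pow_step 1 L; rewrite expr1; have := L; lra.
have := ler_wpM2r (ltW m0) l2; have := m0; lra.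
Qed.

(** Only a power of [l] is left: 40 from [m], 3 from the upper size and 1 from [p x]. The logarithm
    in the weak phase is therefore at most [44 ln l]. *)
Lemma const_ln2M1 : 1 / 10000 * p * (x ^+ 2 / m ^+ 2) * (m * x * l ^+ 3) <= l ^+ 44.
Proof.
have -> : 1 / 10000 * p * (x ^+ 2 / m ^+ 2) * (m * x * l ^+ 3) =
    10 * p * x * x ^+ 2 * l ^+ 3 / (10 * 10000) / m by field; rewrite gt_eqF.
rewrite px ler_pdivrMr // ler_pdivrMr ?mulr_gt0 //.
have := ler_wpM2r (ltW (lp 4)) m_lo; have := mulr_gt0 m0 (lp 44); lra.
Qed.

Lemma const_ln1M1 : 64 <= 3 / 2 * p * (x ^+ 2 / m ^+ 2) * (m * x * l ^+ 3).
Proof.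
have -> : 3 / 2 * p * (x ^+ 2 / m ^+ 2) * (m * x * l ^+ 3) =
    3 / 20 * (10 * p * x) * x ^+ 2 * l ^+ 3 / m by field; rewrite gt_eqF.
rewrite px ler_pdivlMr //.
have := ler_wpM2r (ltW (lp 4)) m_up.
have h : 64 * 20 <= l ^+ 44 by have := pow_le L (isT : (1 <= 44)%N); rewrite expr1; have := L; lra.
have := ler_wpM2l (ltW m0) h; have := m0; lra.
Qed.

Lemma const_ln1m : 3 / 2 * p * (x ^+ 2 / m ^+ 2) * m ^+ 2 <= l * x.
Proof.
have -> : 3 / 2 * p * (x ^+ 2 / m ^+ 2) * m ^+ 2 = 3 / 20 * (10 * p * x) * x.
  by field; rewrite gt_eqF.
rewrite px; have := mulr_gt0 l0 x0; lra.
Qed.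

Lemma const_p_half : p <= 1 / 4.
Proof.
have := px; have : 10 * l <= x.
  by apply: le_trans X; have := pow_le L (isT : (2 <= 100)%N); have := pow_step 1 L; rewrite expr1; have := l0; lra.
move=> h e; have := ler_wpM2l (ltW p0) h; have := mulr_gt0 p0 l0; have := l0 => a1 a2 a3.
rewrite -(ler_pM2r l0); lra.
Qed.

Lemma const_x_le_m : x ^+ 2 <= m ^+ 2.
Proof.
have xm : x <= m.
  apply: le_trans m_big; rewrite ler_peMl ?(ltW x0) //.
  by have := pow_le L (isT : (0 <= 55)%N); rewrite expr0.
by rewrite ler_pXn2r ?nnegrE // ltW.
Qed.

End Constants.

From mathcomp Require Import all_classical all_reals all_analysis.

(** * Logarithmic form of the random estimates *)

Lemma ln1B_le (R : realType) (x : R) : x < 1 -> ln (1 - x) <= - x.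
Proof. by move=> x1; apply: le_ln1Dx; rewrite ltrN2. Qed.

Lemma ln_ge_1BV (R : realType) (x : R) : 0 < x -> 1 - x^-1 <= ln x.
Proof.
move=> x0; have xi : 0 < x^-1 by rewrite invr_gt0.
have := @ln1B_le R (1 - x^-1); rewrite subKr gtrBl xi lnV ?posrE // => /(_ isT).
lra.
Qed.

Lemma ln1D_ge (R : realType) (s : R) : 0 < s -> s / (1 + s) <= ln (1 + s).
Proof.
move=> s0; have s1 : 0 < 1 + s by rewrite addr_gt0.
apply: le_trans (ln_ge_1BV s1); rewrite le_eqVlt; apply/orP; left; apply/eqP.
by field; rewrite gt_eqF.
Qed.

(** From [2 = 4/3 * 3/2] and [ln (1 + s) >= s / (1 + s)]. This precision suffices, as [1 + 7/12]
    exceeds [1.57]. *)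
Lemma ln2_ge (R : realType) : 7 / 12 <= ln 2 :> R.
Proof.
have -> : 2 = (1 + 1 / 3) * (1 + 1 / 2) :> R by field.
rewrite lnM ?posrE; [|lra|lra].
have := @ln1D_ge R (1 / 3); have := @ln1D_ge R (1 / 2).
have -> : 1 / 2 / (1 + 1 / 2) = 1 / 3 :> R by field.
have -> : 1 / 3 / (1 + 1 / 3) = 1 / 4 :> R by field.
by move=> /(_ ltac:(lra)) h1 /(_ ltac:(lra)) h2; lra.
Qed.

(** The factor 100 of the union bound is absorbed by one additional [ln N]. *)
Lemma ln_union_bound (R : realType) (a b N : R) (k i F : nat) :
  0 < a -> 0 < b -> 0 < N -> 100 <= ln N ->
  a ^+ k < 100 * N ^+ i * b ^+ F ->
  k%:R * ln a <= (i%:R + 1) * ln N + F%:R * ln b.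
Proof.
move=> a0 b0 N0 lN h.
have h100 : ln 100 <= ln N.
  have := @le_ln1Dx R 99; have -> : 1 + 99 = 100 :> R by ring.
  by move=> /(_ ltac:(lra)); lra.
have : ln (a ^+ k) <= ln (100 * N ^+ i * b ^+ F).
  by rewrite ler_ln ?posrE ?exprn_gt0 ?mulr_gt0 ?exprn_gt0 // ltW.
rewrite lnM ?posrE ?exprn_gt0 ?mulr_gt0 ?exprn_gt0 //.
rewrite lnM ?posrE ?exprn_gt0 // !lnXn //.
rewrite -[ln a *+ _]mulr_natl -[ln N *+ _]mulr_natl -[ln b *+ _]mulr_natl; lra.
Qed.

Section LogBounds.
Variables (R : realType) (m n D : nat) (p u0 z0 : R).
Let l : R := ln n%:R.
Hypothesis p0 : 0 < p.
Hypothesis p1 : p <= 1.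
Hypothesis n0 : (0 < n)%N.
Hypothesis l100 : 100 <= l.

Let N0 : 0 < n%:R :> R. Proof. by rewrite ltr0n. Qed.

Lemma upper_count (k i F : nat) : 2 ^+ k < 100 * n%:R ^+ i * (1 + p) ^+ F ->
  k%:R <= 2 * p * F%:R + 2 * (i%:R + 1) * l.
Proof.
move=> h; have p1' : 0 < 1 + p by rewrite addr_gt0.
have := ln_union_bound (ltr0n R 2) p1' N0 l100 h; rewrite -/l.
have := ln2_ge R.
have lp : ln (1 + p) <= p by apply: le_ln1Dx; have := p0; lra.
have k0 : 0 <= k%:R :> R by [].
have F0 : 0 <= F%:R :> R by [].
move=> h2; have := ler_wpM2l k0 h2; have := ler_wpM2l F0 lp; lra.
Qed.

Lemma lower_count (k i F : nat) :
  (1 - 1 / 40) ^+ k < 100 * n%:R ^+ i * (1 - 1 / 40 * p) ^+ F ->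
  39 / 40 * p * F%:R - 39 * (i%:R + 1) * l <= k%:R.
Proof.
move=> h; have a0 : 0 < 1 - 1 / 40 :> R by lra.
have b0 : 0 < 1 - 1 / 40 * p by have := p1; lra.
have := ln_union_bound a0 b0 N0 l100 h; rewrite -/l.
have lp : ln (1 - 1 / 40 * p) <= - (1 / 40 * p) by apply: ln1B_le; have := p1; lra.
have la : - (1 / 39) <= ln (1 - 1 / 40) :> R.
  apply: le_trans (ln_ge_1BV a0).
  by have -> : 1 - (1 - 1 / 40)^-1 = - (1 / 39) :> R by field.
have k0 : 0 <= k%:R :> R by [].
have F0 : 0 <= F%:R :> R by [].
have := ler_wpM2l k0 la; have := ler_wpM2l F0 lp; lra.
Qed.

Lemma pack_count (k i F d : nat) : 2 ^+ k < 100 * n%:R ^+ i * (1 + p ^+ d) ^+ F ->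
  k%:R <= 2 * p ^+ d * F%:R + 2 * (i%:R + 1) * l.
Proof.
move=> h; have pd : 0 <= p ^+ d by rewrite exprn_ge0 // ltW.
have p1' : 0 < 1 + p ^+ d by rewrite ltr_wpDr.
have := ln_union_bound (ltr0n R 2) p1' N0 l100 h; rewrite -/l.
have := ln2_ge R.
have lp : ln (1 + p ^+ d) <= p ^+ d by apply: le_ln1Dx; lra.
have k0 : 0 <= k%:R :> R by [].
have F0 : 0 <= F%:R :> R by [].
move=> h2; have := ler_wpM2l k0 h2; have := ler_wpM2l F0 lp; lra.
Qed.

Lemma degree_count (k F : nat) :
  (1 + 1 / 40) ^+ k < 100 * n%:R * (1 + 1 / 40 * p) ^+ F ->
  k%:R <= 41 / 40 * p * F%:R + 82 * l.
Proof.
move=> h; have a0 : 0 < 1 + 1 / 40 :> R by lra.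
have b0 : 0 < 1 + 1 / 40 * p by have := p0; lra.
have := @ln_union_bound R (1 + 1 / 40) (1 + 1 / 40 * p) n%:R k 1 F a0 b0 N0 l100; rewrite expr1 -/l.
move=> /(_ h).
have lp : ln (1 + 1 / 40 * p) <= 1 / 40 * p by apply: le_ln1Dx; have := p0; lra.
have la : 1 / 41 <= ln (1 + 1 / 40) :> R.
  have := @ln1D_ge R (1 / 40); have -> : 1 / 40 / (1 + 1 / 40) = 1 / 41 :> R by field.
  by apply; lra.
have k0 : 0 <= k%:R :> R by [].
have F0 : 0 <= F%:R :> R by [].
have := ler_wpM2l k0 la; have := ler_wpM2l F0 lp; lra.
Qed.

(** The constant in [K = 200 l] covers the lower bound: two lower counts with error [39 (i + 1) l]
    and six times a packing error [2 (i + 1) l] give [90 (|X| + |Y| + 1) l], at most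
    [135 (|X| + |Y|) l] for nonempty sets; the diagonal costs at most [|X|] more. *)
Lemma base_graph_exists :
  2 * m%:R <= n%:R :> R -> 960 * p ^+ 2 * m%:R <= 1 ->
  41 / 40 * p * m%:R + 82 * l <= D%:R -> 4 <= z0 -> 0 <= u0 ->
  9 / 20 * l <= ln (1 + (p * z0)^-1) ->
  exists h : rel 'I_m, base_graph h p (200 * l) D u0
    (u0 + 2 * (l + l * u0 + p ^+ 2 * m%:R * u0 ^+ 2)) z0.
Proof.
move=> mn pm hD z4 u00 lz.
have pz0 : 0 < p * z0 by rewrite mulr_gt0 //; lra.
(* With [t p z0 = 1] the mean factor of the test between [Z] and [Y] contributes at most [|Y|],
   while every edge gains [ln (1 + t)], nearly [l / 2]. *)
set t := (p * z0)^-1 in lz; have t0 : 0 < t by rewrite invr_gt0.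
have [S [low upp deg [fan che tris]]] := @random_sample R m p (1 / 40) t n%:R (ltW p0) p1
  ltac:(lra) ltac:(lra) t0 N0 mn.
exists (base_adj S).
have subadj x y : (base_adj S x y <= sample_adj S x y)%N.
  rewrite /base_adj /sample_adj inE; case: (_ != _) => //=.
  by case: (_ \in finset.cover _); case: (_ \in S).
have ecE (X Y : {set 'I_m}) : ecount R (base_adj S) X Y =
    (\sum_(x in X) \sum_(y in Y) base_adj S x y)%N%:R.
  by rewrite /ecount natr_sum; apply: eq_bigr => x _; rewrite natr_sum.
have empty (X Y : {set 'I_m}) : (#|X| == 0)%N || (#|Y| == 0)%N -> ecount R (base_adj S) X Y = 0.
  rewrite !cards_eq0 /ecount => /orP[/eqP->|/eqP->]; first by rewrite big_set0.
  by rewrite big1 // => x _; rewrite big_set0.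
have l0 : 0 < l by have := l100; lra.
have l1 : 1 <= l by have := l100; lra.
have nonempty (X Y : {set 'I_m}) : ~~ ((#|X| == 0)%N || (#|Y| == 0)%N) ->
    (1 : R) <= #|X|%:R /\ (1 : R) <= #|Y|%:R.
  by rewrite negb_or -!lt0n !ler1n => /andP.
split.
- exact: sample_adj_sym.
- by move=> x; rewrite /base_adj /sample_adj eqxx.
- exact: base_adj_triangle_free.
- move=> X Y; have [e|ne] := boolP ((#|X| == 0)%N || (#|Y| == 0)%N).
    by rewrite empty // addr_ge0 ?mulr_ge0 ?addr_ge0 // ltW.
  have [X1 Y1] := nonempty _ _ ne; rewrite ecE.
  apply: (@le_trans _ _ (#|S :&: forward X Y| + #|S :&: forward Y X|)%:R).
    rewrite -sum_sample ler_nat; apply: leq_sum => x _; apply: leq_sum => y _.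
    exact: subadj.
  have := upp X Y; have := upp Y X; rewrite -!exprD => /upper_count h1 /upper_count h2.
  have := congr1 (fun i => i%:R : R) (card_forward X Y).
  have i0 : 0 <= p * #|X :&: Y|%:R by rewrite mulr_ge0 // ltW.
  rewrite !natrD natrM => /(congr1 (fun i => p * i)); move: h1 h2; rewrite !natrD.
  have lX := ler_wpM2r (ltW l0) X1; have lY := ler_wpM2r (ltW l0) Y1.
  move: (#|X|%:R) (#|Y|%:R) (#|forward X Y|%:R) (#|forward Y X|%:R) (#|X :&: Y|%:R) i0 lX lY
    => a b c d e i0 lX lY; lra.
- move=> X Y; have [e|ne] := boolP ((#|X| == 0)%N || (#|Y| == 0)%N).
    rewrite empty //.
    have -> : 19 / 20 * p * #|X|%:R * #|Y|%:R = 0 :> R.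
      by case/orP: e => /eqP->; rewrite ?mulr0 ?mul0r.
    by rewrite sub0r oppr_le0 ?mulr_ge0 ?addr_ge0 // ltW.
  have [X1 Y1] := nonempty _ _ ne; rewrite ecE.
  have rem := removed_edges S X Y.
  have rem' : (#|S :&: forward X Y| + #|S :&: forward Y X|)%:R <=
      (\sum_(x in X) \sum_(y in Y) base_adj S x y)%N%:R +
      6 * #|max_packing S :&: triangles X Y|%:R :> R.
    by rewrite -sum_sample -natrM -natrD ler_nat.
  have := low X Y; have := low Y X; rewrite -!exprD => /lower_count h1 /lower_count h2.
  have := le_lt_trans (packed_triangles R S X Y) (tris X Y); rewrite -exprD => /pack_count h3.
  have ct : #|triangles X Y|%:R <= #|X|%:R * #|Y|%:R * m%:R :> R.
    by rewrite -!natrM ler_nat card_triangles.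
  have p30 : 0 <= p ^+ 3 by rewrite exprn_ge0 // ltW.
  have h4 := ler_wpM2l p30 ct.
  have XY0 : 0 <= p * (#|X|%:R * #|Y|%:R) by rewrite !mulr_ge0 // ltW.
  (* Removing triangles costs [12 / 960 = 1/80] of the density, and [39/40 - 1/80] still exceeds
     [19/20]. *)
  have h5 : p ^+ 3 * (#|X|%:R * #|Y|%:R * m%:R) <= p * (#|X|%:R * #|Y|%:R) / 960.
    have := ler_wpM2r XY0 pm; rewrite !exprS expr0 mulr1.
    move: (#|X|%:R) (#|Y|%:R) (m%:R : R) => a b c; lra.
  have := congr1 (fun i => i%:R : R) (card_forward X Y).
  have i0 : p * #|X :&: Y|%:R <= #|X|%:R.
    apply: (@le_trans _ _ (1 * #|X :&: Y|%:R)); first by rewrite ler_wpM2r.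
    by rewrite mul1r ler_nat subset_leq_card // finset.subsetIl.
  have lX := ler_wpM2r (ltW l0) X1; have lY := ler_wpM2r (ltW l0) Y1.
  have X0 : 0 <= #|X|%:R :> R by [].
  have l1X : #|X|%:R <= #|X|%:R * l by rewrite ler_peMr.
  move: h1 h2 h3 h4 h5 rem'; rewrite !natrD natrM.
  move: (#|X|%:R) (#|Y|%:R) (#|forward X Y|%:R) (#|forward Y X|%:R) (#|X :&: Y|%:R) i0 lX lY X0 l1X
    XY0 => a b c d e i0 lX lY a0 l1X XY0.
  move: (p ^+ 3) (#|triangles X Y|%:R) (m%:R : R) (#|max_packing S :&: triangles X Y|%:R)
    => p3 tr mm k3 h1 h2 h3 h4 h5 h6 /(congr1 (fun i => p * i)); lra.
- move=> x.
  have h1 : (\sum_y base_adj S x y <= #|S :&: joins [set x] [set: 'I_m]|)%N.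
    apply: leq_trans (_ : \sum_(x' in [set x]) \sum_(y in [set: 'I_m]) sample_adj S x' y <= _)%N.
      rewrite big_set1; apply: (@leq_trans (\sum_y sample_adj S x y)%N).
        by apply: leq_sum => y _; apply: subadj.
      by rewrite [X in (_ <= X)%N](eq_bigl xpredT) // => y; rewrite inE.
    apply: sum_joins_le => x1 y; rewrite inE => /eqP-> _ x' y'; rewrite inE => /eqP-> _.
    by move=> /andP[ne _] /nedge_inj[[_ ->]//|[e1 e2]]; rewrite e2 eqxx in ne.
  have := degree_count (deg x) => h2.
  have h3 : #|joins [set x] [set: 'I_m]|%:R <= m%:R :> R.
    rewrite ler_nat; apply: leq_trans (card_joins _ _) _.
    by rewrite cards1 mul1n cardsT card_ord.
  have := ler_wpM2l (ltW p0) h3 => h4.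
  rewrite -(ler_nat R); apply: le_trans (_ : #|S :&: joins [set x] [set: 'I_m]|%:R <= _).
    by rewrite ler_nat.
  by move: h2 h4 hD; lra.
- move=> U hU; set Z := [set z | _].
  (* Vertices inside [U] are counted bluntly, whence the leading [u0] of the bound; only the others
     are centres of cherries. *)
  pose Z' := [set z | (z \notin U) && (2 <= \sum_(y in U) sample_adj S z y)%N].
  have c1 : (#|Z| <= #|U| + #|Z'|)%N.
    apply: leq_trans (leq_card_setU _ _); apply/subset_leq_card/fintype.subsetP => z; rewrite !inE.
    case: (z \in U) => //= h; apply: leq_trans h _; apply: leq_sum => y _; exact: subadj.
  have := le_lt_trans (cherry_count R S U) (che U) => /pack_count h2.
  have h3 : #|cherries U|%:R <= m%:R * #|U|%:R ^+ 2 :> R.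
    by rewrite -natrX -natrM ler_nat card_cherries.
  have p20 : 0 <= p ^+ 2 by rewrite exprn_ge0 // ltW.
  have h4 : #|U|%:R ^+ 2 <= u0 ^+ 2 by rewrite ler_pXn2r ?nnegrE.
  have h5 := ler_wpM2l p20 (le_trans h3 (ler_wpM2l (ler0n R m) h4)).
  have h6 := ler_wpM2l (ltW l0) hU.
  have : #|Z|%:R <= #|U|%:R + #|Z'|%:R :> R by rewrite -natrD ler_nat.
  move: h2 h5 h6 hU; rewrite -/Z'; lra.
move=> Z Y hZ dis h3.
have k3 : (3 * #|Y| <= #|S :&: joins Z Y|)%N.
  apply: leq_trans (_ : \sum_(z in Z) \sum_(y in Y) sample_adj S z y <= _)%N; last first.
    apply: sum_joins_le => z y zZ yY z' y' zZ' yY' _ /nedge_inj[[-> ->]//|[e1 e2]].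
    by have := disjointFr dis zZ; rewrite e1 yY'.
  rewrite exchange_big /= mulnC -sum_nat_const; apply: leq_sum => y yY.
  by apply: leq_trans (h3 y yY) _; apply: leq_sum => z _; apply: subadj.
have t1 : 0 < 1 + t by rewrite addr_gt0.
have tp1 : 0 < 1 + t * p by rewrite addr_gt0 // mulr_gt0.
have := fan Z Y; rewrite -exprD => /(ln_union_bound t1 tp1 N0 l100); rewrite -/l natrD => h4.
have ltp : ln (1 + t * p) <= t * p by apply: le_ln1Dx; have := mulr_gt0 t0 p0; lra.
have c4 : #|joins Z Y|%:R <= #|Z|%:R * #|Y|%:R :> R by rewrite -natrM ler_nat card_joins.
have tz : t * p * z0 = 1 by rewrite /t; field; rewrite !gt_eqF //; lra.
have h5 : #|joins Z Y|%:R * ln (1 + t * p) <= #|Y|%:R.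
  apply: (@le_trans _ _ (#|joins Z Y|%:R * (t * p))); first by rewrite ler_wpM2l.
  apply: (@le_trans _ _ (z0 * #|Y|%:R * (t * p))); last first.
    have -> : z0 * #|Y|%:R * (t * p) = t * p * z0 * #|Y|%:R by ring.
    by rewrite tz mul1r.
  apply: ler_wpM2r; first by rewrite mulr_ge0 // ltW.
  by apply: le_trans c4 _; apply: ler_wpM2r.
have h6 : 3 * #|Y|%:R * (9 / 20 * l) <= #|S :&: joins Z Y|%:R * ln (1 + t).
  apply: ler_pM => //; last by rewrite -natrM ler_nat.
  by have := l0; lra.
have Y0 : 0 <= #|Y|%:R :> R by [].
have h7 := ler_wpM2l Y0 l100.
have h8 := ler_wpM2r (ltW l0) hZ.
(* Three edges per vertex gain [3 * 9/20], more than the entropy 1 per vertex of [Y]; two edges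
   would gain only [9/10]. *)
have h9 : l * (27 / 20 * #|Y|%:R) <= l * (1 + z0 + (1 + 1 / 100) * #|Y|%:R).
  by move: h4 h5 h6 h7 h8; move: (#|Y|%:R) (#|Z|%:R) => y z; lra.
move: h9; rewrite ler_pM2l // => h9; lra.
Qed.

End LogBounds.

(** * Growth of the hard-core partition function *)

Section Growth.
Variables (R : realType) (q r : R).
Hypothesis q0 : 0 < q.
Hypothesis r0 : 0 < r.
Hypothesis r2 : r <= 1 / 2.

Definition growth (t : R) : R := ln (r * q * t) ^+ 2 / (2 * r).

Let rq0 : 0 < r * q. Proof. exact: mulr_gt0. Qed.

Lemma growth_le (t t' : R) : 0 < t -> 0 <= ln (r * q * t) -> t <= t' -> growth t <= growth t'.
Proof.
move=> t0 lt tt'; rewrite /growth ler_pM2r ?invr_gt0 ?mulr_gt0 //.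
have t'0 : 0 < t' by apply: lt_le_trans tt'.
have le : ln (r * q * t) <= ln (r * q * t').
  by rewrite ler_ln ?posrE ?mulr_gt0 // ler_pM2l.
by rewrite ler_pXn2r ?nnegrE //; apply: le_trans le.
Qed.

Lemma growth_ge0 t : 0 <= growth t.
Proof. by rewrite divr_ge0 ?sqr_ge0 // mulr_ge0 // ltW. Qed.

Lemma ln_shift (s t : R) : 0 < s -> 0 < t -> ln (r * q * s) = ln (r * q * t) + ln (s / t).
Proof.
move=> s0 t0; rewrite -lnM ?posrE ?mulr_gt0 ?invr_gt0 //; congr ln.
by field; rewrite gt_eqF.
Qed.

(* [growth] solves [g'(s) = ln (r q s) / (r s)], a supersolution of the differential form
   [g'(s) = q exp (- r s g'(s))] of the recursion for the partition function. *)
Lemma growth_step (s : R) : 8 <= s -> 3 <= ln (r * q * s) ->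
  [/\ 0 <= ln (r * q * (s - 1)), 0 <= ln (r * q * (s - 1 - r * s)) &
  expR (growth (s - 1)) + q * expR (growth (s - 1 - r * s)) <= expR (growth s)].
Proof.
move=> s8 l3; set a := s - 1; set b := a - r * s.
have s0 : 0 < s by lra.
have a0 : 0 < a by rewrite /a; lra.
have rs : r * s <= s / 2 by have := ler_wpM2r (ltW s0) r2; lra.
have rs0 : 0 < r * s by rewrite mulr_gt0.
have b38 : 3 / 8 * s <= b by rewrite /b /a; lra.
have b0 : 0 < b by lra.
have rN : r != 0 by rewrite gt_eqF.
set sg := ln (r * q * s) in l3; set al := ln (r * q * a); set be := ln (r * q * b).
have e1 : sg = al + ln (s / a) by apply: ln_shift.
have e2 : al = be + ln (a / b) by apply: ln_shift.
have sa0 : 0 < s / a by rewrite divr_gt0.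
have ab0 : 0 < a / b by rewrite divr_gt0.
have d1 : s^-1 <= ln (s / a).
  apply: le_trans (ln_ge_1BV sa0); rewrite invf_div.
  rewrite le_eqVlt; apply/orP; left; apply/eqP; rewrite /a; field.
  by rewrite gt_eqF.
have d1' : ln (s / a) <= 1.
  have -> : s / a = 1 + a^-1 by rewrite /a; field; rewrite gt_eqF //; lra.
  apply: le_trans (le_ln1Dx _) _; first by apply: lt_trans (_ : 0 < _); rewrite ?invr_gt0 //; lra.
  by rewrite invf_le1 //; rewrite /a; lra.
have d2 : r <= ln (a / b).
  apply: le_trans (ln_ge_1BV ab0); rewrite invf_div.
  have : b / a <= 1 - r by rewrite ler_pdivrMr // /b /a; have := r0; lra.
  lra.
have d2' : ln (a / b) <= 2.
  have := @le_ln1Dx R (a / b - 1); rewrite [1 + _]addrC subrK => h.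
  apply: le_trans (h _) _; first by lra.
  have : a / b <= 3 by rewrite ler_pdivrMr // /a; lra.
  lra.
have al2 : 2 <= al by lra.
have be0 : 0 <= be by lra.
split; [lra | lra |].
have r20 : 0 < 2 * r by rewrite mulr_gt0.
have g1 : al / (r * s) <= growth s - growth a.
  rewrite /growth -/sg -/al -mulrBl ler_pdivlMr //.
  have -> : al / (r * s) * (2 * r) = 2 * al * s^-1 by field; rewrite rN gt_eqF.
  have -> : sg ^+ 2 - al ^+ 2 = ln (s / a) * (2 * al + ln (s / a)) by rewrite e1; ring.
  have si0 : 0 < s^-1 by rewrite invr_gt0.
  move: (s^-1) (ln (s / a)) d1 si0 => y d h1 h2; clear - al2 h1 h2; nra.
(* Removing the neighbourhood lowers the logarithm by at least [r], so [growth] falls by nearly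
   [al], and [exp (- al)] cancels the fugacity up to [1 / (r a)]. *)
have g2 : al - r / 2 <= growth a - growth b.
  rewrite /growth -/al -/be -mulrBl ler_pdivlMr //.
  have -> : al ^+ 2 - be ^+ 2 = ln (a / b) * (2 * al - ln (a / b)) by rewrite e2; ring.
  move: (ln (a / b)) d2 d2' => d h1 h2; have := r2; clear - al2 h1 h2; nra.
have qE : q * expR (- al) = (r * a)^-1.
  rewrite /al -lnV ?posrE ?mulr_gt0 // lnK ?posrE ?invr_gt0 ?mulr_gt0 //.
  by field; rewrite !gt_eqF.
have er : expR (r / 2) <= 4 / 3.
  have : expR (- (r / 2)) >= 3 / 4 by apply: le_trans (expR_ge1Dx _); have := r2; lra.
  rewrite expRN => h; have e0 := expR_gt0 (r / 2).
  by have := ler_wpM2r (ltW e0) h; rewrite mulVf ?gt_eqF //; lra.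
have sb : q * expR (growth b) <= expR (growth a) * (4 / 3 / (r * a)).
  apply: (@le_trans _ _ (q * (expR (growth a) * (expR (- al) * expR (r / 2))))).
    by rewrite ler_pM2l // -!expRD ler_expR; lra.
  rewrite [X in X <= _](_ : _ = expR (growth a) * (q * expR (- al) * expR (r / 2))); last by ring.
  rewrite qE ler_pM2l ?expR_gt0 // mulrC ler_pM2r // invr_gt0 mulr_gt0 //.
have sb' : expR (growth a) * (1 + al / (r * s)) <= expR (growth s).
  have -> : growth s = growth a + (growth s - growth a) by ring.
  rewrite expRD ler_pM2l ?expR_gt0 //; apply: le_trans (_ : expR (al / (r * s)) <= _).
    exact: expR_ge1Dx.
  by rewrite ler_expR.
apply: le_trans sb'; rewrite mulrDr mulr1 lerD2l; apply: le_trans sb _.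
(* What remains is [4/3 <= al * a / s], true with room since [al >= 2] and [s >= 8]. *)
rewrite ler_pM2l ?expR_gt0 // ler_pdivrMr ?mulr_gt0 //.
have -> : al / (r * s) * (r * a) = al * a / s by field; rewrite rN gt_eqF.
rewrite ler_pdivlMr //.
have : 2 * a <= al * a by rewrite ler_pM2r.
rewrite /a; lra.
Qed.

(** Induction on the size with the recursion at a vertex of high degree. A smaller set that drops to
    size [M0] or below is covered by [B] alone, because [growth] is nonnegative. *)
Lemma hardcore_growth (T : finType) (G : sgraph T) (B M0 M1 : R) :
  8 <= M0 -> 3 <= ln (r * q * M0) -> 0 <= B ->
  (forall S : {set T}, #|S|%:R <= M0 -> hardcore G q S <= B) ->
  (forall S : {set T}, M0 < #|S|%:R -> #|S|%:R <= M1 ->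
    exists2 v, v \in S & r * #|S|%:R <= #|[set w in S | adj G v w]|%:R) ->
  forall S : {set T}, M0 < #|S|%:R -> #|S|%:R <= M1 ->
    hardcore G q S <= B * expR (growth #|S|%:R).
Proof.
move=> M8 l3 B0 hB hv S; move: {2}#|S| (leqnn #|S|) => n; elim: n S => [|n IH] S cS S0 S1.
  by move: S0; rewrite leqn0 in cS; rewrite (eqP cS) ltNge; have := M8; lra.
have s8 : 8 <= #|S|%:R :> R by have := M8; lra.
have s0 : 0 < #|S|%:R :> R by have := M8; lra.
have M00 : 0 < M0 by have := M8; lra.
have ls : 3 <= ln (r * q * #|S|%:R).
  apply: le_trans l3 _; rewrite ler_ln ?posrE ?mulr_gt0 // ler_pM2l ?mulr_gt0 // ltW //.
have [la lb step] := growth_step s8 ls.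
have [v vS dv] := hv S S0 S1.
apply: le_trans (hardcore_rec G (ltW q0) vS) _.
have cv : #|S :\ v|%:R = #|S|%:R - 1 :> R by rewrite [in RHS](cardsD1 v S) vS addnC natrD addrK.
have sub t (S' : {set T}) : 0 < t -> 0 <= ln (r * q * t) -> #|S'|%:R <= t -> (#|S'| <= n)%N ->
    #|S'|%:R <= M1 -> hardcore G q S' <= B * expR (growth t).
  move=> t0 lt S't S'n S'M; have [h|h] := leP (#|S'|%:R) M0.
    apply: le_trans (hB _ h) _; rewrite ler_peMr //; apply: le_trans (expR_ge1Dx _).
    by rewrite lerDl growth_ge0.
  apply: le_trans (IH _ S'n h S'M) _; rewrite ler_wpM2l // ler_expR; apply: growth_le => //.
    by apply: lt_trans h.
  apply: (@le_trans _ _ 3) => //; apply: le_trans l3 _.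
  by rewrite ler_ln ?posrE ?mulr_gt0 ?(lt_trans M00 h) // ler_pM2l ?mulr_gt0 // ltW.
set S2 := (S :\ v) :\: _.
have c2 : #|S2|%:R <= #|S|%:R - 1 - r * #|S|%:R.
  have : (#|S2| + #|[set w in S | adj G v w]| <= #|S :\ v|)%N.
    rewrite -(cardsID [set w | adj G v w] (S :\ v)) addnC leq_add2r.
    apply/subset_leq_card/fintype.subsetP => w; rewrite !inE => /andP[wS vw].
    rewrite wS vw !andbT; apply: contraTneq vw => ->; by rewrite adj_irrefl.
  rewrite -(ler_nat R) natrD cv; lra.
have n1 : (#|S :\ v| <= n)%N by move: cS; rewrite (cardsD1 v S) vS.
have n2 : (#|S2| <= n)%N by apply: leq_trans n1; apply/subset_leq_card/finset.subsetDl.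
have rs : r * #|S|%:R <= #|S|%:R / 2 by have := ler_wpM2r (ltW s0) r2; lra.
have rs0 : 0 < r * #|S|%:R by rewrite mulr_gt0.
have z1 : hardcore G q (S :\ v) <= B * expR (growth (#|S|%:R - 1)).
  by apply: sub => //; rewrite ?cv //; move: s8 S1; lra.
have z2 : hardcore G q S2 <= B * expR (growth (#|S|%:R - 1 - r * #|S|%:R)).
  by apply: sub => //; move: s8 S1 rs rs0 c2; lra.
have := ler_wpM2l B0 step; have := ler_wpM2l (ltW q0) z2; move: z1; lra.
Qed.

End Growth.

Lemma max_degree_ge (R : realFieldType) (A : finType) (h : rel A) (hs : symmetric h)
    (hi : irreflexive h) (S : {set A * A}) (c : R) :
  0 < #|S|%:R :> R -> c * #|S|%:R ^+ 2 <= edge_pairs R h S ->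
  exists2 v, v \in S & c * #|S|%:R <= #|[set w in S | adj (product_graph hs hi) v w]|%:R.
Proof.
move=> S0 hc.
have degE v : \sum_(w in S) (product_adj h v w)%:R =
    #|[set w in S | adj (product_graph hs hi) v w]|%:R :> R.
  rewrite -natr_sum -sum1_card; congr _%:R; rewrite big_mkcond [RHS]big_mkcond /=.
  by apply: eq_bigr => w _; rewrite inE /=; case: (w \in S); case: (product_adj h v w).
have [||v vS hv] := @sum_ge_exists R _ S
    (fun v => - #|[set w in S | adj (product_graph hs hi) v w]|%:R) (- (c * #|S|%:R)).
- by rewrite -card_gt0 -(ltr0n R).
- rewrite sumrN mulrN lerN2 (eq_bigr _ (fun v _ => esym (degE v))).
  by apply: le_trans hc; rewrite expr2 mulrCA.
by exists v => //; rewrite -lerN2.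
Qed.

(** The bound reached at size [M1] with rate [r2] is the starting value [B] for the phase with rate
    [r1]. *)
Lemma hardcore_two_phase (R : realType) (A : finType) (h : rel A) (hs : symmetric h)
    (hi : irreflexive h) (q r1 r2 M M1 : R) :
  0 < q -> 0 < r1 -> r1 <= 1 / 2 -> 0 < r2 -> r2 <= 1 / 2 ->
  8 <= M -> M <= M1 -> M1 < (#|A|%:R) ^+ 2 ->
  3 <= ln (r2 * q * M) -> 3 <= ln (r1 * q * M1) ->
  (forall S : {set A * A}, M <= #|S|%:R -> r2 * #|S|%:R ^+ 2 <= edge_pairs R h S) ->
  (forall S : {set A * A}, M1 <= #|S|%:R -> r1 * #|S|%:R ^+ 2 <= edge_pairs R h S) ->
  hardcore (product_graph hs hi) q [set: A * A] <=
  expR (q * M + growth q r2 M1 + growth q r1 ((#|A|%:R) ^+ 2)).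
Proof.
move=> q0 r10 r1h r20 r2h M8 MM1 M1A l2 l1 e2 e1.
have M0 : 0 < M by lra.
have M10 : 0 < M1 by lra.
have b0 (S : {set A * A}) : #|S|%:R <= M -> hardcore (product_graph hs hi) q S <= expR (q * M).
  move=> hS; apply: le_trans (hardcore_le_expn _ _ (ltW q0)) _.
  apply: (@le_trans _ _ (expR q ^+ #|S|)).
    have q1 : 0 <= 1 + q by rewrite addr_ge0 // ltW.
    by rewrite lerXn2r ?nnegrE ?expR_ge0 ?expR_ge1Dx.
  by rewrite -expRM_natr ler_expR ler_pM2l.
have b1 (S : {set A * A}) : #|S|%:R <= M1 ->
    hardcore (product_graph hs hi) q S <= expR (q * M + growth q r2 M1).
  move=> hS; rewrite expRD; have [hM|hM] := leP (#|S|%:R) M.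
    apply: le_trans (b0 _ hM) _; rewrite ler_peMr ?expR_ge0 //.
    by apply: le_trans (expR_ge1Dx _); rewrite lerDl growth_ge0.
  have S0 : 0 < #|S|%:R :> R by apply: lt_trans hM.
  apply: le_trans (hardcore_growth q0 r20 r2h (M1 := M1) M8 l2 (expR_ge0 _) b0 _ hM hS) _.
    move=> S' hS' _; apply: max_degree_ge; first exact: lt_trans hS'.
    by apply: e2; apply: ltW.
  rewrite ler_pM2l ?expR_gt0 // ler_expR; apply: growth_le => //.
  apply: le_trans (_ : 3 <= _) => //; apply: le_trans l2 _.
  by rewrite ler_ln ?posrE ?mulr_gt0 // ler_pM2l ?mulr_gt0 // ltW.
have cT : #|[set: A * A]|%:R = (#|A|%:R) ^+ 2 :> R.
  by rewrite cardsT card_prod natrM expr2.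
have M18 : 8 <= M1 by lra.
rewrite expRD -cT.
apply: (hardcore_growth q0 r10 r1h (M1 := (#|A|%:R) ^+ 2) M18 l1 (expR_ge0 _) b1) => //.
- move=> S' hS' _; apply: max_degree_ge; first exact: lt_trans hS'.
  by apply: e1; apply: ltW.
- by rewrite cT.
by rewrite cT.
Qed.

(** * Numerical assembly of the exponent *)

Lemma ln_ge3 (R : realType) (y : R) : 64 <= y -> 3 <= ln y.
Proof.
move=> y64; have : ln (2 ^+ 6) <= ln y.
  by rewrite ler_ln ?posrE ?exprn_gt0 //; [apply: le_trans y64; lra | lra].
rewrite lnXn // -[ln 2 *+ 6]mulr_natl; have := ln2_ge R; lra.
Qed.

Lemma ln_mul_le (R : realType) (c s t : R) : 0 < c -> 0 < s -> s <= t ->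
  ln (c * s) <= ln (c * t).
Proof.
move=> c0 s0 st; have t0 := lt_le_trans s0 st.
by rewrite ler_ln ?posrE ?mulr_gt0 // ler_pM2l.
Qed.

(** The factor 5 is [10 / 2]: one divides by [2 c p], and [1 / p = 10 x / l]. *)
Lemma growth_bound (R : realType) (q p t l x a c : R) : 0 < p -> 0 < c -> 10 * p * x = l ->
  0 <= ln (c * p * q * t) -> ln (c * p * q * t) <= a * l ->
  growth q (c * p) t <= 5 * a ^+ 2 / c * l * x.
Proof.
move=> p0 c0 px h0 hB; apply: (@le_trans _ _ ((a * l) ^+ 2 / (2 * (c * p)))).
  rewrite /growth ler_pM2r ?invr_gt0 ?mulr_gt0 //.
  by rewrite ler_pXn2r ?nnegrE //; apply: le_trans hB.
rewrite le_eqVlt; apply/orP; left; apply/eqP; rewrite -px; field.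
by rewrite !gt_eqF.
Qed.

Lemma constants_exist (R : realType) (l x : R) : 10000 <= l -> l ^+ 100 <= x ->
  exists m D k v : nat, constants l x (l / (10 * x)) m%:R D%:R k%:R v%:R.
Proof.
move=> L X.
have l0 : 0 < l by clear -L; lra.
have lp j : 0 < l ^+ j by rewrite exprn_gt0.
have x0 : 0 < x by apply: lt_le_trans X.
set p := l / (10 * x).
have p0 : 0 < p by rewrite divr_gt0 // mulr_gt0.
have px : 10 * p * x = l by rewrite /p; field; rewrite gt_eqF.
have ti (y : R) : 0 <= y -> (Num.truncn y)%:R <= y /\ y - 1 <= (Num.truncn y)%:R.
  move=> y0; have /andP[h1] := truncn_itv y0; rewrite -natr1 => h2; split => //.
  by rewrite lerBlDr ltW.
pose y := x ^+ 2 / l ^+ 40; pose m := Num.truncn y.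
have yx : y * l ^+ 40 = x ^+ 2 by rewrite /y divfK // gt_eqF.
have y0 : 0 <= y by rewrite divr_ge0 ?sqr_ge0 // ltW.
have [m_le m_ge] := ti y y0; rewrite -/m in m_le m_ge.
have y2 : 2 <= y.
  rewrite ler_pdivlMr //.
  have h1 : l ^+ 100 * l ^+ 100 <= x ^+ 2.
    by rewrite expr2; apply: ler_pM => //; apply: ltW.
  rewrite -exprD in h1; apply: le_trans h1; apply: le_trans (pow_le L (isT : (41 <= 200)%N)).
  by apply: le_trans (pow_step 40 L); rewrite ler_pM2r //; clear; lra.
have m_half : y <= 2 * m%:R by clear -m_ge y2; lra.
have m_up : m%:R * l ^+ 40 <= x ^+ 2 by rewrite -yx ler_pM2r.
have m_lo : x ^+ 2 <= 2 * m%:R * l ^+ 40 by rewrite -yx ler_pM2r.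
have m0 : 0 < m%:R :> R by clear -m_half y2; lra.
have pm0 : 0 <= 11 / 10 * (p * m%:R) by have := mulr_gt0 p0 m0; clear; lra.
have lx0 : 0 <= l ^+ 2 * x by rewrite mulr_ge0 // ltW.
have ml0 : 0 <= m%:R / l ^+ 3 by rewrite divr_ge0 // ltW.
have [D_up D_lo] := ti _ pm0; have [k_up k_lo] := ti _ lx0; have [v_up v_lo] := ti _ ml0.
exists m, (Num.truncn (11 / 10 * (p * m%:R))), (Num.truncn (l ^+ 2 * x)),
  (Num.truncn (m%:R / l ^+ 3)); split => //.
- by rewrite -ler_pdivlMr.
by rewrite -ler_pdivrMr // -lerBlDr.
Qed.

(** The three coefficients are [0.693], about [0.0387] and about [0.8334]; their sum stays below
    [1 + 7/12]. *)
Lemma exponent_sum (R : realType) (l x a b c : R) : 0 < l * x ->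
  a <= 693 / 1000 * l * x -> b <= 5 * (44 / (5 * 10000)) ^+ 2 / (1 / 10000) * l * x ->
  c <= 5 * (1 / 2 + 1 / (5 * 10000)) ^+ 2 / (3 / 2) * l * x ->
  a + b + c <= (1 + ln 2) * x * l.
Proof.
move=> lx; have := ler_wpM2r (ltW lx) (ln2_ge R); move: (ln 2) lx => y.
rewrite -[693 / 1000 * l * x]mulrA -[5 * _ / (1 / 10000) * l * x]mulrA -[5 * _ / (3 / 2) * l * x]mulrA.
rewrite -[_ * x * l]mulrA [x * l]mulrC; move: (l * x) => t; lra.
Qed.

(** Up to powers of [l] the density is [n^(-1/2)], and these powers cost at most [18 ln l], far
    below [l / 20]. *)
Lemma ln_density_bound (R : realType) (l x p : R) : 10000 <= l -> 0 < x -> ln x = l / 2 ->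
  ln l <= l / (5 * 10000) -> 0 < p -> 10 * p * x = l -> 9 / 20 * l <= ln (1 + (p * l ^+ 17)^-1).
Proof.
move=> L x0 lnx lnl p0 px.
have l0 : 0 < l by clear -L; lra.
have lp : 0 < l ^+ 17 by rewrite exprn_gt0.
have t0 : 0 < (p * l ^+ 17)^-1 by rewrite invr_gt0 mulr_gt0.
have h1 : ln ((p * l ^+ 17)^-1) <= ln (1 + (p * l ^+ 17)^-1).
  by rewrite ler_ln ?posrE ?addr_gt0 // lerDr.
have h2 : ln p <= ln l - l / 2.
  rewrite -lnx -ln_div ?posrE // ler_ln ?posrE ?divr_gt0 // ler_pdivlMr // -px -mulrA.
  by rewrite ler_peMl ?mulr_ge0 ?(ltW p0) ?(ltW x0) //; clear; lra.
apply: le_trans h1; rewrite lnV ?posrE ?mulr_gt0 // lnM ?posrE // lnXn //.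
by rewrite -[ln l *+ 17]mulr_natl; clear -h2 lnl L; lra.
Qed.

Lemma few_independent_sets (R : realType) (n : nat) :
  10000 <= ln n%:R :> R -> ln (ln n%:R) <= ln n%:R / (5 * 10000) :> R ->
  exists G : sgraph 'I_n, triangle_free G /\
    (num_indep G)%:R <= expR ((1 + ln 2) * Num.sqrt n%:R * ln n%:R : R).
Proof.
set l := ln n%:R => L lnl.
have n0 : (0 < n)%N.
  rewrite lt0n; apply/eqP => n0; move: L; rewrite /l n0 ln0 //; clear; lra.
have nR : 0 < n%:R :> R by rewrite ltr0n.
set x := Num.sqrt n%:R.
have x0 : 0 < x by rewrite sqrtr_gt0.
have x2 : x ^+ 2 = n%:R by rewrite sqr_sqrtr // ltW.
have l0 : 0 < l by clear -L; lra.
have lnx : ln x = l / 2.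
  have : ln (x ^+ 2) = l by rewrite x2.
  by rewrite lnXn // -[ln x *+ 2]mulr_natl => <-; field.
have X : l ^+ 100 <= x.
  rewrite -ler_ln ?posrE ?exprn_gt0 // lnXn // lnx -[ln l *+ 100]mulr_natl.
  by clear -lnl l0; lra.
have [m [D [k [v C]]]] := constants_exist L X.
set p := l / (10 * x) in C.
have p0 := const_p0 C; have px := const_px C; have m0 := const_m0 C.
have p4 := const_p_half C.
have p1 : p <= 1 by clear -p4; lra.
have l100 : 100 <= l by clear -L; lra.
have D60 := D_ge C.
have lp j : 0 < l ^+ j by rewrite exprn_gt0.
have u00 : 0 <= l ^+ 6 * D%:R by rewrite mulr_ge0 // ltW.
have z4 : 4 <= l ^+ 17.
  by apply: le_trans (pow_le L (isT : (1 <= 17)%N)); rewrite expr1; clear -L; lra.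
have lz := ln_density_bound L x0 lnx lnl p0 px.
have mn : 2 * m%:R <= n%:R :> R by rewrite -x2; apply: const_m_small C.
(* The exponents form a chain: [v] is about [m / l^3], so [u0 = l^6 D] makes [u0 v] exceed [K D m];
   then [T = D / l^9] keeps [K T u0] below [D^2], and [z0 = l^17] makes [z0 T] exceed [K u0]. *)
have [h bg] := @base_graph_exists R m n D p (l ^+ 6 * D%:R) (l ^+ 17) p0 p1 n0 l100 mn
  (const_pm C) (D_ge_P C) z4 u00 lz.
have K0 : 0 < 200 * l by rewrite mulr_gt0.
have hs := base_sym bg; have hi := base_irr bg.
have cm : #|'I_m|%:R = m%:R :> R by rewrite card_ord.
pose M : R := 63 / 10 * D%:R * m%:R.
pose M1 : R := m%:R * x * l ^+ 3.
have k0 : (0 < k)%N by rewrite -(ltr0n R); apply: const_k0 C.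
have D0 : (0 < D)%N by rewrite -(ltr0n R); apply: lt_le_trans D60.
have kv : (k <= v)%N by rewrite -(ler_nat R); apply: (const_kv C).
have med (S : {set 'I_m * 'I_m}) : M <= #|S|%:R -> 1 / 10000 * p * #|S|%:R ^+ 2 <= edge_pairs R h S.
  move=> hS.
  apply: (edge_pairs_medium p0 K0 bg (T := D%:R / l ^+ 9) (a := l ^- 4) k0 kv); rewrite ?cm //.
  - exact: const_k C.
  - exact: const_pD C.
  - exact: const_pu C.
  - exact: const_T C.
  - exact: const_z C.
  - exact: const_z_D C.
  - exact: const_cherry C.
  - exact: const_u C.
  - exact: const_v C.
  - by rewrite invr_gt0.
  - exact: const_kD C.
  - exact: const_thin C.
  - exact: const_a C.
  exact: const_ka C.
have lar (S : {set 'I_m * 'I_m}) : M1 <= #|S|%:R -> 3 / 2 * p * #|S|%:R ^+ 2 <= edge_pairs R h S.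
  move=> hS; apply: (edge_pairs_large p0 K0 bg k0); rewrite ?cm.
  - exact: const_k C.
  - exact: const_pD C.
  - by apply: le_trans hS; apply: (const_large_k C).
  - by apply: le_trans hS; apply: (const_large_D C).
  apply: (@le_trans _ _ (p * M1)); last by rewrite ler_pM2l.
  exact: const_large_DD C.
pose q := x ^+ 2 / m%:R ^+ 2.
have q0 : 0 < q by rewrite divr_gt0 // exprn_gt0.
have M8 : 8 <= M by apply: (const_M_ge C).
have MM1 : M <= M1 by apply: (const_MM1 C).
have M1m : M1 < m%:R ^+ 2 by apply: (const_M1 C).
have M0 : 0 < M by clear -M8; lra.
have M10 : 0 < M1 by apply: lt_le_trans MM1.
have lm2 : 3 <= ln (1 / 10000 * p * q * M) by apply: ln_ge3; apply: (const_ln2M C).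
have lm1 : 3 <= ln (3 / 2 * p * q * M1) by apply: ln_ge3; apply: (const_ln1M1 C).
have r10 : 0 < 3 / 2 * p by clear -p0; lra.
have r20 : 0 < 1 / 10000 * p by clear -p0; lra.
have r1h : 3 / 2 * p <= 1 / 2 by clear -p4; lra.
have r2h : 1 / 10000 * p <= 1 / 2 by clear -p4 p0; lra.
have Z : hardcore (product_graph hs hi) q [set: 'I_m * 'I_m] <=
    expR (q * M + growth q (1 / 10000 * p) M1 + growth q (3 / 2 * p) (m%:R ^+ 2)).
  have := @hardcore_two_phase R _ h hs hi q (3 / 2 * p) (1 / 10000 * p) M M1 q0 r10 r1h r20 r2h M8 MM1.
  by rewrite cm; apply.
have cA : #|{: 'I_m * 'I_m}|%:R = m%:R ^+ 2 :> R by rewrite card_prod card_ord natrM expr2.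
have nT : (n <= #|{: 'I_m * 'I_m}|)%N.
  by rewrite -(ler_nat R) cA -x2; apply: (const_x_le_m C).
have [G [tf hG]] := exists_sparse_pullback R n0 nT 
  (@product_triangle_free _ h hs hi (base_triangle_free bg)).
exists G; split => //; apply: le_trans hG _; rewrite cA -x2 -/q.
apply: le_trans Z _; rewrite ler_expR.
have rq1 := mulr_gt0 r10 q0; have rq2 := mulr_gt0 r20 q0.
have e2 : growth q (1 / 10000 * p) M1 <= 5 * (44 / (5 * 10000)) ^+ 2 / (1 / 10000) * l * x.
  have c0 : 0 < 1 / 10000 :> R by clear; lra.
  apply: (growth_bound p0 c0 px).
    exact: (le_trans (ler0n R 3) (le_trans lm2 (ln_mul_le rq2 M0 MM1))).
  apply: (@le_trans _ _ (ln (l ^+ 44))).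
    rewrite ler_ln ?posrE; [exact: const_ln2M1 C | exact: (mulr_gt0 rq2 M10) | exact: lp].
  rewrite lnXn; last exact: l0.
  rewrite -[ln l *+ 44]mulr_natl [44 / _ * l]mulrAC -mulrA ler_pM2l; last exact: ltr0n.
  exact: lnl.
have e3 : growth q (3 / 2 * p) (m%:R ^+ 2) <=
    5 * (1 / 2 + 1 / (5 * 10000)) ^+ 2 / (3 / 2) * l * x.
  have c0 : 0 < 3 / 2 :> R by clear; lra.
  apply: (growth_bound p0 c0 px).
    exact: (le_trans (ler0n R 3) (le_trans lm1 (ln_mul_le rq1 M10 (ltW M1m)))).
  apply: (@le_trans _ _ (ln (l * x))).
    rewrite ler_ln ?posrE; [exact: const_ln1m C | | exact: mulr_gt0].
    exact: (mulr_gt0 rq1 (lt_trans M10 M1m)).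
  rewrite lnM ?posrE; [|exact: l0|exact: x0].
  by rewrite lnx; move: lnl; clear; move: (ln l) => y; lra.
exact: (exponent_sum (mulr_gt0 l0 x0) (const_qM C) e2 e3).
Qed.

Lemma num_indep_le (T : finType) (G : sgraph T) : (num_indep G <= 2 ^ #|T|)%N.
Proof.
by apply: leq_trans (max_card _) _; rewrite -cardsT -powersetT card_powerset cardsT.
Qed.

Lemma edgeless_graph_exists (T : finType) : exists G : sgraph T, triangle_free G.
Proof.
have s : symmetric (fun _ _ : T => false) by [].
have i : irreflexive (fun _ _ : T => false) by [].
by exists (SGraph s i) => x y z [].
Qed.

Lemma eventually_large_log (R : realType) : exists n0 : nat, forall n : nat, (n0 <= n)%N ->
  10000 <= ln n%:R :> R /\ ln (ln n%:R) <= ln n%:R / (5 * 10000) :> R.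
Proof.
(* With [y = sqrt l], [ln l = 2 ln y <= 2 y], which is at most [y^2 / 50000] once [y >= 10^5]; hence
   [E = 10^10]. *)
have [E EE] : exists E : R, E = (10 * 10000) * (10 * 10000) by eexists.
have E1 : 10000 <= E by rewrite EE; lra.
exists (Num.truncn (expR E)).+1 => n hn.
have /andP[_ h] := truncn_itv (expR_ge0 E).
have hE : E <= ln n%:R.
  rewrite -[E]expRK ler_ln ?posrE ?expR_gt0 //.
    by apply: le_trans (ltW h) _; rewrite ler_nat.
  by apply: lt_le_trans (expR_gt0 E) _; apply: le_trans (ltW h) _; rewrite ler_nat.
move: (ln n%:R) hE => l hE; have l0 : 0 < l by lra.
split; first by lra.
set y := Num.sqrt l; have y0 : 0 < y by rewrite sqrtr_gt0.
have yy : y ^+ 2 = l by rewrite sqr_sqrtr // ltW.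
have hy : 10 * 10000 <= y.
  rewrite leNgt; apply/negP => yl.
  have : y * y < 10 * 10000 * (10 * 10000) by apply: ltr_pM => //; apply: ltW.
  by rewrite -EE -expr2 yy; lra.
have ly : ln y <= y.
  have := @le_ln1Dx R (y - 1); rewrite [1 + _]addrC subrK => hh; apply: le_trans (hh _) _; lra.
rewrite -yy lnXn // -[ln y *+ 2]mulr_natl.
have := ler_wpM2r (ltW y0) hy; rewrite expr2; lra.
Qed.

Import numFieldNormedType.Exports.
Local Open Scope classical_set_scope.

Theorem theorem2 (R : realType) :
  exists delta : nat -> R,
    (delta n @[n --> \oo] --> (0 : R)) /\
    forall n : nat, (2 <= n)%N ->
      exists G : sgraph 'I_n,
        triangle_free G /\
        (num_indep G)%:R <=
          expR ((1 + delta n) * (1 + ln 2) * Num.sqrt n%:R * ln n%:R).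
Proof.
have [n0 hn0] := eventually_large_log R.
(* For the finitely many small [n] the edgeless graph suffices: [delta n * ln n = n], and it has at
   most [2^n <= exp n] independent sets. *)
exists (fun n => if (n0 <= n)%N then 0 else n%:R / ln n%:R); split.
  apply: cvg_near_cst; near=> n; rewrite ifT //.
  by near: n; apply: nbhs_infty_ge.
move=> n n2; case: ifP => [/hn0[h1 h2]|_].
  by rewrite addr0 mul1r; apply: few_independent_sets.
have [G tf] := edgeless_graph_exists 'I_n; exists G; split => //.
have n1 : 1 < n%:R :> R by rewrite ltr1n.
have ln0 : 0 < ln n%:R :> R by apply: ln_gt0.
have s1 : 1 <= Num.sqrt n%:R :> R by rewrite -[X in X <= _]sqrtr1 ler_wsqrtr // ltW.
have l2 := ln2_ge R.
apply: (@le_trans _ _ (expR n%:R)).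
  apply: (@le_trans _ _ (expR 1 ^+ n)); last by rewrite -expRM_natr mul1r.
  apply: (@le_trans _ _ (2 ^+ n)).
    by rewrite -natrX ler_nat; have := num_indep_le G; rewrite card_ord.
  by rewrite lerXn2r ?nnegrE ?expR_ge0 //; apply: le_trans (expR_ge1Dx _); lra.
rewrite ler_expR.
have d0 : 0 <= n%:R / ln n%:R :> R by rewrite divr_ge0 // ltW.
rewrite -[X in X <= _](divfK (lt0r_neq0 ln0)) ler_pM2r //.
set d := n%:R / ln n%:R in d0 *; set c := Num.sqrt _ in s1 *.
apply: (@le_trans _ _ ((1 + d) * (1 + ln 2) * 1)); last first.
  by apply: ler_wpM2l => //; apply: mulr_ge0; lra.
by rewrite mulr1; apply: (@le_trans _ _ ((1 + d) * 1)); [lra | apply: ler_wpM2l; lra].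
Unshelve. all: by end_near.
Qed.
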